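(* Let $(\boldsymbol{X}_t)_{t\in\mathbb{R}_+}$ be a multi-type CBI process with parameters $(d,\boldsymbol{c},\boldsymbol{\beta},\boldsymbol{B},\nu,\boldsymbol{\mu})$ such that $\mathbb{E}(\|\boldsymbol{X}_0\|^2)<\infty$ and $$\sum_{\ell=1}^d\int_{\mathcal{U}_d}\|\boldsymbol{z}\|^2\mathbf{1}_{\{\|\boldsymbol{z}\|\ge1\}}\,\mu_\ell(\mathrm{d}\boldsymbol{z})<\infty,\qquad\int_{\mathcal{U}_d}\|\boldsymbol{r}\|^2\mathbf{1}_{\{\|\boldsymbol{r}\|\ge1\}}\,\nu(\mathrm{d}\boldsymbol{r})<\infty.$$ Then for each left eigenvector $\boldsymbol{v}\in\mathbb{C}^d$ of $\widetilde{\boldsymbol{B}}$ corresponding to an arbitrary eigenvalue $\lambda\in\sigma(\widetilde{\boldsymbol{B}})$, we have $$\mathbb{E}(|\langle\boldsymbol{v},\boldsymbol{X}_t\rangle|^2)=E_{\boldsymbol{v},\lambda}(t)+\sum_{\ell=1}^dC_{\boldsymbol{v},\ell}I_{\lambda,\ell}(t)+I_\lambda(t)\int_{\mathcal{U}_d}|\langle\boldsymbol{v},\boldsymbol{r}\rangle|^2\,\nu(\mathrm{d}\boldsymbol{r}),\qquad t\in\mathbb{R}_+,$$ with $$E_{\boldsymbol{v},\lambda}(t):=\mathbb{E}\Big(\Big|\mathrm{e}^{\lambda t}\langle\boldsymbol{v},\boldsymbol{X}_0\rangle+\langle\boldsymbol{v},\widetilde{\boldsymbol{\beta}}\rangle\int_0^t\mathrm{e}^{\lambda(t-u)}\,\mathrm{d}u\Big|^2\Big),\qquad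 I_{\lambda,\ell}(t):=\int_0^t\mathrm{e}^{2\mathrm{Re}(\lambda)(t-u)}\mathbb{E}(X_{u,\ell})\,\mathrm{d}u,$$ $$I_\lambda(t):=\int_0^t\mathrm{e}^{2\mathrm{Re}(\lambda)(t-u)}\,\mathrm{d}u,\qquad C_{\boldsymbol{v},\ell}:=2|\langle\boldsymbol{v},\boldsymbol{e}_\ell\rangle|^2c_\ell+\int_{\mathcal{U}_d}|\langle\boldsymbol{v},\boldsymbol{z}\rangle|^2\,\mu_\ell(\mathrm{d}\boldsymbol{z}),\qquad\ell\in\{1,\dots,d\}.$$ If, in addition, $(\boldsymbol{X}_t)_{t\in\mathbb{R}_+}$ is supercritical and irreducible, then $$\lim_{t\to\infty}h(t)\,\mathbb{E}(|\langle\boldsymbol{v},\boldsymbol{X}_t\rangle|^2)=M_2,$$ where $$h(t):=\begin{cases}\mathrm{e}^{-s(\widetilde{\boldsymbol{B}})t}&\text{if }\mathrm{Re}(\lambda)\in(-\infty,\tfrac12s(\widetilde{\boldsymbol{B}})),\\t^{-1}\mathrm{e}^{-s(\widetilde{\boldsymbol{B}})t}&\text{if }\mathrm{Re}(\lambda)=\tfrac12s(\widetilde{\boldsymbol{B}}),\\\mathrm{e}^{-2\mathrm{Re}(\lambda)t}&\text{if }\mathrm{Re}(\lambda)\in(\tfrac12s(\widetilde{\boldsymbol{B}}),s(\widetilde{\boldsymbol{B}})],\end{cases}$$ and $M_2$ is given as follows: - if $\mathrm{Re}(\lambda)\in(-\infty,\tfrac12s(\widetilde{\boldsymbol{B}}))$,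 then $M_2:=\dfrac{1}{s(\widetilde{\boldsymbol{B}})-2\mathrm{Re}(\lambda)}\Big(\langle\boldsymbol{u},\mathbb{E}(\boldsymbol{X}_0)\rangle+\dfrac{\langle\boldsymbol{u},\widetilde{\boldsymbol{\beta}}\rangle}{s(\widetilde{\boldsymbol{B}})}\Big)\sum_{\ell=1}^dC_{\boldsymbol{v},\ell}\langle\boldsymbol{e}_\ell,\widetilde{\boldsymbol{u}}\rangle$; - if $\mathrm{Re}(\lambda)=\tfrac12s(\widetilde{\boldsymbol{B}})$, then $M_2:=\Big(\langle\boldsymbol{u},\mathbb{E}(\boldsymbol{X}_0)\rangle+\dfrac{\langle\boldsymbol{u},\widetilde{\boldsymbol{\beta}}\rangle}{s(\widetilde{\boldsymbol{B}})}\Big)\sum_{\ell=1}^dC_{\boldsymbol{v},\ell}\langle\boldsymbol{e}_\ell,\widetilde{\boldsymbol{u}}\rangle$; - if $\mathrm{Re}(\lambda)\in(\tfrac12s(\widetilde{\boldsymbol{B}}),s(\widetilde{\boldsymbol{B}})]$, then $$M_2:=\mathbb{E}\Big(\Big|\langle\boldsymbol{v},\boldsymbol{X}_0\rangle+\frac{\langle\boldsymbol{v},\widetilde{\boldsymbol{\beta}}\rangle}{\lambda}\Big|^2\Big)+\frac{1}{2\mathrm{Re}(\lambda)}\int_{\mathcal{U}_d}|\langle\boldsymbol{v},\boldsymbol{r}\rangle|^2\,\nu(\mathrm{d}\boldsymbol{r})+\sum_{\ell=1}^dC_{\boldsymbol{v},\ell}\,\boldsymbol{e}_\ell^\top(2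\mathrm{Re}(\lambda)\boldsymbol{I}_d-\widetilde{\boldsymbol{B}})^{-1}\Big(\mathbb{E}(\boldsymbol{X}_0)+\frac{\widetilde{\boldsymbol{\beta}}}{2\mathrm{Re}(\lambda)}\Big).$$
   Context: Notation. $\mathbb{R}_+=[0,\infty)$, $\mathbb{R}_{++}=(0,\infty)$, $x\wedge y=\min\{x,y\}$, $x^+=\max\{0,x\}$; $\langle\boldsymbol{x},\boldsymbol{y}\rangle=\sum_{j=1}^d x_j\overline{y_j}$ for $\boldsymbol{x},\boldsymbol{y}\in\mathbb{C}^d$, with induced norm $\|\cdot\|$; $\boldsymbol{e}_1,\dots,\boldsymbol{e}_d$ is the natural basis of $\mathbb{R}^d$; $\boldsymbol{I}_d$ is the $d\times d$ identity matrix; $\mathcal{U}_d=\mathbb{R}_+^d\setminus\{\boldsymbol{0}\}$; $\delta_{i,j}$ is the Kronecker delta; $X_{t,\ell}$ is the $\ell$-th coordinate of $\boldsymbol{X}_t$. $\mathbb{R}^{d\times d}_{(+)}$ is the set of real $d\times d$ matrices with non-negative off-diagonal entries. Admissible parameters. $(d,\boldsymbol{c},\boldsymbol{\beta},\boldsymbol{B},\nu,\boldsymbol{\mu})$ is a set of admissible parameters if $d\in\{1,2,\dots\}$, $\boldsymbol{c}\in\mathbb{R}_+^d$, $\boldsymbol{\beta}\in\mathbb{R}_+^d$, $\boldsymbol{B}=(b_{i,j})\in\mathbb{R}^{d\times d}_{(+)}$, $\nu$ is a Borel measure on $\mathcal{U}_d$ with $\int_{\mathcal{U}_d}(1\wedge\|\boldsymbol{r}\|)\,\nu(\mathrm{d}\boldsymbol{r})<\infty$,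 and $\boldsymbol{\mu}=(\mu_1,\dots,\mu_d)$, where each $\mu_i$ is a Borel measure on $\mathcal{U}_d$ with $\int_{\mathcal{U}_d}\big[\|\boldsymbol{z}\|\wedge\|\boldsymbol{z}\|^2+\sum_{j\ne i}(1\wedge z_j)\big]\mu_i(\mathrm{d}\boldsymbol{z})<\infty$. Multi-type CBI process. A multi-type CBI process with these (admissible) parameters is a conservative Markov process with state space $\mathbb{R}_+^d$ whose transition semigroup $(P_t)_{t\in\mathbb{R}_+}$ satisfies, for $\boldsymbol{x},\boldsymbol{\lambda}\in\mathbb{R}_+^d$, $t\in\mathbb{R}_+$, $$\int_{\mathbb{R}_+^d}\mathrm{e}^{-\langle\boldsymbol{\lambda},\boldsymbol{y}\rangle}P_t(\boldsymbol{x},\mathrm{d}\boldsymbol{y})=\mathrm{e}^{-\langle\boldsymbol{x},\boldsymbol{v}(t,\boldsymbol{\lambda})\rangle-\int_0^t\psi(\boldsymbol{v}(s,\boldsymbol{\lambda}))\,\mathrm{d}s},$$ where $t\mapsto\boldsymbol{v}(t,\boldsymbol{\lambda})\in\mathbb{R}_+^d$ is the unique locally bounded solution of $\partial_tv_i(t,\boldsymbol{\lambda})=-\varphi_i(\boldsymbol{v}(t,\boldsymbol{\lambda}))$, $v_i(0,\boldsymbol{\lambda})=\lambda_i$, $i=1,\dots,d$, with $\varphi_i(\boldsymbol{\lambda})=c_i\lambda_i^2-\langle\boldsymbol{B}\boldsymbol{e}_i,\boldsymbol{\lambda}\rangle+\int_{\mathcal{U}_d}(\mathrm{e}^{-\langle\boldsymbol{\lambda},\boldsymbol{z}\rangle}-1+\lambda_i(1\wedge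 z_i))\,\mu_i(\mathrm{d}\boldsymbol{z})$ and $\psi(\boldsymbol{\lambda})=\langle\boldsymbol{\beta},\boldsymbol{\lambda}\rangle+\int_{\mathcal{U}_d}(1-\mathrm{e}^{-\langle\boldsymbol{\lambda},\boldsymbol{r}\rangle})\,\nu(\mathrm{d}\boldsymbol{r})$. Under $\int_{\mathcal{U}_d}\|\boldsymbol{r}\|\mathbf{1}_{\{\|\boldsymbol{r}\|\ge1\}}\nu(\mathrm{d}\boldsymbol{r})<\infty$ put $$\widetilde{\boldsymbol{B}}=(\widetilde{b}_{i,j}),\quad\widetilde{b}_{i,j}=b_{i,j}+\int_{\mathcal{U}_d}(z_i-\delta_{i,j})^+\,\mu_j(\mathrm{d}\boldsymbol{z}),\qquad\widetilde{\boldsymbol{\beta}}=\boldsymbol{\beta}+\int_{\mathcal{U}_d}\boldsymbol{r}\,\nu(\mathrm{d}\boldsymbol{r}).$$ Then $\widetilde{\boldsymbol{B}}\in\mathbb{R}^{d\times d}_{(+)}$ and $\widetilde{\boldsymbol{\beta}}\in\mathbb{R}_+^d$. Classification. $\sigma(\boldsymbol{A})$ is the set of complex eigenvalues of $\boldsymbol{A}$ and $s(\boldsymbol{A})=\max_{\lambda\in\sigma(\boldsymbol{A})}\mathrm{Re}(\lambda)$. A matrix is reducible if a simultaneous row and column permutation brings it to block upper triangular form with two square diagonal blocks of sizes $r$ and $d-r$, $1\le r\le d-1$; otherwise it is irreducible (every $1\times1$ matrix is irreducible). The CBI process is irreducible if $\widetilde{\boldsymbol{B}}$ is irreducible, and an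 irreducible one is supercritical if $s(\widetilde{\boldsymbol{B}})>0$. Perron vectors. For irreducible $\widetilde{\boldsymbol{B}}$, $s(\widetilde{\boldsymbol{B}})$ is an eigenvalue of $\widetilde{\boldsymbol{B}}$ of algebraic and geometric multiplicity $1$; $\widetilde{\boldsymbol{u}}\in\mathbb{R}_{++}^d$ is the unique right eigenvector for $s(\widetilde{\boldsymbol{B}})$ with coordinates summing to $1$, and $\boldsymbol{u}\in\mathbb{R}_{++}^d$ is the unique left eigenvector for $s(\widetilde{\boldsymbol{B}})$ with $\widetilde{\boldsymbol{u}}^\top\boldsymbol{u}=1$. A left eigenvector $\boldsymbol{v}\in\mathbb{C}^d$ for $\lambda$ means $\boldsymbol{v}\neq\boldsymbol{0}$ and $\boldsymbol{v}^\top\widetilde{\boldsymbol{B}}=\lambda\boldsymbol{v}^\top$. *)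

(* Defs.v *)
From HB Require Import structures.
From mathcomp Require Import all_boot all_order all_algebra.
From mathcomp Require Import all_fingroup.
From mathcomp Require Import complex.
From mathcomp Require Import all_classical all_reals all_analysis.

Set Implicit Arguments.
Unset Strict Implicit.
Unset Printing Implicit Defensive.

Import Order.TTheory GRing.Theory Num.Theory.
Import numFieldNormedType.Exports.

Local Open Scope classical_set_scope.
Local Open Scope ring_scope.
Local Open Scope complex_scope.

(* R^d with its Borel sigma-algebra. *)
Definition Rvec (R : realType) (d : nat) :=
  g_sigma_algebraType (@open 'cV[R]_d).

Section Vectors.
Variable R : realType.

Definition e_ d (i : 'I_d) : 'cV[R]_d := delta_mx i 0.

Definition dotr d (x y : 'cV[R]_d) : R := \sum_j x j 0 * y j 0.

Definition dotc d (x y : 'cV[R[i]]_d) : R[i] :=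
  \sum_j x j 0 * (y j 0)^*.

(* The matrix norm of the library is the maximum norm. *)
Definition enorm d (x : 'cV[R]_d) : R := Num.sqrt (dotr x x).

Definition toC m n (A : 'M[R]_(m, n)) : 'M[R[i]]_(m, n) :=
  map_mx (real_complex R) A.

Definition cone {d} : set (Rvec R d) := [set x | forall i, 0 <= x i 0].

Definition Uset {d} : set (Rvec R d) := cone `\ (0 : 'cV[R]_d).

Definition cexp (z : R[i]) : R[i] :=
  (expR (complex.Re z) * cos (complex.Im z)) +i*
  (expR (complex.Re z) * sin (complex.Im z)).

Definition cintegral (a b : R) (f : R -> R[i]) : R[i] :=
  (\int[lebesgue_measure]_(u in `[a, b]) complex.Re (f u)) +i*
  (\int[lebesgue_measure]_(u in `[a, b]) complex.Im (f u)).

Definition sqmod (z : R[i]) : R := ComplexField.Normc.normc z ^+ 2.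

End Vectors.

Arguments cone {R d}.
Arguments Uset {R d}.

Section Matrices.
Variables (R : realType) (d : nat).
Implicit Types A : 'M[R]_d.

Definition spectrum A : set R[i] := [set l | eigenvalue (toC A) l].

(* The spectrum is finite, and nonempty as soon as 0 < d, so that the supremum
   is a maximum. *)
Definition spectral_abscissa A : R :=
  sup [set complex.Re l | l in spectrum A].

Definition reducible A : Prop :=
  exists (s : 'S_d) (r : nat), (0 < r < d)%N /\
    forall i j : 'I_d, (j < r <= i)%N -> row_perm s (col_perm s A) i j = 0.

Definition irreducible A : Prop := ~ reducible A.

Definition left_eigenvector A (l : R[i]) (v : 'cV[R[i]]_d) : Prop :=
  v != 0 /\ v^T *m toC A = l *: v^T.

Definition right_perron_vector A (ut : 'cV[R]_d) : Prop :=
  [/\ forall i, 0 < ut i 0,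
      A *m ut = spectral_abscissa A *: ut &
      \sum_i ut i 0 = 1].

Definition left_perron_vector A (ut u : 'cV[R]_d) : Prop :=
  [/\ forall i, 0 < u i 0,
      u^T *m A = spectral_abscissa A *: u^T &
      ut^T *m u = 1%:M].

End Matrices.

(* A measure on Uset is represented by its extension by 0 to R^d. *)
Record cbi_params (R : realType) (d : nat) := CBIParams {
  pc : 'cV[R]_d;
  pbeta : 'cV[R]_d;
  pB : 'M[R]_d;
  pnu : {measure set (Rvec R d) -> \bar R};
  pmu : 'I_d -> {measure set (Rvec R d) -> \bar R}
}.

Section CBI.
Variables (R : realType) (d : nat) (p : cbi_params R d).

Let c := pc p.
Let beta := pbeta p.
Let B := pB p.
Let nu := pnu p.
Let mu := pmu p.

Definition admissible : Prop :=
  (0 < d)%N /\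
  [/\ forall i, 0 <= c i 0,
      forall i, 0 <= beta i 0,
      forall i j : 'I_d, i != j -> 0 <= B i j,
      nu (~` Uset) = 0%E /\
      (\int[nu]_(r in Uset) (Num.min 1 (enorm r))%:E < +oo)%E &
      forall i, mu i (~` Uset) = 0%E /\
      (\int[mu i]_(z in Uset)
         (Num.min (enorm z) (enorm z ^+ 2)
          + \sum_(j | j != i) Num.min 1 (z j 0))%:E < +oo)%E].

Definition branching (i : 'I_d) (l : 'cV[R]_d) : R :=
  c i 0 * l i 0 ^+ 2 - dotr (B *m e_ R i) l
  + \int[mu i]_(z in Uset)
      (expR (- dotr l z) - 1 + l i 0 * Num.min 1 (z i 0)).

Definition immigration (l : 'cV[R]_d) : R :=
  dotr beta l + \int[nu]_(r in Uset) (1 - expR (- dotr l r)).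

(* The solution is unique; uniqueness is a theorem about the equation and is not
   part of this predicate. The derivative is taken relatively to [0, +oo[, hence is one-sided at 0. *)
Definition branching_flow (v : R -> 'cV[R]_d) (l : 'cV[R]_d) : Prop :=
  [/\ forall t : R, 0 <= t -> cone (v t),
      forall T : R, exists M : R, forall t : R, 0 <= t <= T -> enorm (v t) <= M,
      v 0 = l &
      forall (t : R) (i : 'I_d), 0 <= t ->
        (fun s => (v s i 0 - v t i 0) / (s - t)) @ within `[0, +oo[ t^'
          --> - branching i (v t)].

(* Kernels are total functions on R^d: only their values at times t >= 0 and at
   the points of the cone are meaningful. *)
Definition cbi_semigroup (Q : R -> R.-pker (Rvec R d) ~> (Rvec R d)) : Prop :=
  [/\ forall (t : R) (x : Rvec R d), 0 <= t -> cone x -> Q t x cone = 1%E,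
      forall (x : Rvec R d) (A : set (Rvec R d)), cone x ->
        measurable A -> Q 0 x A = \d_x A,
      forall (s t : R) (x : Rvec R d) (A : set (Rvec R d)),
        0 <= s -> 0 <= t -> cone x -> measurable A ->
        Q (s + t) x A = (\int[Q s x]_(y in cone) Q t y A)%E &
      exists v : R -> 'cV[R]_d -> 'cV[R]_d,
        (forall l : 'cV[R]_d, cone l -> branching_flow (v ^~ l) l) /\
        forall (t : R) (x l : 'cV[R]_d), 0 <= t -> cone x -> cone l ->
          (\int[Q t x]_(y in cone) (expR (- dotr l y))%:E)%E =
          (expR (- dotr x (v t l)
             - \int[lebesgue_measure]_(s in `[0, t]) immigration (v s l)))%:E].

Section Process.
Context (dO : measure_display) (O : measurableType dO) (P : probability O R).
Variable X : R -> O -> Rvec R d.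

Definition natural_filtration (s : R) : set (set O) :=
  <<s \bigcup_(u in `[0, s]) preimage_set_system setT (X u) measurable >>.

(* The Markov property says that Q t (X s) A is a version of the conditional
   probability of the event X (s + t) \in A given the past at time s. *)
Definition is_cbi : Prop :=
  [/\ forall t : R, 0 <= t -> measurable_fun setT (X t),
      forall (t : R) (w : O), 0 <= t -> cone (X t w) &
      exists Q : R -> R.-pker (Rvec R d) ~> (Rvec R d), cbi_semigroup Q /\
        forall (s t : R) (F : set O) (A : set (Rvec R d)),
          0 <= s -> 0 <= t ->
          natural_filtration s F -> measurable A ->
          P (F `&` X (s + t) @^-1` A) = (\int[P]_(w in F) Q t (X s w) A)%E].

End Process.

Definition Btilde : 'M[R]_d :=
  \matrix_(i, j) (B i j
    + \int[mu j]_(z in Uset) Num.max 0 (z i 0 - (i == j)%:R)).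

Definition betatilde : 'cV[R]_d :=
  \col_i (beta i 0 + \int[nu]_(r in Uset) r i 0).

End CBI.

Section Moments.
Variables (R : realType) (d : nat) (p : cbi_params R d).
Context (dO : measure_display) (O : measurableType dO) (P : probability O R).
Variable X : R -> O -> Rvec R d.
Variables (v : 'cV[R[i]]_d) (lambda : R[i]).

Let s := spectral_abscissa (Btilde p).
Let bt := betatilde p.

(* The quantities below are real numbers because, under the moment assumptions,
   all the expectations and integrals that define them are finite. *)
Definition mean (t : R) : 'cV[R]_d :=
  \col_l fine 'E_P[fun w => X t w l 0].

Definition Cv (l : 'I_d) : R :=
  2 * sqmod (dotc v (toC (e_ R l))) * pc p l 0
  + \int[pmu p l]_(z in Uset) sqmod (dotc v (toC z)).

Definition nu_int : R := \int[pnu p]_(r in Uset) sqmod (dotc v (toC r)).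

Definition Ev (t : R) : R :=
  fine 'E_P[fun w => sqmod
    (cexp (lambda * t%:C) * dotc v (toC (X 0 w))
     + dotc v (toC bt) * cintegral 0 t (fun u => cexp (lambda * (t - u)%:C)))].

Definition Il (l : 'I_d) (t : R) : R :=
  \int[lebesgue_measure]_(u in `[0, t])
     (expR (2 * complex.Re lambda * (t - u)) * mean u l 0).

Definition I_ (t : R) : R :=
  \int[lebesgue_measure]_(u in `[0, t])
     expR (2 * complex.Re lambda * (t - u)).

(* The last branch is the case s / 2 < Re lambda <= s: the real part of an
   eigenvalue is at most s. *)
Definition h (t : R) : R :=
  if complex.Re lambda < s / 2 then expR (- s * t)
  else if complex.Re lambda == s / 2 then t^-1 * expR (- s * t)
  else expR (- 2 * complex.Re lambda * t).

Definition M2 (ut u : 'cV[R]_d) : R :=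
  let w := dotr u (mean 0) + dotr u bt / s in
  let S := \sum_l Cv l * dotr (e_ R l) ut in
  if complex.Re lambda < s / 2 then (s - 2 * complex.Re lambda)^-1 * w * S
  else if complex.Re lambda == s / 2 then w * S
  else
    fine 'E_P[fun w => sqmod (dotc v (toC (X 0 w)) + dotc v (toC bt) / lambda)]
    + (2 * complex.Re lambda)^-1 * nu_int
    + \sum_l Cv l *
        ((e_ R l)^T *m invmx ((2 * complex.Re lambda)%:M - Btilde p)
         *m (mean 0 + (2 * complex.Re lambda)^-1 *: bt)) 0 0.

End Moments.

(* Main.v *)
Require Import Defs.
From HB Require Import structures.
From mathcomp Require Import all_boot all_order all_algebra.
From mathcomp Require Import all_fingroup.
From mathcomp Require Import complex.
From mathcomp Require Import all_classical all_reals all_analysis.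
From mathcomp Require Import measurable_realfun ring lra.

Set Implicit Arguments.
Unset Strict Implicit.
Unset Printing Implicit Defensive.

Import Order.TTheory GRing.Theory Num.Theory.
Import numFieldNormedType.Exports.

Local Open Scope classical_set_scope.
Local Open Scope ring_scope.

(** Let g(u) = e^-u - 1 + u. Compensating with Btilde, the branching mechanism is
    a nonlinear remainder in g minus the linear map Btilde^T, so pairing the
    flow v with a solution m of m' = Btilde m + betatilde gives the exact Laplace
    exponent <m(t), l> - int_0^t (remainder along v). Replacing l by l / (n + 1)
    and expanding to second order (the rescaled remainders are bounded by their limits,
    so Fatou's lemma gives the convergence of the integrals) yields the first two moments of the
    transition kernels on the cone; decomposing l into positive and negative parts
    and polarizing extends them to all real l. On a left eigenvector the backward
    flow is a rotation times an exponential, which is the first formula.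

    For the limits, e^{-st} m(t) converges exponentially fast to a multiple of the right
    Perron vector ut: the component orthogonal to the left Perron vector u decays by a
    Poincare inequality for the Dirichlet form with weights u_i Btilde_ij ut_j, which
    holds because Btilde is irreducible. *)

(** The process is given only through the Laplace transforms of its semigroup: no stochastic
    equation is at hand to which Ito's formula could be applied, and the finiteness of the moments
    is itself to be proved. The Laplace exponent is therefore never differentiated in l. The duality
    identity gives it exactly, every nonlinear term left in it is nonnegative and of second order,
    and so the flow started from l / (n + 1) is needed only to leading order. Bounding the rescaled
    remainders by their limits yields finiteness and value of a moment together. All this needs
    nonnegative integrands, which confines l to the cone at first.

    The formula itself is a decomposition of variance: E_{v,lambda} is the second moment of the
    conditional mean given X_0, and the other terms are the expected conditional variance, which is
    affine in X_0 and hence depends on the law of X_0 only through its mean.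

    For the limits, an exponential rate and not mere convergence of e^{-st} m(t) is wanted, because
    it encloses the time integrals between explicit primitives. The value lambda = 0 stands apart,
    since the expansion of E_{v,lambda} is centred with the quotient of <v, betatilde> by lambda. *)

Lemma cvg_sumr (R : realType) (T J : Type) (F : set_system T) {FF : Filter F}
    (f : J -> T -> R) (l : J -> R) (r : seq J) (P : pred J) :
  (forall j, P j -> f j x @[x --> F] --> l j) ->
  \sum_(j <- r | P j) f j x @[x --> F] --> \sum_(j <- r | P j) l j.
Proof.
move=> fl; elim: r => [|j r IH].
  by rewrite big_nil; under eq_fun do rewrite big_nil; exact: cvg_cst.
rewrite big_cons; under eq_fun do rewrite big_cons.
by case: ifPn => // Pj; apply: cvgD => //; exact: fl.
Qed.

Lemma cvg_pseries_fact_bound (R : realType) (f : R ^nat) (C M : R) :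
  0 <= M -> (forall k, `|f k| <= C * (M ^+ k / k`!%:R)) ->
  forall x, cvgn (pseries f x).
Proof.
move=> M0 fb x; apply: normed_cvg.
have C0 : 0 <= C.
  have := fb 0; rewrite expr0 fact0 divr1 mulr1 => h0.
  exact: le_trans h0.
apply: (@series_le_cvg _ _ (fun k => C * exp_coeff (M * `|x|) k)).
- by move=> n /=; exact: normr_ge0.
- move=> n; apply: mulr_ge0 => //; apply: mulr_ge0; first by rewrite exprn_ge0 ?mulr_ge0.
  by rewrite invr_ge0.
- move=> n /=; rewrite normrM normrX /exp_coeff /= exprMn mulrAC mulrA.
  by rewrite ler_wpM2r ?exprn_ge0// mulrAC -mulrA.
- have -> : (fun k => C * exp_coeff (M * `|x|) k) = C *: exp_coeff (M * `|x|) by [].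
  by apply: is_cvg_seriesZ; exact: is_cvg_series_exp_coeff.
Qed.

(** Coefficients of size C M^k / k! keep this form under termwise differentiation. Differentiating a
    power series at t asks for convergence of the series and of its first two derived series beyond
    |t|, so the bound is applied twice. *)
Lemma pseries_diffs_fact_bound (R : realType) (f : R ^nat) (C M : R) :
  0 <= M -> (forall k, `|f k| <= C * (M ^+ k / k`!%:R)) ->
  forall k, `|pseries_diffs f k| <= C * M * (M ^+ k / k`!%:R).
Proof.
move=> M0 fb k; rewrite /pseries_diffs normrM ger0_norm//.
apply: (le_trans (ler_wpM2l _ (fb k.+1))) => //.
rewrite factS natrM invfM exprS.
have k0 : k.+1%:R != 0 :> R by [].
rewrite le_eqVlt; apply/orP; left; apply/eqP; field.
by rewrite -[1 + k%:R]/(1%:R + k%:R) -natrD k0 andbT pnatr_eq0 -lt0n fact_gt0.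
Qed.

(** * Linear and scalar differential equations *)

Section linear_ode.
Variables (R : realType) (d : nat) (B : 'M[R]_d) (b x : 'cV[R]_d).

(** Taylor coefficients at 0 of the solution of m' = B m + b, m(0) = x. The constant source b enters
    the coefficient of order one only. The series solves the equation on the whole line, so no
    one-sided derivative arises at 0. *)
Fixpoint ode_coeff k : 'cV[R]_d :=
  if k is k'.+1 then k'.+1%:R^-1 *: (B *m ode_coeff k' + (k' == 0)%:R *: b) else x.

(** The summand 1 leaves room for b in the induction step of the coefficient bound. *)
Let M : R := 1 + \sum_i \sum_j `|B i j|.
Let C : R := \sum_i (`|x i 0| + `|b i 0|).

Let M_ge1 : 1 <= M.
Proof. by rewrite lerDl sumr_ge0// => i _; rewrite sumr_ge0. Qed.

Let xb_le i : `|x i 0| + `|b i 0| <= C.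
Proof. by rewrite /C (bigD1 i)//= lerDl sumr_ge0// => j _; rewrite addr_ge0. Qed.

Lemma ode_coeff_bound k i : `|ode_coeff k i 0| <= C * (M ^+ k / k`!%:R).
Proof.
have C0 : 0 <= C by rewrite /C sumr_ge0// => j _; rewrite addr_ge0.
elim: k i => [|k IH] i /=.
  by rewrite expr0 fact0 divr1 mulr1 (le_trans _ (xb_le i))// lerDl.
rewrite !mxE normrM ger0_norm ?invr_ge0// factS natrM invfM.
rewrite exprS [X in _ <= X](_ : _ = k.+1%:R^-1 * (C * (M * (M ^+ k / k`!%:R)))); last by ring.
rewrite ler_wpM2l ?invr_ge0//.
have P0 : 0 <= M ^+ k / k`!%:R by rewrite mulr_ge0 ?invr_ge0// exprn_ge0// (le_trans _ M_ge1).
apply: le_trans (ler_normD _ _) _.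
have -> : C * (M * (M ^+ k / k`!%:R)) = (\sum_i \sum_j `|B i j|) * (C * (M ^+ k / k`!%:R)) + C * (M ^+ k / k`!%:R).
  by rewrite /M; ring.
apply: lerD.
  apply: le_trans (ler_norm_sum _ _ _) _.
  have row_le : \sum_j `|B i j| <= \sum_i \sum_j `|B i j|.
    rewrite [leRHS](bigD1 i)//= lerDl sumr_ge0// => j _.
    by rewrite sumr_ge0.
  apply: le_trans (ler_wpM2r _ row_le); last exact: mulr_ge0.
  by rewrite mulr_suml ler_sum// => j _; rewrite normrM ler_wpM2l.
case: k {IH} P0 => [|k] P0 /=.
  rewrite mul1r expr0 fact0 divr1 mulr1; apply: le_trans (xb_le i).
  by rewrite lerDr.
by rewrite mul0r normr0 mulr_ge0.
Qed.

Definition ode_sol (t : R) : 'cV[R]_d :=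
  \col_i limn (pseries (fun k => ode_coeff k i 0) t).

Let M_ge0 : 0 <= M. Proof. exact: le_trans M_ge1. Qed.

Lemma ode_sol0 : ode_sol 0 = x.
Proof.
apply/matrixP => i j; rewrite (ord1 j) mxE; apply: lim_near_cst => //.
near=> n; rewrite -[n]prednK; last by near: n.
rewrite /pseries /= /series /= big_nat_recl//= expr0 mulr1 big1 ?addr0// => k _.
by rewrite expr0n mulr0.
Unshelve. all: by end_near. Qed.

Lemma is_derive_ode_sol (t : R) i :
  is_derive t 1 (fun s => ode_sol s i 0) ((B *m ode_sol t + b) i 0).
Proof.
have cv j := cvg_pseries_fact_bound M_ge0 (fun k => ode_coeff_bound k j).
pose f k := ode_coeff k i 0.
have fb k : `|f k| <= C * (M ^+ k / k`!%:R) := ode_coeff_bound k i.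
have fb1 := pseries_diffs_fact_bound M_ge0 fb.
have fb2 := pseries_diffs_fact_bound M_ge0 fb1.
have := @pseries_snd_diffs R f (`|t| + 1) t (@cvg_pseries_fact_bound _ _ _ _ M_ge0 fb _)
  (@cvg_pseries_fact_bound _ _ _ _ M_ge0 fb1 _)
  (@cvg_pseries_fact_bound _ _ _ _ M_ge0 fb2 _).
rewrite [X in _ < X]ger0_norm ?addr_ge0// ltrDl ltr01 => /(_ isT).
have -> : (fun s => limn (pseries f s)) = (fun s => ode_sol s i 0).
  by apply/funext => s; rewrite mxE.
suff -> : limn (pseries (pseries_diffs f) t) = (B *m ode_sol t + b) i 0 by [].
apply: cvg_lim => //.
(* The identity below holds for nonempty partial sums only: the index 0 is the one that carries
   b. *)
rewrite -cvg_shiftS /=.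
have -> : (fun n => pseries (pseries_diffs f) t n.+1) =
  (fun n => \sum_j B i j * pseries (fun k => ode_coeff k j 0) t n.+1 + b i 0).
  apply/funext => n; rewrite /pseries /series /=.
  under [in RHS]eq_bigr do rewrite mulr_sumr.
  rewrite exchange_big /=.
  under eq_bigr => k _.
    rewrite /pseries_diffs /f /= !mxE mulrA divff// mul1r mulrDl mulr_suml.
    under eq_bigr do rewrite -mulrA.
    over.
  rewrite big_split /=; congr (_ + _).
  rewrite big_nat_recl//= expr0 mulr1 mul1r big1 ?addr0// => k _.
  by rewrite !mul0r.
rewrite !mxE; apply: cvgD; last exact: cvg_cst.
apply: (@cvg_sumr _ _ _ _ _ (fun j n => B i j * pseries (fun k => ode_coeff k j 0) t n.+1)) => j _.
rewrite mxE; apply: cvgMr.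
rewrite (cvg_shiftS (pseries (fun k => ode_coeff k j 0) t)).
exact: cv.
Qed.

End linear_ode.

Section real_derivatives.
Variable R : realType.
Implicit Types (f g : R -> R) (x : R).

Lemma is_derive1D f g x df dg : is_derive x 1 f df -> is_derive x 1 g dg ->
  is_derive x 1 (fun t => f t + g t) (df + dg).
Proof. by move=> hf hg; exact: is_deriveD. Qed.

Lemma is_derive1B f g x df dg : is_derive x 1 f df -> is_derive x 1 g dg ->
  is_derive x 1 (fun t => f t - g t) (df - dg).
Proof. by move=> hf hg; exact: is_deriveB. Qed.

Lemma is_derive1M f g x df dg : is_derive x 1 f df -> is_derive x 1 g dg ->
  is_derive x 1 (fun t => f t * g t) (df * g x + f x * dg).
Proof.
move=> hf hg; have := is_deriveM hf hg.
suff -> : f x *: dg + g x *: df = df * g x + f x * dg by [].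
by rewrite addrC /GRing.scale /= mulrC.
Qed.

Lemma is_derive1Z (k : R) f x df : is_derive x 1 f df ->
  is_derive x 1 (fun t => k * f t) (k * df).
Proof.
move=> hf; have := is_derive1M (is_derive_cst k x 1) hf.
by rewrite mul0r add0r.
Qed.

Lemma is_derive1_sum n (h : 'I_n -> R -> R) x (dh : 'I_n -> R) :
  (forall i, is_derive x 1 (h i) (dh i)) ->
  is_derive x 1 (fun t => \sum_i h i t) (\sum_i dh i).
Proof.
move=> H; have := is_derive_sum H.
by rewrite (_ : \sum_i h i = fun t => \sum_i h i t)//; apply/funext => t; rewrite fct_sumE.
Qed.

Lemma is_derive1_expRM (k : R) x :
  is_derive x 1 (fun t => expR (k * t)) (k * expR (k * x)).
Proof.
rewrite mulrC; apply: (@is_derive1_comp _ expR (fun t => k * t) x).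
by have := is_derive1Z k (is_derive_id x 1); rewrite mulr1.
Qed.

Lemma is_derive1_comp_subl f (c : R) x df : is_derive (c - x) 1 f df ->
  is_derive x 1 (fun t => f (c - t)) (- df).
Proof.
move=> hf; rewrite -mulrN1.
apply: (@is_derive1_comp _ f (fun t => c - t) x) => //.
by have := is_derive1B (is_derive_cst c x 1) (is_derive_id x 1); rewrite sub0r.
Qed.

Lemma is_derive1_continuous f x df : is_derive x 1 f df -> {for x, continuous f}.
Proof.
by move=> [df1 _]; apply: differentiable_continuous; apply/derivable1_diffP.
Qed.

Lemma continuous_itv_integrable f (a b : R) : {within `[a, b], continuous f} ->
  lebesgue_measure.-integrable `[a, b] (EFin \o f).
Proof. by apply: continuous_compact_integrable; exact: segment_compact. Qed.

(** Differentiability is asked in the open interval only, because the branching flow has merely a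
    right derivative at 0. *)
Lemma Rintegral_FTC (F f : R -> R) (t : R) : 0 <= t ->
  {within `[0, t], continuous F} -> {within `[0, t], continuous f} ->
  (forall s, 0 < s < t -> is_derive s 1 F (f s)) ->
  \int[lebesgue_measure]_(s in `[0, t]) f s = F t - F 0.
Proof.
rewrite le_eqVlt => /predU1P[<- _ _ _|t0 cF cf dF].
  by rewrite set_itv1 Rintegral_set1 subrr.
rewrite /Rintegral (@continuous_FTC2 _ f F)//.
- have [_ c0 ct] := (continuous_within_itvP _ t0).1 cF.
  by split=> // x; rewrite in_itv/= => /dF [].
- by move=> x; rewrite in_itv/= => /dF h; rewrite derive1E derive_val.
Qed.

Lemma is_derive_le_itv (F f : R -> R) (t : R) : 0 <= t ->
  {within `[0, t], continuous F} ->
  (forall s, 0 < s < t -> is_derive s 1 F (f s)) ->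
  (forall s, 0 < s < t -> f s <= 0) -> F t <= F 0.
Proof.
move=> t0 cF dF f0.
apply: (@ler0_derive1_le_cc _ F 0 t) => //; last 2 first.
- by rewrite in_itv/= lexx t0.
- by rewrite in_itv/= lexx t0.
- by move=> x; rewrite in_itv/= => /dF [].
- by move=> x; rewrite in_itv/= => xt; have h := dF _ xt; rewrite derive1E derive_val f0.
Qed.

Lemma gronwall (F f : R -> R) (K t : R) : 0 <= t ->
  {within `[0, t], continuous F} ->
  (forall s, 0 < s < t -> is_derive s 1 F (f s)) ->
  (forall s, 0 < s < t -> f s <= K * F s) -> F t <= expR (K * t) * F 0.
Proof.
move=> t0 cF dF fK.
have dE (s : R) : is_derive s 1 (fun u => expR ((- K) * u)) (- K * expR (- K * s)).
  exact: is_derive1_expRM.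
have h : expR (- K * t) * F t <= expR (- K * 0) * F 0.
  apply: (@is_derive_le_itv (fun s => expR (- K * s) * F s)
    (fun s => (- K * expR (- K * s)) * F s + expR (- K * s) * f s)) => //.
  - move=> x; apply: cvgM; last exact: cF.
    apply: (@continuous_subspaceT R R `[0, t]%classic (fun s => expR (- K * s))) => y.
    exact: is_derive1_continuous (dE y).
  - by move=> s st; apply: is_derive1M (dE s) (dF _ st).
  - move=> s st; rewrite [X in X + _](_ : _ = expR (- K * s) * (- K * F s)); last by ring.
    rewrite -mulrDr mulr_ge0_le0 ?expR_ge0//.
    by rewrite mulNr addrC subr_le0 fK.
rewrite mulr0 expR0 mul1r in h.
apply: le_trans (ler_wpM2l (expR_ge0 (K * t)) h).
by rewrite mulrA -expRD mulNr subrr expR0 mul1r.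
Qed.

End real_derivatives.

(** * Measurability and vectors *)

Section Rvec_measurability.
Variables (R : realType) (d : nat).
Implicit Types (z l : Rvec R d).

Lemma open_measurable_Rvec (A : set 'cV[R]_d) :
  open A -> measurable (A : set (Rvec R d)).
Proof. exact: sub_sigma_algebra. Qed.

Lemma measurable_coord (D : set (Rvec R d)) i : measurable_fun D (fun z : Rvec R d => z i 0).
Proof.
apply: (@measurable_funS _ _ _ _ setT) => //.
apply: (measurability _ (RGenOInfty.measurableE R)) => _ [_ [x ->] <-].
rewrite setTI; apply: open_measurable_Rvec.
by apply: open_comp (@interval_open R (BRight x) +oo%O isT isT) => M _; exact: coord_continuous.
Qed.

Lemma measurable_dotr (D : set (Rvec R d)) l : measurable_fun D (fun z : Rvec R d => dotr l z).
Proof.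
apply: measurable_sum => j; apply: measurable_funM; first exact: measurable_cst.
exact: measurable_coord.
Qed.

Lemma measurable_enorm (D : set (Rvec R d)) : measurable_fun D (fun z : Rvec R d => enorm z).
Proof.
apply: (@measurableT_comp _ _ _ _ _ _ (@Num.sqrt R)).
  exact: (@continuous_measurable_fun _ (@Num.sqrt R) (@sqrt_continuous R)).
by apply: measurable_sum => j; apply: measurable_funM; exact: measurable_coord.
Qed.

Lemma measurable_cone : measurable (@cone R d).
Proof.
have -> : @cone R d = \bigcap_(i in [set: 'I_d]) ((fun z : Rvec R d => z i 0) @^-1` `[0, +oo[).
  apply/seteqP; split => [z cz i _ /=|z cz i]; first by rewrite in_itv/= andbT cz.
  by have := cz i Logic.I; rewrite /= in_itv/= andbT.
apply: fin_bigcap_measurable => [|i _]; first exact: finite_finset.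
by rewrite -[X in measurable X]setTI; exact: measurable_coord.
Qed.

Lemma measurable_Uset : measurable (@Uset R d).
Proof.
apply: measurableD; first exact: measurable_cone.
have -> : [set (0 : 'cV[R]_d)] = \bigcap_(i in [set: 'I_d]) ((fun z : Rvec R d => z i 0) @^-1` [set 0]) :> set (Rvec R d).
  apply/seteqP; split => [z /= -> i _ /=|z cz /=]; first by rewrite mxE.
  by apply/matrixP => i j; rewrite (ord1 j) mxE; exact: (cz i Logic.I).
apply: fin_bigcap_measurable => [|i _]; first exact: finite_finset.
by rewrite -[X in measurable X]setTI; apply: measurable_coord.
Qed.

Lemma Uset_cone z : Uset z -> cone z. Proof. by case. Qed.

End Rvec_measurability.

Section vectors.
Variables (R : realType) (d : nat).
Implicit Types (x y z l k : 'cV[R]_d).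

(** On the cone this norm is the sum of the coordinates, hence linear along the flow. It bounds
    [dotr] against the Euclidean norm, in which the moment conditions are stated. *)
Definition n1 x : R := \sum_j `|x j 0|.

Lemma n1_ge0 x : 0 <= n1 x. Proof. exact: sumr_ge0. Qed.

Lemma enorm_ge0 x : 0 <= enorm x. Proof. exact: sqrtr_ge0. Qed.

Lemma coord_le_enorm x i : `|x i 0| <= enorm x.
Proof.
rewrite -sqrtr_sqr ler_wsqrtr// /dotr (bigD1 i)//= expr2 lerDl sumr_ge0// => j _.
by rewrite -expr2 sqr_ge0.
Qed.

Lemma coord_le_n1 x i : `|x i 0| <= n1 x.
Proof. by rewrite /n1 (bigD1 i)//= lerDl sumr_ge0. Qed.

Lemma dotr_le x y : `|dotr x y| <= n1 x * enorm y.
Proof.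
apply: le_trans (ler_norm_sum _ _ _) _; rewrite /n1 mulr_suml ler_sum// => j _.
by rewrite normrM ler_wpM2l// coord_le_enorm.
Qed.

Lemma dotrC x y : dotr x y = dotr y x.
Proof. by apply: eq_bigr => j _; rewrite mulrC. Qed.

Lemma dotrDl x y z : dotr (x + y) z = dotr x z + dotr y z.
Proof. by rewrite /dotr -big_split /=; apply: eq_bigr => j _; rewrite mxE mulrDl. Qed.

Lemma dotrZl (a : R) x z : dotr (a *: x) z = a * dotr x z.
Proof. by rewrite /dotr mulr_sumr; apply: eq_bigr => j _; rewrite mxE mulrA. Qed.

Lemma dotrBl x y z : dotr (x - y) z = dotr x z - dotr y z.
Proof. by rewrite -scaleN1r dotrDl dotrZl mulN1r. Qed.

Lemma dotr0l z : dotr 0 z = 0.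
Proof. by rewrite /dotr big1// => j _; rewrite mxE mul0r. Qed.

Lemma dotrDr x y z : dotr z (x + y) = dotr z x + dotr z y.
Proof. by rewrite !(dotrC z) dotrDl. Qed.

Lemma dotrZr (a : R) x z : dotr z (a *: x) = a * dotr z x.
Proof. by rewrite !(dotrC z) dotrZl. Qed.

Lemma dotr_ge0 x y : cone x -> cone y -> 0 <= dotr x y.
Proof. by move=> cx cy; apply: sumr_ge0 => j _; apply: mulr_ge0; [exact: cx|exact: cy]. Qed.

Lemma dotr_mulmx (A : 'M[R]_d) x y : dotr (A *m x) y = dotr x (A^T *m y).
Proof.
rewrite /dotr; under eq_bigr do rewrite mxE mulr_suml.
rewrite exchange_big/=; apply: eq_bigr => i _.
rewrite mxE mulr_sumr; apply: eq_bigr => j _; rewrite mxE; ring.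
Qed.

Lemma dotr_e_ i x : dotr (e_ R i) x = x i 0.
Proof.
rewrite /dotr (bigD1 i)//= big1 ?addr0; first by rewrite mxE !eqxx mul1r.
by move=> j ji; rewrite mxE (negbTE ji) mul0r.
Qed.

Lemma n1Z (a : R) x : n1 (a *: x) = `|a| * n1 x.
Proof. by rewrite /n1 mulr_sumr; apply: eq_bigr => j _; rewrite mxE normrM. Qed.

Lemma coneZ (a : R) x : 0 <= a -> cone x -> cone (a *: x).
Proof. by move=> a0 cx i; rewrite mxE mulr_ge0//; exact: cx. Qed.

End vectors.

(** * The compensated exponential and its Taylor bounds *)

Section expR_remainder.
Variable R : realType.
Implicit Types u v : R.

Definition erem u : R := expR (- u) - 1 + u.

Lemma erem0 : erem 0 = 0. Proof. by rewrite /erem oppr0 expR0 subrr addr0. Qed.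

Lemma erem_ge0 u : 0 <= erem u.
Proof. by rewrite /erem; have := expR_ge1Dx (- u); lra. Qed.

Lemma is_derive_erem u : is_derive u 1 erem (1 - expR (- u)).
Proof.
have h := is_derive1_expRM (- 1) u.
have -> : erem = (fun t => (expR (- 1 * t) - 1) + t) by apply/funext => t; rewrite mulN1r.
have := is_derive1D (is_derive1B h (is_derive_cst (1:R) u 1)) (is_derive_id u 1).
by rewrite mulN1r subr0 addrC mulN1r.
Qed.

Lemma continuous_erem : continuous erem.
Proof. by move=> u; apply: is_derive1_continuous (is_derive_erem u). Qed.

Lemma erem_le u : 0 <= u -> erem u <= u ^+ 2 / 2.
Proof.
move=> u0.
have dF (s : R) : is_derive s 1 (fun t : R => erem t - 2^-1 * t ^+ 2) ((1 - expR (- s)) - 2^-1 * (s + s)).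
  apply: is_derive1B; first exact: is_derive_erem.
  apply: is_derive1Z.
  by have := is_derive1M (is_derive_id s 1) (is_derive_id s 1); rewrite /= mul1r mulr1.
have : erem u - 2^-1 * u ^+ 2 <= erem 0 - 2^-1 * 0 ^+ 2.
  apply: (is_derive_le_itv u0 _ (fun s _ => dF s)).
    by apply: continuous_subspaceT => s; exact: is_derive1_continuous (dF s).
  by move=> s _; have := expR_ge1Dx (- s); lra.
by rewrite erem0 expr0n /= mulr0 subrr; lra.
Qed.

Lemma erem_ge u : 0 <= u -> u ^+ 2 / 2 - u ^+ 3 / 6 <= erem u.
Proof.
move=> u0.
have dF (s : R) : is_derive s 1 (fun t : R => (2^-1 * t ^+ 2 - 6^-1 * (t * t ^+ 2)) - erem t)
    ((2^-1 * (s + s) - 6^-1 * (s ^+ 2 + s * (s + s))) - (1 - expR (- s))).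
  have d2 : is_derive s 1 (fun t : R => t ^+ 2) (s + s).
    by have := is_derive1M (is_derive_id s 1) (is_derive_id s 1); rewrite /= mul1r mulr1.
  apply: is_derive1B; last exact: is_derive_erem.
  apply: is_derive1B.
  apply: is_derive1Z.
  by have := is_derive1M (is_derive_id s 1) d2; rewrite mul1r.
have : (2^-1 * u ^+ 2 - 6^-1 * (u * u ^+ 2)) - erem u <= (2^-1 * 0 ^+ 2 - 6^-1 * (0 * 0 ^+ 2)) - erem 0.
  apply: (is_derive_le_itv u0 _ (fun s _ => dF s)).
    by apply: continuous_subspaceT => s; exact: is_derive1_continuous (dF s).
  move=> s /andP[s0 _].
  (* The derivative equals [erem s - s ^+ 2 / 2], so each Taylor bound is the integral of the
     preceding one. *)
  have := erem_le (ltW s0); rewrite /erem; nra.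
by rewrite erem0 expr0n /= !mulr0 !subr0 -exprS; lra.
Qed.

(** The derivative 1 - e^{-u} of [erem] lies between 0 and u. Keeping the factor u + v, instead of
    bounding it by a constant, makes the estimate quadratic in z once u and v are of the form <l,
    z>, so that it is integrable against the jump measures. *)
Lemma erem_lip u v : 0 <= u -> 0 <= v -> `|erem u - erem v| <= `|u - v| * (u + v).
Proof.
wlog uv : u v / v <= u.
  move=> H u0 v0; have [/H h|/ltW/H h] := leP v u; first exact: h.
  by rewrite distrC (distrC u) (addrC u); exact: h.
move=> u0 v0.
pose h := u - v; have h0 : 0 <= h by rewrite subr_ge0.
have -> : u = v + h by rewrite /h addrC subrK.
have E : erem (v + h) - erem v = expR (- v) * (expR (- h) - 1) + h.
  by rewrite /erem opprD expRD; ring.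
have lo : erem (v + h) - erem v >= 0.
  rewrite E; have h1 := expR_ge1Dx (- h); have h2 : expR (- v) <= 1 by rewrite -expR0 ler_expR oppr_le0.
  have h3 := expR_ge0 (- v); nra.
rewrite ger0_norm// E addrAC subrr add0r ger0_norm//.
have h1 := erem_le h0; rewrite /erem in h1.
have h2 : expR (- v) <= 1 by rewrite -expR0 ler_expR oppr_le0.
have h3 := expR_ge0 (- v); have h4 := expR_ge1Dx (- v).
have h5 : expR (- v) * (expR (- h) - 1) <= expR (- v) * (- h + h ^+ 2 / 2).
  by rewrite ler_wpM2l//; lra.
nra.
Qed.

Lemma erem_scaled_le n u : 0 <= u -> erem (n.+1%:R^-1 * u) * n.+1%:R ^+ 2 <= u ^+ 2 / 2.
Proof.
move=> u0; have n0 : n.+1%:R != 0 :> R by [].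
rewrite -ler_pdivlMr ?exprn_gt0//.
have := @erem_le (n.+1%:R^-1 * u); rewrite mulr_ge0 ?invr_ge0// => /(_ isT) h.
apply: le_trans h _; rewrite le_eqVlt; apply/orP; left; apply/eqP.
by move: n0; set N : R := n.+1%:R => n0; field.
Qed.

Lemma erem_scaled_ge n u : 0 <= u ->
  u ^+ 2 / 2 - n.+1%:R^-1 * (u ^+ 3 / 6) <= erem (n.+1%:R^-1 * u) * n.+1%:R ^+ 2.
Proof.
move=> u0; have n0 : 0 < n.+1%:R :> R by [].
rewrite -ler_pdivrMr ?exprn_gt0//.
have := @erem_ge (n.+1%:R^-1 * u); rewrite mulr_ge0 ?invr_ge0// => /(_ isT) h.
apply: le_trans h; rewrite le_eqVlt; apply/orP; left; apply/eqP.
by move: n0; set N : R := n.+1%:R => n0; field; rewrite gt_eqF.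
Qed.

Lemma cvg_invS : n.+1%:R^-1 @[n --> \oo] --> (0 : R).
Proof. exact: cvg_harmonic. Qed.

Lemma erem_scaled_cvg u : 0 <= u ->
  erem (n.+1%:R^-1 * u) * n.+1%:R ^+ 2 @[n --> \oo] --> 2^-1 * u ^+ 2.
Proof.
move=> u0; rewrite mulrC.
apply: (@squeeze_cvgr _ _ _ _ (fun n => u ^+ 2 / 2 - n.+1%:R^-1 * (u ^+ 3 / 6)) (fun=> u ^+ 2 / 2)).
- by apply: nearW => n; rewrite erem_scaled_le// erem_scaled_ge.
- rewrite -[X in _ --> X]subr0; apply: cvgB; first exact: cvg_cst.
  by rewrite -[X in _ --> X](mul0r (u ^+ 3 / 6)); apply: cvgM; [exact: cvg_invS|exact: cvg_cst].
- exact: cvg_cst.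
Qed.

Lemma onem_expR_scaled_bound n u : 0 <= u ->
  0 <= (1 - expR (- (n.+1%:R^-1 * u))) * n.+1%:R <= u.
Proof.
move=> u0; have n0 : 0 < n.+1%:R :> R by [].
rewrite mulr_ge0 ?ler0n//=; last first.
  by rewrite subr_ge0 -expR0 ler_expR oppr_le0 mulr_ge0// invr_ge0.
rewrite -ler_pdivlMr// (mulrC u).
by move: (n.+1%:R^-1 * u) => w; have := expR_ge1Dx (- w); lra.
Qed.

Lemma onem_expR_scaled_cvg u : 0 <= u ->
  (1 - expR (- (n.+1%:R^-1 * u))) * n.+1%:R @[n --> \oo] --> u.
Proof.
move=> u0.
apply: (@squeeze_cvgr _ _ _ _ (fun n => u - n.+1%:R^-1 * (u ^+ 2 / 2)) (fun=> u)).
- apply: nearW => n; have /andP[_ ->] := onem_expR_scaled_bound n u0; rewrite andbT.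
  have n0 : 0 < n.+1%:R :> R by [].
  rewrite -ler_pdivrMr//.
  have := @erem_le (n.+1%:R^-1 * u); rewrite mulr_ge0 ?invr_ge0// => /(_ isT).
  rewrite /erem -lerBlDr => h.
  have -> : (u - n.+1%:R^-1 * (u ^+ 2 / 2)) / n.+1%:R = n.+1%:R^-1 * u - (n.+1%:R^-1 * u) ^+ 2 / 2.
    by move: n0; set N : R := n.+1%:R => n0; field; rewrite gt_eqF.
  by move: (n.+1%:R^-1 * u) h => w h; lra.
- rewrite -[X in _ --> X]subr0; apply: cvgB; first exact: cvg_cst.
  by rewrite -[X in _ --> X](mul0r (u ^+ 2 / 2)); apply: cvgM; [exact: cvg_invS|exact: cvg_cst].
- exact: cvg_cst.
Qed.

End expR_remainder.

(** * Real integrals and second-order remainders *)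

Section Rintegral_theory.
Context (dd : measure_display) (T : measurableType dd) (R : realType).
Variables (mu : {measure set T -> \bar R}) (D : set T).
Hypothesis mD : measurable D.
Implicit Types f g : T -> R.

Local Notation rint f := (mu.-integrable D (EFin \o f)).

Lemma rint_measurable f : rint f -> measurable_fun D f.
Proof. by move=> /measurable_int/measurable_EFinP. Qed.

Lemma EFin_Rint f : rint f -> (\int[mu]_(x in D) f x)%:E = (\int[mu]_(x in D) (f x)%:E)%E.
Proof. by move=> h; rewrite /Rintegral fineK//; exact: integrable_fin_num. Qed.

Lemma rintD f g : rint f -> rint g -> rint (fun x => f x + g x).
Proof. by move=> hf hg; exact: (integrableD mD hf hg). Qed.

Lemma rintB f g : rint f -> rint g -> rint (fun x => f x - g x).
Proof. by move=> hf hg; exact: (integrableB mD hf hg). Qed.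

Lemma rintZ (k : R) f : rint f -> rint (fun x => k * f x).
Proof. by move=> hf; exact: (integrableZl mD k hf). Qed.

Lemma rint0 : rint (fun=> 0).
Proof. exact: integrable0. Qed.

Lemma rint_sum (I : Type) (s : seq I) (P : pred I) (h : I -> T -> R) :
  (forall i, P i -> rint (h i)) -> rint (fun x => \sum_(i <- s | P i) h i x).
Proof.
move=> hh; elim: s => [|i s IH].
  by under eq_fun do rewrite big_nil; exact: rint0.
under eq_fun do rewrite big_cons.
by have [Pi|//] := boolP (P i); apply: rintD => //; exact: hh.
Qed.

Lemma rint_le f g : measurable_fun D f -> (forall x, D x -> `|f x| <= g x) ->
  rint g -> rint f.
Proof.
move=> mf fg; apply: le_integrable => //; first exact/measurable_EFinP.
by move=> x Dx; rewrite /= lee_fin (le_trans (fg x Dx))// ler_norm.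
Qed.

Lemma rint_ge0_fin f : measurable_fun D f -> (forall x, D x -> 0 <= f x) ->
  (\int[mu]_(x in D) (f x)%:E < +oo)%E -> rint f.
Proof.
move=> mf f0 fin; apply/integrableP; split; first exact/measurable_EFinP.
by under eq_integral => x /set_mem Dx do rewrite /= ger0_norm ?f0//.
Qed.

Lemma Rintegral_sum (I : Type) (s : seq I) (P : pred I) (h : I -> T -> R) :
  (forall i, P i -> rint (h i)) ->
  \int[mu]_(x in D) (\sum_(i <- s | P i) h i x) = \sum_(i <- s | P i) \int[mu]_(x in D) h i x.
Proof.
move=> hh; elim: s => [|i s IH].
  under eq_Rintegral do rewrite big_nil.
  by rewrite big_nil /Rintegral integral0.
under eq_Rintegral do rewrite big_cons.
rewrite big_cons; have [Pi|//] := boolP (P i).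
by rewrite RintegralD// ?IH//; [exact: hh|exact: rint_sum].
Qed.

Lemma Rintegral_dominated_cvg (f_ : nat -> T -> R) f g :
  (forall n, measurable_fun D (f_ n)) -> measurable_fun D f ->
  (forall x, D x -> f_ n x @[n --> \oo] --> f x) ->
  rint g -> (forall n x, D x -> `|f_ n x| <= g x) ->
  \int[mu]_(x in D) f_ n x @[n --> \oo] --> \int[mu]_(x in D) f x.
Proof.
move=> mf_ mf cf ig fg.
have ir n : rint (f_ n) by exact: rint_le (mf_ n) (fg n) ig.
have [] := @dominated_convergence _ _ _ mu D mD (fun n => EFin \o f_ n) (EFin \o f) (EFin \o g).
- by move=> n; exact/measurable_EFinP.
- exact/measurable_EFinP.
- by apply: aeW => x Dx; apply: cvg_EFin; [exact: nearW|exact: cf].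
- exact: ig.
- by apply: aeW => x n Dx; rewrite /= lee_fin fg.
move=> irf _.
rewrite -(EFin_Rint irf) => /fine_cvgP[_ h].
exact: h.
Qed.

(** Fatou's lemma bounds the integral of f by L, and monotonicity from f_n <= f gives the converse.
    Dominated convergence would presuppose the integrability of f, which is a conclusion here. *)
Lemma integral_cvg_from_below (f_ : nat -> T -> R) f (a : R ^nat) (L : R) :
  (forall n, measurable_fun D (f_ n)) -> measurable_fun D f ->
  (forall n x, D x -> 0 <= f_ n x <= f x) ->
  (forall x, D x -> f_ n x @[n --> \oo] --> f x) ->
  (forall n, (\int[mu]_(x in D) (f_ n x)%:E)%E = (a n)%:E) ->
  a @ \oo --> L -> (\int[mu]_(x in D) (f x)%:E)%E = L%:E.
Proof.
move=> mf_ mf f0 cf fa aL.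
have aLE : (a n)%:E @[n --> \oo] --> L%:E by apply: cvg_EFin => //; exact: nearW.
apply/le_anti/andP; split.
  have := @fatou _ _ _ mu D mD (fun n => EFin \o f_ n).
  have -> : (fun n => \int[mu]_(x in D) (EFin \o f_ n) x)%E = (fun n => (a n)%:E).
    by apply/funext => n; rewrite -fa.
  rewrite (cvg_limn_einf_sup aLE) => H.
  apply: le_trans (H _ _); last 2 first.
  - by move=> n; exact/measurable_EFinP.
  - by move=> n x Dx; rewrite /= lee_fin; case/andP: (f0 n x Dx).
  rewrite le_eqVlt; apply/orP; left; apply/eqP; apply: eq_integral => x /set_mem Dx.
  have cE : (EFin \o f_ n) x @[n --> \oo] --> (f x)%:E.
    by apply: cvg_EFin; [exact: nearW|exact: cf].
  by rewrite (cvg_limn_einf_sup cE).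
rewrite -(cvg_lim (@ereal_hausdorff R) aLE).
apply: lime_le; first by apply/cvg_ex; exists L%:E.
apply: nearW => n; rewrite -fa.
by apply: ge0_le_integral => //;
  [move=> x Dx; rewrite lee_fin; case/andP: (f0 n x Dx)|exact/measurable_EFinP
  |exact/measurable_EFinP|move=> x Dx; rewrite lee_fin; case/andP: (f0 n x Dx)].
Qed.

End Rintegral_theory.

(** * Remainder integrals for a square-integrable jump measure *)

Section second_moment.
Variables (R : realType) (d : nat) (m : {measure set (Rvec R d) -> \bar R}).
Hypothesis sqint : m.-integrable Uset (EFin \o (fun z => enorm z ^+ 2)).
Implicit Types l k : 'cV[R]_d.

Local Notation mU := (@measurable_Uset R d).
Local Notation rint f := (m.-integrable Uset (EFin \o f)).

Lemma rint_dotrM k l : rint (fun z : Rvec R d => dotr k z * dotr l z).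
Proof.
apply: (rint_le mU _ _ (rintZ mU (n1 k * n1 l) sqint)).
  by apply: measurable_funM; exact: measurable_dotr.
move=> z Uz; rewrite normrM [X in _ <= X](_ : _ = (n1 k * enorm z) * (n1 l * enorm z)); last by ring.
by apply: ler_pM => //; exact: dotr_le.
Qed.

Lemma rint_dotr_sqr l : rint (fun z : Rvec R d => dotr l z ^+ 2).
Proof. exact: (rint_dotrM l l). Qed.

Lemma rint_erem l : cone l -> rint (fun z : Rvec R d => erem (dotr l z)).
Proof.
move=> cl; apply: (rint_le mU _ _ (rint_dotr_sqr l)).
  apply: measurableT_comp; last exact: measurable_dotr.
  by apply: continuous_measurable_fun; exact: continuous_erem.
move=> z Uz; have h := dotr_ge0 cl (Uset_cone Uz).
rewrite ger0_norm ?erem_ge0// (le_trans (erem_le h))//.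
by have := sqr_ge0 (dotr l z); lra.
Qed.

Definition ierem l := \int[m]_(z in Uset) erem (dotr l z).

Definition isq l := \int[m]_(z in Uset) (dotr l z ^+ 2).

Definition isqr := \int[m]_(z in Uset) (enorm z ^+ 2).

Lemma isqr_ge0 : 0 <= isqr.
Proof. by apply: Rintegral_ge0 => z _; exact: sqr_ge0. Qed.

Lemma ierem_ge0 l : 0 <= ierem l.
Proof. by apply: Rintegral_ge0 => z _; exact: erem_ge0. Qed.

Lemma ierem0 : ierem 0 = 0.
Proof.
rewrite /ierem; under eq_Rintegral do rewrite dotr0l erem0.
by rewrite /Rintegral integral0.
Qed.

Lemma ierem_lip k l : cone k -> cone l ->
  `|ierem k - ierem l| <= n1 (k - l) * (n1 k + n1 l) * isqr.
Proof.
move=> ck cl.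
have ik := rint_erem ck; have il := rint_erem cl.
rewrite /ierem -RintegralB//; last exact: mU.
have pw z : Uset z -> `|erem (dotr k z) - erem (dotr l z)| <=
    n1 (k - l) * (n1 k + n1 l) * enorm z ^+ 2.
  move=> Uz.
  have hk := dotr_ge0 ck (Uset_cone Uz); have hl := dotr_ge0 cl (Uset_cone Uz).
  apply: le_trans (erem_lip hk hl) _.
  rewrite -dotrBl [leRHS](_ : _ = (n1 (k - l) * enorm z) * ((n1 k + n1 l) * enorm z)); last by ring.
  apply: ler_pM => //; [exact: addr_ge0|exact: dotr_le|].
  by rewrite mulrDl; apply: lerD; apply: le_trans (dotr_le _ _); exact: ler_norm.
apply: le_trans (le_normr_Rintegral mU (rintB mU ik il)) _.
rewrite /isqr -RintegralZl//; last exact: mU.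
apply: le_Rintegral => //; first exact: mU.
  apply: (rint_le mU _ _ (rintZ mU (n1 (k - l) * (n1 k + n1 l)) sqint)).
    apply: measurableT_comp => //.
    by apply: measurable_funB; [exact: (rint_measurable ik)|exact: (rint_measurable il)].
  by move=> z Uz; rewrite normr_id; exact: pw.
exact: (rintZ mU).
Qed.

(** Half the square dominates the rescaled integrand and is also its pointwise limit. *)
Lemma ierem_cvg l : cone l ->
  ierem (n.+1%:R^-1 *: l) * n.+1%:R ^+ 2 @[n --> \oo] -->
  2^-1 * isq l.
Proof.
move=> cl.
have cth n : cone (n.+1%:R^-1 *: l) by apply: coneZ.
rewrite /isq -RintegralZl; [|exact: mU|exact: rint_dotr_sqr].
have -> : (fun n => ierem (n.+1%:R^-1 *: l) * n.+1%:R ^+ 2) =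
  (fun n => \int[m]_(z in Uset) (erem (dotr (n.+1%:R^-1 *: l) z) * n.+1%:R ^+ 2)).
  by apply/funext => n; rewrite RintegralZr//; [exact: mU|exact: rint_erem].
apply: (Rintegral_dominated_cvg mU).
- move=> n; apply: measurable_funM; last exact: measurable_cst.
  exact: rint_measurable (rint_erem (cth n)).
- exact: rint_measurable (rintZ mU _ (rint_dotr_sqr l)).
- move=> z Uz; under eq_fun do rewrite dotrZl.
  by apply: erem_scaled_cvg; exact: dotr_ge0 cl (Uset_cone Uz).
- exact: (rintZ mU 2^-1 (rint_dotr_sqr l)).
- move=> n z Uz; have h := dotr_ge0 cl (Uset_cone Uz).
  rewrite dotrZl ger0_norm ?mulr_ge0 ?erem_ge0 ?sqr_ge0//.
  by rewrite (le_trans (erem_scaled_le n h))// mulrC.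
Qed.

Lemma isq_lip k l : `|isq k - isq l| <= n1 (k - l) * (n1 k + n1 l) * isqr.
Proof.
have ik := rint_dotr_sqr k; have il := rint_dotr_sqr l.
rewrite /isq -RintegralB//; last exact: mU.
have pw z : `|dotr k z ^+ 2 - dotr l z ^+ 2| <= n1 (k - l) * (n1 k + n1 l) * enorm z ^+ 2.
  rewrite subr_sqr -dotrBl normrM.
  rewrite [leRHS](_ : _ = (n1 (k - l) * enorm z) * ((n1 k + n1 l) * enorm z)); last by ring.
  apply: ler_pM => //; first exact: dotr_le.
  by rewrite (le_trans (ler_normD _ _))// mulrDl lerD// dotr_le.
apply: le_trans (le_normr_Rintegral mU (rintB mU ik il)) _.
rewrite /isqr -RintegralZl//; last exact: mU.
apply: le_Rintegral => //; first exact: mU.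
  apply: (rint_le mU _ _ (rintZ mU (n1 (k - l) * (n1 k + n1 l)) sqint)).
    apply: measurableT_comp => //.
    by apply: measurable_funB; [exact: (rint_measurable ik)|exact: (rint_measurable il)].
  by move=> z Uz; rewrite normr_id; exact: pw.
exact: (rintZ mU).
Qed.

Lemma isq_parallelogram k l : isq (k + l) + isq (k - l) = 2 * isq k + 2 * isq l.
Proof.
rewrite /isq -!RintegralZl; [|exact: mU|exact: rint_dotr_sqr|exact: mU|exact: rint_dotr_sqr].
rewrite -!RintegralD; [|exact: mU|exact: (rintZ mU _ (rint_dotr_sqr _))|exact: (rintZ mU _ (rint_dotr_sqr _))
  |exact: mU|exact: rint_dotr_sqr|exact: rint_dotr_sqr].
by apply: eq_Rintegral => z _; rewrite dotrBl dotrDl; ring.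
Qed.

End second_moment.

(** * Compensated form of the branching and immigration mechanisms *)

Section cbi_mechanisms.
Variables (R : realType) (d : nat) (p : cbi_params R d).
Hypothesis adm : admissible p.
Hypothesis mu_tail : (\sum_(l < d) \int[pmu p l]_(z in Uset)
     (enorm z ^+ 2 * (1 <= enorm z)%R%:R)%:E < +oo)%E.
Hypothesis nu_tail : (\int[pnu p]_(r in Uset)
     (enorm r ^+ 2 * (1 <= enorm r)%R%:R)%:E < +oo)%E.

Local Notation mU := (@measurable_Uset R d).
Local Notation U := (@Uset R d).

Let mtail : measurable_fun U (fun z : Rvec R d => enorm z ^+ 2 * (1 <= enorm z)%R%:R).
Proof.
apply: measurable_funM; first by apply: measurable_funX; exact: measurable_enorm.
rewrite (_ : (fun z => _) = (fun z : Rvec R d => if 1 <= enorm z then 1 else 0)); last first.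
  by apply/funext => z; case: ifP.
apply: measurable_fun_if => //; first exact: mU.
by apply: measurable_fun_ler; [exact: measurable_cst|exact: measurable_enorm].
Qed.

Definition mu_weight i (z : Rvec R d) : R :=
  Num.min (enorm z) (enorm z ^+ 2) + \sum_(j | j != i) Num.min 1 (z j 0).

Lemma sum_min1_ge0 i (z : Rvec R d) : cone z -> 0 <= \sum_(j | j != i) Num.min 1 (z j 0).
Proof. by move=> cz; apply: sumr_ge0 => j _; rewrite le_min ler01; exact: cz. Qed.

Lemma min_enorm_ge0 (z : Rvec R d) : 0 <= Num.min (enorm z) (enorm z ^+ 2).
Proof. by rewrite le_min enorm_ge0 sqr_ge0. Qed.

Lemma mu_weight_int i : (pmu p i).-integrable U (EFin \o mu_weight i).
Proof.
have [_ [_ _ _ _ /(_ i)[_ fin]]] := adm.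
apply: rint_ge0_fin => //.
  apply: measurable_funD.
    by apply: measurable_minr; [|apply: measurable_funX]; exact: measurable_enorm.
  rewrite (_ : (fun z => _) = (fun z : Rvec R d => \sum_j (if j != i then Num.min 1 (z j 0) else 0))); last first.
    by apply/funext => z; rewrite big_mkcond.
  apply: measurable_sum => j; case: (j != i) => //=.
  by apply: measurable_minr; [exact: measurable_cst|exact: measurable_coord].
by move=> z Uz; rewrite addr_ge0// ?min_enorm_ge0// sum_min1_ge0//; exact: Uset_cone.
Qed.

(** For norms below 1 the minimum in [mu_weight] is the square itself; the other jumps are covered
    by [mu_tail]. *)
Lemma mu_sqint i : (pmu p i).-integrable U (EFin \o (fun z => enorm z ^+ 2)).
Proof.
have i2 : (pmu p i).-integrable U (EFin \o (fun z => enorm z ^+ 2 * (1 <= enorm z)%R%:R)).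
  apply: rint_ge0_fin => //.
    by move=> z _; rewrite mulr_ge0 ?sqr_ge0.
  apply: le_lt_trans mu_tail; rewrite (bigD1 i)//=; apply: leeDl.
  apply: sume_ge0 => j _; apply: integral_ge0 => z _.
  by rewrite lee_fin mulr_ge0 ?sqr_ge0.
apply: (rint_le mU _ _ (rintD mU (mu_weight_int i) i2)).
  by apply: measurable_funX; exact: measurable_enorm.
move=> z Uz; rewrite ger0_norm ?sqr_ge0// /mu_weight.
have h1 := sum_min1_ge0 i (Uset_cone Uz); have h2 := min_enorm_ge0 z.
have [e1|e1] := leP 1 (enorm z).
  by rewrite mulr1 lerDr addr_ge0.
rewrite mulr0 addr0; apply: le_trans (_ : _ <= Num.min (enorm z) (enorm z ^+ 2)) _.
  by rewrite le_min lexx andbT expr2 ler_piMl// ?enorm_ge0// ltW.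
by rewrite lerDl.
Qed.

Lemma nu_int1 : (pnu p).-integrable U (EFin \o (fun z => Num.min 1 (enorm z))).
Proof.
have [_ [_ _ _ [_ fin] _]] := adm.
apply: rint_ge0_fin => //.
  by apply: measurable_minr; [exact: measurable_cst|exact: measurable_enorm].
by move=> z _; rewrite le_min ler01 enorm_ge0.
Qed.

Lemma nu_int2 : (pnu p).-integrable U (EFin \o (fun z => enorm z ^+ 2 * (1 <= enorm z)%R%:R)).
Proof.
apply: rint_ge0_fin => //.
by move=> z _; rewrite mulr_ge0 ?sqr_ge0.
Qed.

Lemma nu_sqint : (pnu p).-integrable U (EFin \o (fun z => enorm z ^+ 2)).
Proof.
apply: (rint_le mU _ _ (rintD mU nu_int1 nu_int2)).
  by apply: measurable_funX; exact: measurable_enorm.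
move=> z Uz; rewrite ger0_norm ?sqr_ge0//; have h := enorm_ge0 z.
have [e1|e1] := leP 1 (enorm z); first by rewrite mulr1 lerDr ler01.
by rewrite mulr0 addr0 expr2 ler_piMl// ltW.
Qed.

Lemma nu_int_coord i : (pnu p).-integrable U (EFin \o (fun z => z i 0)).
Proof.
apply: (rint_le mU _ _ (rintD mU nu_int1 nu_int2)); first exact: measurable_coord.
move=> z Uz; apply: le_trans (coord_le_enorm z i) _; have h := enorm_ge0 z.
have [e1|e1] := leP 1 (enorm z); last by rewrite mulr0 addr0.
by rewrite mulr1 (@le_trans _ _ (enorm z ^+ 2))// ?lerDr ?ler01// expr2 ler_peMl.
Qed.

(** Three ranges occur. If the norm is at least 1, [mu_weight] is at least the norm. If it is
    smaller and i = j, the integrand vanishes because z_i < 1. If it is smaller and i differs from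
    j, then z_i is one of the terms min(1, z_i) of the admissibility condition. *)
Lemma mu_int_drift i j : (pmu p j).-integrable U
  (EFin \o (fun z => Num.max 0 (z i 0 - (i == j)%:R))).
Proof.
apply: (rint_le mU _ _ (mu_weight_int j)).
  apply: measurable_maxr; first exact: measurable_cst.
  by apply: measurable_funB; [exact: measurable_coord|exact: measurable_cst].
move=> z Uz; have h1 := sum_min1_ge0 j (Uset_cone Uz); have h2 := min_enorm_ge0 z.
rewrite ger0_norm ?le_max ?lexx// /mu_weight ge_max addr_ge0//=.
have zi : z i 0 <= enorm z by apply: le_trans (coord_le_enorm z i); exact: ler_norm.
have zi0 : 0 <= z i 0 by exact: (Uset_cone Uz).
have [e1|e1] := leP 1 (enorm z).
  apply: le_trans (_ : enorm z <= _).
    by rewrite lerBlDr (le_trans zi)// lerDl.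
  by rewrite min_l ?lerDl// expr2 ler_peMl ?enorm_ge0.
have [ij|ij] := eqVneq i j.
  rewrite (@le_trans _ _ 0)//; last exact: addr_ge0.
  by rewrite subr_le0 (le_trans zi)// ltW.
rewrite subr0 (bigD1 i)//= (min_r (le_trans zi (ltW e1))).
rewrite addrCA lerDl addr_ge0// sumr_ge0// => k _.
by rewrite le_min ler01; exact: (Uset_cone Uz).
Qed.

(** The nonlinear part of the i-th branching mechanism: nonnegative and of second order at 0. *)
Definition brem i (l : 'cV[R]_d) := pc p i 0 * l i 0 ^+ 2 + ierem (pmu p i) l.

(** Since min(1, z_i) = z_i - (z_i - 1)^+, passing from the truncated compensator to the full <l, z>
    costs the sum over j of l_j (z_j - delta_ij)^+. Its integral is exactly the correction that
    turns B into [Btilde]. *)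
Lemma branchingE i l : cone l -> branching p i l = brem i l - ((Btilde p)^T *m l) i 0.
Proof.
move=> cl.
have E z : U z -> expR (- dotr l z) - 1 + l i 0 * Num.min 1 (z i 0) =
    erem (dotr l z) - \sum_j l j 0 * Num.max 0 (z j 0 - (j == i)%:R).
  move=> Uz.
  suff S : \sum_j l j 0 * Num.max 0 (z j 0 - (j == i)%:R) = dotr l z - l i 0 * Num.min 1 (z i 0).
    by rewrite S /erem; ring.
  rewrite /dotr (bigD1 i)//= [in RHS](bigD1 i)//= eqxx.
  have -> : \sum_(j | j != i) l j 0 * z j 0 = \sum_(j | j != i) l j 0 * Num.max 0 (z j 0 - (j == i)%:R).
    apply: eq_bigr => j ji; rewrite (negbTE ji) subr0 max_r//; exact: (Uset_cone Uz).
  have -> : Num.max 0 (z i 0 - 1) = z i 0 - Num.min 1 (z i 0).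
    by case: (leP 1 (z i 0)) => h; [rewrite max_r ?subr_ge0|rewrite subrr max_l ?subr_le0 ?ltW].
  ring.
rewrite /branching; under eq_Rintegral => z /set_mem Uz do rewrite (E _ Uz).
have ie : forall j, (pmu p i).-integrable U (EFin \o (fun z : Rvec R d => l j 0 * Num.max 0 (z j 0 - (j == i)%:R))).
  by move=> j; exact: (rintZ mU _ (mu_int_drift j i)).
rewrite RintegralB//; last 3 first.
- exact: mU.
- exact: (rint_erem (mu_sqint i) cl).
- by apply: (rint_sum mU) => j _; exact: ie.
rewrite (Rintegral_sum mU)//.
rewrite /brem -/(ierem _ _).
rewrite mxE [in RHS](eq_bigr (fun j => (pB p *m e_ R i) j 0 * l j 0 + \int[pmu p i]_(z in U) (l j 0 * Num.max 0 (z j 0 - (j == i)%:R)))); last first.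
  move=> j _; rewrite RintegralZl//; last 2 first.
  - exact: mU.
  - exact: mu_int_drift.
  rewrite !mxE mulrDl mulrC; congr (_ + _); last by rewrite mulrC.
  rewrite (bigD1 i)//= big1 ?addr0; first by rewrite mxE !eqxx mulr1 mulrC.
  by move=> k ki; rewrite mxE (negbTE ki) mulr0.
rewrite big_split/= -/(dotr _ _); ring.
Qed.

Lemma immigrationE l : cone l -> immigration p l = dotr (betatilde p) l - ierem (pnu p) l.
Proof.
move=> cl.
have E (z : Rvec R d) : 1 - expR (- dotr l z) = (\sum_j l j 0 * z j 0) - erem (dotr l z).
  by rewrite /erem -/(dotr l z); ring.
rewrite /immigration; under eq_Rintegral => z _ do rewrite E.
have ie : forall j, (pnu p).-integrable U (EFin \o (fun z : Rvec R d => l j 0 * z j 0)).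
  by move=> j; exact: (rintZ mU _ (nu_int_coord j)).
rewrite RintegralB//; last 3 first.
- exact: mU.
- by apply: (rint_sum mU) => j _; exact: ie.
- exact: (rint_erem nu_sqint cl).
rewrite addrA; congr (_ - _).
rewrite (Rintegral_sum mU)// /dotr -big_split/=; apply: eq_bigr => j _.
rewrite RintegralZl//; last 2 first.
- exact: mU.
- exact: nu_int_coord.
by rewrite !mxE mulrDl (mulrC (l j 0)).
Qed.

End cbi_mechanisms.

(** * Continuous functions of time and their integrals *)

Section continuity.
Variable R : realType.
Implicit Types f g : R -> R.

Lemma continuous_funD f g : continuous f -> continuous g -> continuous (fun s => f s + g s).
Proof. by move=> cf cg x; apply: cvgD; [exact: cf|exact: cg]. Qed.

Lemma continuous_funB f g : continuous f -> continuous g -> continuous (fun s => f s - g s).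
Proof. by move=> cf cg x; apply: cvgB; [exact: cf|exact: cg]. Qed.

Lemma continuous_funM f g : continuous f -> continuous g -> continuous (fun s => f s * g s).
Proof. by move=> cf cg x; apply: cvgM; [exact: cf|exact: cg]. Qed.

Lemma continuous_funZ (k : R) f : continuous f -> continuous (fun s => k * f s).
Proof. by move=> cf; apply: continuous_funM => // x; exact: cvg_cst. Qed.

Lemma continuous_fun_sum n (h : 'I_n -> R -> R) :
  (forall i, continuous (h i)) -> continuous (fun s => \sum_i h i s).
Proof. by move=> ch x; apply: cvg_sumr => i _; exact: ch. Qed.

Lemma continuous_fun_subl f (t : R) : continuous f -> continuous (fun s => f (t - s)).
Proof.
move=> cf x; apply: (@continuous_comp _ _ _ (fun s => t - s) f); last exact: cf.
by apply: cvgB; [exact: cvg_cst|exact: cvg_id].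
Qed.

Lemma continuous_fun_norm f : continuous f -> continuous (fun s => `|f s|).
Proof. by move=> cf x; apply: cvg_norm; exact: cf. Qed.

Lemma continuous_rint f (a b : R) : continuous f ->
  lebesgue_measure.-integrable `[a, b] (EFin \o f).
Proof. by move=> cf; apply: continuous_itv_integrable; exact: continuous_subspaceT. Qed.

Lemma itv_Rint_FTC (F f : R -> R) (t : R) : 0 <= t ->
  (forall s : R, is_derive s 1 F (f s)) -> continuous f ->
  \int[lebesgue_measure]_(s in `[0, t]) f s = F t - F 0.
Proof.
move=> t0 dF cf; apply: Rintegral_FTC => //; last exact: continuous_subspaceT.
by apply: continuous_subspaceT => s; exact: is_derive1_continuous (dF s).
Qed.

Lemma itv_RintD f g (a b : R) : continuous f -> continuous g ->
  \int[lebesgue_measure]_(s in `[a, b]) (f s + g s) =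
  \int[lebesgue_measure]_(s in `[a, b]) f s + \int[lebesgue_measure]_(s in `[a, b]) g s.
Proof. by move=> cf cg; rewrite RintegralD//; exact: continuous_rint. Qed.

Lemma itv_RintB f g (a b : R) : continuous f -> continuous g ->
  \int[lebesgue_measure]_(s in `[a, b]) (f s - g s) =
  \int[lebesgue_measure]_(s in `[a, b]) f s - \int[lebesgue_measure]_(s in `[a, b]) g s.
Proof. by move=> cf cg; rewrite RintegralB//; exact: continuous_rint. Qed.

Lemma itv_RintZ f (k a b : R) : continuous f ->
  \int[lebesgue_measure]_(s in `[a, b]) (k * f s) = k * \int[lebesgue_measure]_(s in `[a, b]) f s.
Proof. by move=> cf; rewrite RintegralZl//; exact: continuous_rint. Qed.

Lemma itv_Rint_sum n (h : 'I_n -> R -> R) (a b : R) : (forall i, continuous (h i)) ->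
  \int[lebesgue_measure]_(s in `[a, b]) (\sum_i h i s) =
  \sum_i \int[lebesgue_measure]_(s in `[a, b]) h i s.
Proof. by move=> ch; rewrite Rintegral_sum// => i _; exact: continuous_rint. Qed.

Lemma itv_Rint_parallelogram (f g h k : R -> R) (a b : R) :
  continuous f -> continuous g -> continuous h -> continuous k ->
  (forall s, f s + g s = 2 * h s + 2 * k s) ->
  \int[lebesgue_measure]_(s in `[a, b]) f s + \int[lebesgue_measure]_(s in `[a, b]) g s =
  2 * \int[lebesgue_measure]_(s in `[a, b]) h s + 2 * \int[lebesgue_measure]_(s in `[a, b]) k s.
Proof.
move=> cf cg ch ck E; have c2 (u : R -> R) := @continuous_funZ 2 u.
rewrite -itv_RintD// -!itv_RintZ// -itv_RintD; [|exact: c2|exact: c2].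
by apply: eq_Rintegral => s _.
Qed.

(** [P] is the region where the Lipschitz bound is known: the cone for the exponential remainders,
    the whole space for their quadratic limits. *)
Lemma continuous_lip (d : nat) (P : 'cV[R]_d -> Prop) (F : 'cV[R]_d -> R)
    (w : R -> 'cV[R]_d) (L : R) :
  (forall i, continuous (fun s => w s i 0)) -> (forall s, P (w s)) ->
  (forall k l : 'cV[R]_d, P k -> P l -> `|F k - F l| <= n1 (k - l) * (n1 k + n1 l) * L) ->
  continuous (fun s => F (w s)).
Proof.
move=> cw kw lipF x.
have cn (k : 'cV[R]_d) : continuous (fun s => n1 (w s - k)).
  apply: continuous_fun_sum => i; apply: continuous_fun_norm.
  under eq_fun do rewrite !mxE.
  by apply: continuous_funB => // y; exact: cvg_cst.
have c1 : continuous (fun s => n1 (w s - w x) * (n1 (w s - 0) + n1 (w x)) * L).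
  apply: continuous_funM; last by move=> y; exact: cvg_cst.
  by apply: continuous_funM => //; apply: continuous_funD => // y; exact: cvg_cst.
have n0 : n1 (w x - w x) = 0 by rewrite subrr /n1 big1// => i _; rewrite mxE normr0.
have h : n1 (w s - w x) * (n1 (w s - 0) + n1 (w x)) * L @[s --> x] --> 0.
  by have := c1 x; rewrite /continuous_at n0 !mul0r.
suff : F (w s) - F (w x) @[s --> x] --> 0.
  by move=> /subr_cvg0.
apply/norm_cvg0P.
apply: (@squeeze_cvgr _ _ _ _ (fun=> 0) (fun s => n1 (w s - w x) * (n1 (w s - 0) + n1 (w x)) * L)) => //.
  by apply: nearW => s; rewrite normr_ge0 subr0 lipF.
exact: cvg_cst.
Qed.

End continuity.

(** * The branching flow *)

Section flow_extension.
Variables (R : realType) (d : nat) (p : cbi_params R d).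

(** The derivative is prescribed for s > 0 only, since an extension that is constant at negative
    times may have a kink at 0. *)
Definition flow_ext (w : R -> 'cV[R]_d) (l : 'cV[R]_d) : Prop :=
  [/\ w 0 = l, forall s, cone (w s), forall i, continuous (fun s => w s i 0) &
     forall (s : R) i, 0 < s -> is_derive s 1 (fun s => w s i 0) (- branching p i (w s))].

(* Freezing the flow at negative times makes it continuous on the whole line. *)
Lemma branching_flow_ext v l : branching_flow p v l ->
  exists2 w, flow_ext w l & forall s, 0 <= s -> w s = v s.
Proof.
move=> [cv _ v0 dv].
pose w s := v (Num.max 0 s).
have wv s : 0 <= s -> w s = v s by move=> s0; rewrite /w max_r.
have dw (s : R) i : 0 < s -> is_derive s 1 (fun s => w s i 0) (- branching p i (w s)).
  move=> s0; rewrite wv ?ltW//; apply/is_derive1_caratheodory.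
  (* Caratheodory's slope function. A small punctured neighbourhood of s > 0 lies inside [0, +oo[,
     so the relative derivative is a two-sided one. *)
  pose g z := if z == s then - branching p i (v s) else (w z i 0 - v s i 0) / (z - s).
  exists g; split; last by rewrite /g eqxx.
    move=> z; rewrite /g -(wv _ (ltW s0)); case: eqVneq => [->|zs]; first by rewrite !subrr mulr0.
    by rewrite divfK// subr_eq0.
  apply/continuous_withinNx; rewrite {2}/g eqxx.
  have h := dv s i (ltW s0).
  move=> P Pa; have := h P Pa; rewrite /nbhs/= /within/= => hP.
  have pos : \forall z \near s^', 0 < z.
    by apply: nbhs_dnbhs; exact: lt_nbhsr.
  have neq : \forall z \near s^', z != s by exact: nbhs_dnbhs_neq.
  near=> z.
  have z0 : 0 < z by near: z.
  have zs : z != s by near: z.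
  rewrite /= /g (negbTE zs) wv ?ltW//.
  apply: (near hP z) => //.
  by rewrite /= in_itv/= andbT ltW.
have cw i : continuous (fun s => w s i 0).
  move=> x; have [x0|x0|x0] := ltgtP x 0.
  - apply: cvg_near_cst; near=> z; rewrite /w !max_l// ltW//; near: z.
    exact: lt_nbhsl.
  - exact: is_derive1_continuous (dw x i x0).
  - rewrite x0; apply/left_right_continuousP; split.
      apply: cvg_near_cst; near=> z; rewrite /w maxxx max_l// ltW//; near: z.
    (* Right continuity at 0 is recovered by multiplying the convergent difference quotient by s. *)
    have h : (v s i 0 - v 0 i 0) / (s - 0) @[s --> 0^'+] --> - branching p i (v 0).
      move=> P Pa; have := dv 0 i (lexx _) P Pa; rewrite /nbhs/= /within/= => hP.
      have [e /= e0 he] := hP; exists e => //= z ze z0.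
      by apply: he => //; rewrite ?gt_eqF// in_itv/= ltW.
    have h2 : (v s i 0 - v 0 i 0) / (s - 0) * s + v 0 i 0 @[s --> 0^'+] --> w 0 i 0.
      have -> : w 0 i 0 = - branching p i (v 0) * 0 + v 0 i 0 by rewrite wv// mulr0 add0r.
      apply: cvgD; last exact: cvg_cst.
      by apply: cvgM => //; apply: (@cvg_at_right_filter _ _ id); exact: cvg_id.
    apply: cvg_trans h2; apply: near_eq_cvg; near=> z.
    have z0 : 0 < z by [].
    by rewrite wv ?ltW// subr0 divfK ?gt_eqF// subrK.
exists w => //; split => // [|s]; first by rewrite wv.
by apply: cv; rewrite le_max lexx.
Unshelve. all: by end_near. Qed.

End flow_extension.

Section branching_flow.
Variables (R : realType) (d : nat) (p : cbi_params R d).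
Hypothesis adm : admissible p.
Hypothesis mu_tail : (\sum_(l < d) \int[pmu p l]_(z in Uset)
     (enorm z ^+ 2 * (1 <= enorm z)%R%:R)%:E < +oo)%E.
Hypothesis nu_tail : (\int[pnu p]_(r in Uset)
     (enorm r ^+ 2 * (1 <= enorm r)%R%:R)%:E < +oo)%E.

Local Notation B := (Btilde p).
Local Notation b := (betatilde p).

Let c_ge0 i : 0 <= pc p i 0.
Proof. by have [_ [h _ _ _ _]] := adm; exact: h. Qed.

Let mu_int i := mu_sqint adm mu_tail i.
Let nu2 := nu_sqint adm nu_tail.

Lemma brem_ge0 i (l : 'cV[R]_d) : 0 <= brem p i l.
Proof. by rewrite addr_ge0 ?ierem_ge0// mulr_ge0 ?sqr_ge0. Qed.

Lemma brem0 i : brem p i 0 = 0.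
Proof. by rewrite /brem mxE expr0n mulr0 ierem0 addr0. Qed.

(** One constant valid for all the branching remainders and for the immigration remainder. *)
Definition lip_const : R := \sum_i (pc p i 0 + isqr (pmu p i)) + isqr (pnu p).

Lemma lip_const_ge0 : 0 <= lip_const.
Proof. by rewrite addr_ge0 ?isqr_ge0// sumr_ge0// => i _; rewrite addr_ge0 ?isqr_ge0. Qed.

Lemma brem_lip i (k l : 'cV[R]_d) : cone k -> cone l ->
  `|brem p i k - brem p i l| <= n1 (k - l) * (n1 k + n1 l) * lip_const.
Proof.
move=> ck cl.
have P0 : 0 <= n1 (k - l) * (n1 k + n1 l) by rewrite mulr_ge0 ?addr_ge0 ?n1_ge0.
have -> : brem p i k - brem p i l = pc p i 0 * ((k - l) i 0 * (k i 0 + l i 0)) +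
    (ierem (pmu p i) k - ierem (pmu p i) l) by rewrite /brem !mxE; ring.
apply: le_trans (ler_normD _ _) _.
apply: (@le_trans _ _ (n1 (k - l) * (n1 k + n1 l) * (pc p i 0 + isqr (pmu p i)))).
  rewrite [leRHS]mulrDr; apply: lerD; last exact: ierem_lip.
  rewrite normrM ger0_norm// mulrC ler_wpM2r// normrM.
  apply: ler_pM => //; first exact: coord_le_n1.
  by apply: le_trans (ler_normD _ _) _; apply: lerD; exact: coord_le_n1.
rewrite ler_wpM2l// /lip_const (bigD1 i)//= -addrA lerDl.
rewrite addr_ge0 ?isqr_ge0// sumr_ge0// => j _.
by rewrite addr_ge0 ?isqr_ge0.
Qed.

Lemma nu_ierem_lip (k l : 'cV[R]_d) : cone k -> cone l ->
  `|ierem (pnu p) k - ierem (pnu p) l| <= n1 (k - l) * (n1 k + n1 l) * lip_const.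
Proof.
move=> ck cl; apply: le_trans (ierem_lip nu2 ck cl) _.
rewrite ler_wpM2l ?mulr_ge0 ?addr_ge0 ?n1_ge0// lerDr sumr_ge0// => j _.
by rewrite addr_ge0 ?isqr_ge0.
Qed.

Lemma brem_le i (l : 'cV[R]_d) : cone l -> brem p i l <= n1 l ^+ 2 * lip_const.
Proof.
have c0 : cone (0 : 'cV[R]_d) by move=> j; rewrite mxE.
move=> cl; have := brem_lip i cl c0.
rewrite brem0 !subr0 (_ : n1 0 = 0); last by rewrite /n1 big1// => j _; rewrite mxE normr0.
by rewrite addr0 -expr2; apply: le_trans; exact: ler_norm.
Qed.

Lemma nu_ierem_le (l : 'cV[R]_d) : cone l -> ierem (pnu p) l <= n1 l ^+ 2 * lip_const.
Proof.
have c0 : cone (0 : 'cV[R]_d) by move=> j; rewrite mxE.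
move=> cl; have := nu_ierem_lip cl c0.
rewrite ierem0 !subr0 (_ : n1 0 = 0); last by rewrite /n1 big1// => j _; rewrite mxE normr0.
by rewrite addr0 -expr2; apply: le_trans; exact: ler_norm.
Qed.

Section one_flow.
Variables (w : R -> 'cV[R]_d) (l : 'cV[R]_d).
Hypothesis wl : flow_ext p w l.

Let w0 : w 0 = l. Proof. by case: wl. Qed.
Let cw s : cone (w s). Proof. by case: wl. Qed.
Let ctw i : continuous (fun s => w s i 0). Proof. by case: wl. Qed.

Lemma is_derive_flow (s : R) i : 0 < s ->
  is_derive s 1 (fun s => w s i 0) ((B^T *m w s) i 0 - brem p i (w s)).
Proof.
move=> s0; have [_ _ _ /(_ s i s0)] := wl.
by rewrite (branchingE adm mu_tail i (cw s)) opprB.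
Qed.

Lemma continuous_brem_flow i : continuous (fun s => brem p i (w s)).
Proof. by apply: (continuous_lip (P := cone)) => // k l'; exact: brem_lip. Qed.

Lemma continuous_ierem_flow : continuous (fun s => ierem (pnu p) (w s)).
Proof. by apply: (continuous_lip (P := cone)) => // k l'; exact: nu_ierem_lip. Qed.

Lemma continuous_dotr_flow (k : 'cV[R]_d) : continuous (fun s => dotr k (w s)).
Proof. by apply: continuous_fun_sum => i; apply: continuous_funZ. Qed.

Definition growth : R := \sum_i \sum_j `|B i j|.

(** Discarding the nonnegative remainders leaves a linear differential inequality for the sum of the
    coordinates. The resulting bound is linear in l, hence of order 1 / (n + 1) for the rescaled
    flows. *)
Lemma flow_n1_le t : 0 <= t -> n1 (w t) <= expR (growth * t) * n1 l.
Proof.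
move=> t0.
have n1E s : n1 (w s) = \sum_i w s i 0.
  by apply: eq_bigr => i _; rewrite ger0_norm//; exact: cw.
rewrite -w0 !n1E.
apply: (@gronwall _ (fun s => \sum_i w s i 0) (fun s => \sum_i ((B^T *m w s) i 0 - brem p i (w s)))) => //.
- by apply: continuous_subspaceT; exact: continuous_fun_sum.
- by move=> s /andP[s0 _]; apply: is_derive1_sum => i; exact: is_derive_flow.
move=> s _; apply: (@le_trans _ _ (\sum_i (B^T *m w s) i 0)).
  by apply: ler_sum => i _; rewrite lerBlDr lerDl brem_ge0.
under eq_bigr do rewrite mxE.
rewrite exchange_big/= mulr_sumr; apply: ler_sum => j _.
rewrite -mulr_suml ler_wpM2r//; first exact: cw.
rewrite /growth [leRHS](bigD1 j)//=.
apply: (@le_trans _ _ (\sum_i `|B j i|)); last first.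
  by rewrite lerDl; apply: sumr_ge0 => i _; exact: sumr_ge0.
by apply: ler_sum => i _; rewrite mxE ler_norm.
Qed.

(* The pairing of m (t - s) with w s varies with s only through the remainder. *)
Lemma flow_duality (m : R -> 'cV[R]_d) (a : 'cV[R]_d) (t : R) : 0 <= t ->
  (forall (s : R) i, is_derive s 1 (fun s => m s i 0) ((B *m m s + a) i 0)) ->
  dotr (m 0) (w t) + \int[lebesgue_measure]_(s in `[0, t])
    (dotr a (w s) + \sum_i m (t - s) i 0 * brem p i (w s)) = dotr (m t) l.
Proof.
move=> t0 dm.
have cm i : continuous (fun s => m s i 0).
  by move=> s; exact: is_derive1_continuous (dm s i).
have cmt i : continuous (fun s => m (t - s) i 0).
  by apply: (continuous_fun_subl (f := fun s => m s i 0)).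
pose f s := dotr a (w s) + \sum_i m (t - s) i 0 * brem p i (w s).
(* In the derivative of this pairing, B acting on m cancels B^T acting on w. The sign is chosen so
   that f is the derivative. *)
pose F s := - \sum_i m (t - s) i 0 * w s i 0.
have FTC : \int[lebesgue_measure]_(s in `[0, t]) f s = F t - F 0.
  apply: Rintegral_FTC => //.
  - apply: continuous_subspaceT => s; apply: cvgN; move: s; apply: continuous_fun_sum => i.
    exact: continuous_funM.
  - apply: continuous_subspaceT; apply: continuous_funD; first exact: continuous_dotr_flow.
    by apply: continuous_fun_sum => i; apply: continuous_funM => //; exact: continuous_brem_flow.
  - move=> s /andP[s0 _].
    have -> : F = (fun s => (-1) * \sum_i m (t - s) i 0 * w s i 0).
      by apply/funext => u; rewrite mulN1r.
    have -> : f s = (-1) * \sum_i ((- (B *m m (t - s) + a) i 0) * w s i 0 +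
        m (t - s) i 0 * ((B^T *m w s) i 0 - brem p i (w s))).
      rewrite mulN1r big_split/=.
      under [X in - (_ + X)]eq_bigr do rewrite mulrBr.
      rewrite sumrB.
      have E : \sum_i m (t - s) i 0 * (B^T *m w s) i 0 = dotr (B *m m (t - s)) (w s) by rewrite dotr_mulmx.
      rewrite E.
      have -> : \sum_i - (B *m m (t - s) + a) i 0 * w s i 0 = - dotr (B *m m (t - s) + a) (w s).
        by rewrite /dotr -sumrN; apply: eq_bigr => i _; rewrite mulNr.
      rewrite dotrDl /f; ring.
    apply: is_derive1Z; apply: is_derive1_sum => i.
    apply: is_derive1M; last exact: is_derive_flow.
    exact: (is_derive1_comp_subl (f := fun s => m s i 0)).
rewrite FTC /F subrr subr0 w0 /dotr; ring.
Qed.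

End one_flow.
End branching_flow.

(** * Asymptotics of the flows started from l / (n + 1) *)

Section scaled_flows.
Variables (R : realType) (d : nat) (p : cbi_params R d).
Hypothesis adm : admissible p.
Hypothesis mu_tail : (\sum_(l < d) \int[pmu p l]_(z in Uset)
     (enorm z ^+ 2 * (1 <= enorm z)%R%:R)%:E < +oo)%E.
Hypothesis nu_tail : (\int[pnu p]_(r in Uset)
     (enorm r ^+ 2 * (1 <= enorm r)%R%:R)%:E < +oo)%E.

Local Notation B := (Btilde p).
Local Notation b := (betatilde p).
Local Notation theta n := (n.+1%:R^-1 : R).

Let mu_int i := mu_sqint adm mu_tail i.
Let nu2 := nu_sqint adm nu_tail.
Let L := lip_const p.
Let L0 : 0 <= L. Proof. exact: lip_const_ge0. Qed.

(** By the Lipschitz bound, an error o(1 / n) in an argument of size O(1 / n) changes F by o(1 /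
    n^2). The flow may therefore be replaced by its linearization inside the remainders. *)
Let lip_scaled_cvg (F Q : 'cV[R]_d -> R) (k : nat -> 'cV[R]_d) (a : 'cV[R]_d) :
  (forall k l : 'cV[R]_d, cone k -> cone l -> `|F k - F l| <= n1 (k - l) * (n1 k + n1 l) * L) ->
  F (theta n *: a) * n.+1%:R ^+ 2 @[n --> \oo] --> Q a ->
  (forall n, cone (k n)) -> cone a ->
  (forall i, n.+1%:R * k n i 0 @[n --> \oo] --> a i 0) ->
  F (k n) * n.+1%:R ^+ 2 @[n --> \oo] --> Q a.
Proof.
move=> lipF FQ ck ca ka.
have D : (F (k n) - F (theta n *: a)) * n.+1%:R ^+ 2 @[n --> \oo] --> 0.
  apply/norm_cvg0P.
  pose g n := n1 (n.+1%:R *: k n - a) * (n1 (n.+1%:R *: k n) + n1 a) * L.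
  have g0 : g @ \oo --> 0.
    have -> : 0 = \sum_(i < d) `|a i 0 - a i 0| * (n1 a + n1 a) * L.
      by rewrite big1// => i _; rewrite subrr normr0 !mul0r.
    have cn : n1 (n.+1%:R *: k n) @[n --> \oo] --> n1 a.
      by apply: cvg_sumr => i _; apply: cvg_norm; under eq_fun do rewrite mxE; exact: ka.
    rewrite -mulr_suml -mulr_suml; apply: cvgM; last exact: cvg_cst.
    apply: cvgM; last by apply: cvgD => //; exact: cvg_cst.
    apply: cvg_sumr => i _; apply: cvg_norm; under eq_fun do rewrite !mxE.
    by apply: cvgB; [exact: ka|exact: cvg_cst].
  apply: (@squeeze_cvgr _ _ _ _ (fun=> 0) g) => //; last exact: cvg_cst.
  apply: nearW => n; rewrite normr_ge0/= normrM [X in _ * X]ger0_norm ?sqr_ge0//.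
  have n0 : 0 < n.+1%:R :> R by [].
  have cth : cone (theta n *: a) by apply: coneZ.
  rewrite -ler_pdivlMr ?exprn_gt0// (le_trans (lipF _ _ (ck n) cth))//.
  have -> : k n = theta n *: (n.+1%:R *: k n) by rewrite scalerA mulVf ?scale1r// gt_eqF.
  rewrite /g; move: (n.+1%:R *: k n) => kk.
  rewrite -scalerBr !n1Z ger0_norm ?invr_ge0//.
  rewrite le_eqVlt; apply/orP; left; apply/eqP.
  by move: n0; set N : R := n.+1%:R => n0; field; rewrite gt_eqF.
rewrite -[Q a]add0r.
have -> : (fun n => F (k n) * n.+1%:R ^+ 2) = (fun n =>
    (F (k n) - F (theta n *: a)) * n.+1%:R ^+ 2 + F (theta n *: a) * n.+1%:R ^+ 2).
  by apply/funext => n; rewrite -mulrDl subrK.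
exact: cvgD.
Qed.

(** The quadratic Taylor term at 0 of the i-th branching mechanism. Its values at Re v and Im v add
    up to half of [Cv]. *)
Definition bquad i (k : 'cV[R]_d) := pc p i 0 * k i 0 ^+ 2 + 2^-1 * isq (pmu p i) k.

Lemma brem_scaled_cvg i (k : 'cV[R]_d) : cone k ->
  brem p i (theta n *: k) * n.+1%:R ^+ 2 @[n --> \oo] --> bquad i k.
Proof.
move=> ck; under eq_fun do rewrite /brem mulrDl.
apply: cvgD; last exact: ierem_cvg.
apply: cvg_near_cst; apply: nearW => n; rewrite mxE.
have n0 : n.+1%:R != 0 :> R by [].
by move: n0; set N : R := n.+1%:R => n0; field.
Qed.

(* The columns of e^{sB}; hence homflow s l = e^{s B^T} l. *)
Definition homsol i (s : R) := ode_sol B 0 (e_ R i) s.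

Definition homflow (s : R) (l : 'cV[R]_d) : 'cV[R]_d := \col_i dotr (homsol i s) l.

Lemma is_derive_homsol i j (s : R) :
  is_derive s 1 (fun s => homsol i s j 0) ((B *m homsol i s) j 0).
Proof.
have := is_derive_ode_sol B 0 (e_ R i) s j.
by rewrite addr0.
Qed.

Lemma continuous_homflow l i : continuous (fun s => homflow s l i 0).
Proof.
have -> : (fun s => homflow s l i 0) = (fun s => \sum_j homsol i s j 0 * l j 0).
  by apply/funext => s; rewrite mxE.
apply: (continuous_fun_sum (h := fun j s => homsol i s j 0 * l j 0)) => j.
apply: continuous_funM; last by move=> s; exact: cvg_cst.
by move=> s; exact: is_derive1_continuous (is_derive_homsol i j s).
Qed.

Lemma continuous_bquad_homflow i l : continuous (fun s => bquad i (homflow s l)).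
Proof.
apply: continuous_funD; last first.
  apply: continuous_funZ; apply: (continuous_lip (P := fun=> True)) => //.
    by move=> j; exact: continuous_homflow.
  by move=> k k' _ _; exact: isq_lip.
by apply: continuous_funZ; apply: continuous_funM; exact: continuous_homflow.
Qed.

Lemma continuous_isq_homflow l : continuous (fun s => isq (pnu p) (homflow s l)).
Proof.
apply: (continuous_lip (P := fun=> True)) => //.
  by move=> j; exact: continuous_homflow.
by move=> k k' _ _; exact: isq_lip.
Qed.

Section family.
Variables (w_ : nat -> R -> 'cV[R]_d) (l : 'cV[R]_d).
Hypothesis cl : cone l.
Hypothesis wl : forall n, flow_ext p (w_ n) (theta n *: l).

Let cw n s : cone (w_ n s). Proof. by case: (wl n). Qed.

Let G := growth p.

Let G0 : 0 <= G. Proof. by apply: sumr_ge0 => i _; apply: sumr_ge0. Qed.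

Lemma scaled_flow_n1_le n t s : 0 <= s <= t -> n1 (w_ n s) <= theta n * (expR (G * t) * n1 l).
Proof.
move=> /andP[s0 st]; apply: le_trans (flow_n1_le adm mu_tail (wl n) s0) _.
rewrite n1Z ger0_norm ?invr_ge0// mulrCA ler_wpM2l ?invr_ge0//.
by rewrite ler_wpM2r ?n1_ge0// ler_expR ler_wpM2l.
Qed.

Let bd t : R := (expR (G * t) * n1 l) ^+ 2 * L.

Let sq_le n s t : 0 <= s <= t -> n1 (w_ n s) ^+ 2 * L <= theta n ^+ 2 * bd t.
Proof.
move=> st; rewrite /bd mulrA ler_wpM2r// -exprMn.
by apply: lerXn2r; rewrite ?nnegrE ?n1_ge0 ?mulr_ge0 ?invr_ge0 ?expR_ge0 ?n1_ge0// scaled_flow_n1_le.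
Qed.

Lemma brem_flow_le n i s t : 0 <= s <= t -> brem p i (w_ n s) <= theta n ^+ 2 * bd t.
Proof. by move=> st; apply: le_trans (sq_le n st); exact: brem_le. Qed.

Lemma nu_flow_le n s t : 0 <= s <= t -> ierem (pnu p) (w_ n s) <= theta n ^+ 2 * bd t.
Proof. by move=> st; apply: le_trans (sq_le n st); exact: nu_ierem_le. Qed.

(** Duality with the homogeneous solution started from the i-th basis vector expresses w_i(s) as its
    linear part minus an integral of remainders, which is of order 1 / (n + 1)^2. Thus the
    linearization is found without differentiating the flow in its initial value. *)
Lemma scaled_flow_cvg s i : 0 <= s ->
  n.+1%:R * w_ n s i 0 @[n --> \oo] --> homflow s l i 0.
Proof.
move=> s0.
have cont_hom j : continuous (fun u => homsol i (s - u) j 0).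
  apply: (continuous_fun_subl (f := fun u => homsol i u j 0)) => u.
  exact: is_derive1_continuous (is_derive_homsol i j u).
pose C := (\int[lebesgue_measure]_(u in `[0, s]) \sum_j `|homsol i (s - u) j 0|) * bd s.
have key n : `|w_ n s i 0 - theta n * homflow s l i 0| <= theta n ^+ 2 * C.
  have := flow_duality adm mu_tail (wl n) (a := 0) s0 (m := homsol i).
  have dh (u : R) j : is_derive u 1 (fun u => homsol i u j 0) ((B *m homsol i u + 0) j 0).
    exact: is_derive_ode_sol.
  move=> /(_ dh); rewrite {1}/homsol ode_sol0 dotr_e_ dotrZr -[dotr _ l]/(dotr (homsol i s) l).
  have -> : dotr (homsol i s) l = homflow s l i 0 by rewrite mxE.
  move=> <-; rewrite opprD addrA subrr sub0r normrN.
  pose f u := dotr 0 (w_ n u) + \sum_j homsol i (s - u) j 0 * brem p j (w_ n u).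
  rewrite -/(f _).
  have cf : continuous f.
    apply: continuous_funD; first exact: (continuous_dotr_flow (wl n)).
    apply: continuous_fun_sum => j; apply: continuous_funM => //.
    exact: (continuous_brem_flow adm mu_tail (wl n)).
  have ch : continuous (fun u => \sum_j `|homsol i (s - u) j 0|).
    by apply: continuous_fun_sum => j; exact: continuous_fun_norm.
  apply: le_trans (le_normr_Rintegral _ (continuous_rint 0 s cf)) _ => //.
  rewrite /C mulrCA -RintegralZr//; last exact: continuous_rint.
  apply: le_Rintegral => //.
  - by apply: continuous_rint; exact: continuous_fun_norm.
  - by apply: continuous_rint; apply: continuous_funM => // u; exact: cvg_cst.
  move=> u; rewrite /= in_itv/= => us; rewrite /f dotr0l add0r.
  apply: le_trans (ler_norm_sum _ _ _) _; rewrite mulr_suml; apply: ler_sum => j _.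
  by rewrite normrM ler_wpM2l// ger0_norm ?brem_ge0// brem_flow_le.
suff : n.+1%:R * w_ n s i 0 - homflow s l i 0 @[n --> \oo] --> 0 by move=> /subr_cvg0.
apply/norm_cvg0P.
apply: (@squeeze_cvgr _ _ _ _ (fun=> 0) (fun n => theta n * C)); last 2 first.
- exact: cvg_cst.
- by rewrite -(mul0r C); apply: cvgM; [exact: cvg_invS|exact: cvg_cst].
apply: nearW => n; rewrite normr_ge0/=.
have n0 : 0 < n.+1%:R :> R by [].
have -> : n.+1%:R * w_ n s i 0 - homflow s l i 0 = n.+1%:R * (w_ n s i 0 - theta n * homflow s l i 0).
  by rewrite mulrBr mulrA divff ?gt_eqF// mul1r.
rewrite normrM ger0_norm// mulrC -ler_pdivlMr// (le_trans (key n))//.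
by rewrite expr2 mulrAC mulrC.
Qed.

(** Positivity is inherited from the nonlinear flows, of which [homflow] is the rescaled limit. *)
Lemma cone_homflow s : 0 <= s -> cone (homflow s l).
Proof.
move=> s0 i; have h := scaled_flow_cvg (i := i) s0.
rewrite -(cvg_lim _ h)//; apply: limr_ge; first by apply/cvg_ex; exists (homflow s l i 0).
by apply: nearW => n; rewrite mulr_ge0//; exact: cw.
Qed.

Lemma brem_flow_cvg i s : 0 <= s ->
  brem p i (w_ n s) * n.+1%:R ^+ 2 @[n --> \oo] --> bquad i (homflow s l).
Proof.
move=> s0; apply: (lip_scaled_cvg (F := brem p i)).
- by move=> *; exact: brem_lip.
- by apply: brem_scaled_cvg; exact: cone_homflow.
- by move=> n; exact: cw.
- exact: cone_homflow.
- by move=> j; exact: scaled_flow_cvg.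
Qed.

Lemma nu_flow_cvg s : 0 <= s ->
  ierem (pnu p) (w_ n s) * n.+1%:R ^+ 2 @[n --> \oo] --> 2^-1 * isq (pnu p) (homflow s l).
Proof.
move=> s0; apply: (lip_scaled_cvg (F := ierem (pnu p)) (Q := fun k => 2^-1 * isq (pnu p) k)).
- by move=> *; exact: nu_ierem_lip.
- by apply: ierem_cvg => //; exact: cone_homflow.
- by move=> n; exact: cw.
- exact: cone_homflow.
- by move=> j; exact: scaled_flow_cvg.
Qed.

Lemma quadratic_term_cvg (m : R -> 'cV[R]_d) t : 0 <= t ->
  (forall i, continuous (fun s => m s i 0)) ->
  \int[lebesgue_measure]_(s in `[0, t])
     ((\sum_i m (t - s) i 0 * brem p i (w_ n s)) + ierem (pnu p) (w_ n s)) * n.+1%:R ^+ 2 @[n --> \oo] -->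
  \int[lebesgue_measure]_(s in `[0, t])
     ((\sum_i m (t - s) i 0 * bquad i (homflow s l)) + 2^-1 * isq (pnu p) (homflow s l)).
Proof.
move=> t0 cm.
have cmt i : continuous (fun s => m (t - s) i 0).
  by apply: (continuous_fun_subl (f := fun s => m s i 0)).
have cf n : continuous (fun s => (\sum_i m (t - s) i 0 * brem p i (w_ n s)) + ierem (pnu p) (w_ n s)).
  apply: continuous_funD; last exact: (continuous_ierem_flow adm nu_tail (wl n)).
  apply: continuous_fun_sum => i; apply: continuous_funM => //.
  exact: (continuous_brem_flow adm mu_tail (wl n)).
have mi (f : R -> R) : continuous f -> measurable_fun `[0, t] f.
  by move=> hf; apply: measurable_funTS; exact: continuous_measurable_fun.
have -> : (fun n => \int[lebesgue_measure]_(s in `[0, t])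
     ((\sum_i m (t - s) i 0 * brem p i (w_ n s)) + ierem (pnu p) (w_ n s)) * n.+1%:R ^+ 2) =
   (fun n => \int[lebesgue_measure]_(s in `[0, t])
     (((\sum_i m (t - s) i 0 * brem p i (w_ n s)) + ierem (pnu p) (w_ n s)) * n.+1%:R ^+ 2)).
  by apply/funext => n; rewrite RintegralZr//; exact: continuous_rint.
(* In the dominating function the summand 1 accounts for the immigration remainder, which carries no
   factor m. *)
apply: (@Rintegral_dominated_cvg _ _ _ lebesgue_measure `[0, t]%classic _ _ _
  (fun s => ((\sum_i `|m (t - s) i 0|) + 1) * bd t)) => //.
- by move=> n; apply: mi; apply: continuous_funM => // s; exact: cvg_cst.
- apply: mi; apply: continuous_funD; last by apply: continuous_funZ; exact: continuous_isq_homflow.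
  by apply: continuous_fun_sum => i; apply: continuous_funM => //; exact: continuous_bquad_homflow.
- move=> s; rewrite /= in_itv/= => /andP[s0 _].
  under eq_fun do rewrite mulrDl mulr_suml.
  apply: cvgD; last exact: nu_flow_cvg.
  apply: cvg_sumr => i _; under eq_fun do rewrite -mulrA.
  by apply: cvgM; [exact: cvg_cst|exact: brem_flow_cvg].
- apply: continuous_rint; apply: continuous_funM; last by move=> s; exact: cvg_cst.
  apply: continuous_funD; last by move=> s; exact: cvg_cst.
  by apply: continuous_fun_sum => i; exact: continuous_fun_norm.
move=> n s; rewrite /= in_itv/= => st.
have n0 : 0 < n.+1%:R :> R by [].
rewrite normrM [X in _ * X]ger0_norm ?sqr_ge0// -ler_pdivlMr ?exprn_gt0//.
apply: le_trans (ler_normD _ _) _.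
rewrite mulrDl mul1r mulrDl [X in _ <= _ + X](_ : _ = theta n ^+ 2 * bd t); last by rewrite mulrC exprVn.
apply: lerD; last by rewrite ger0_norm ?ierem_ge0// nu_flow_le.
apply: le_trans (ler_norm_sum _ _ _) _; rewrite -mulrA mulr_suml; apply: ler_sum => j _.
by rewrite normrM ler_wpM2l// ger0_norm ?brem_ge0// [leRHS]mulrC -exprVn brem_flow_le.
Qed.

End family.
End scaled_flows.

(** * Moments of the transition kernels *)

Section laplace_moments.
Variables (R : realType) (d : nat) (q : {measure set (Rvec R d) -> \bar R}).
Variables (l : 'cV[R]_d) (H j : nat -> R) (h1 V : R).
Local Notation theta n := (n.+1%:R^-1 : R).
Hypothesis cl : cone l.
Hypothesis q1 : q cone = 1%E.
Hypothesis laplace : forall n,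
  (\int[q]_(y in cone) (expR (- dotr (theta n *: l) y))%:E)%E = (expR (- H n))%:E.
Hypothesis H0 : forall n, 0 <= H n.
Hypothesis HE : forall n, H n = theta n * h1 - j n.
Hypothesis jV : j n * n.+1%:R ^+ 2 @[n --> \oo] --> V.

Let mC := @measurable_cone R d.

Let u n := n.+1%:R * H n.

Let N0 n : 0 < n.+1%:R :> R. Proof. by []. Qed.

Let uH n : H n = theta n * u n.
Proof. by rewrite /u mulrA mulVf ?mul1r// gt_eqF. Qed.

Let u0 n : 0 <= u n. Proof. by rewrite mulr_ge0. Qed.

Let uh1 : u @ \oo --> h1.
Proof.
have -> : u = (fun n => h1 - theta n * (j n * n.+1%:R ^+ 2)).
  apply/funext => n; rewrite /u HE; have := N0 n.
  by set N : R := n.+1%:R => n0; field; rewrite gt_eqF.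
rewrite -[X in _ --> X]subr0; apply: cvgB; first exact: cvg_cst.
by rewrite -(mul0r V); apply: cvgM => //; exact: cvg_invS.
Qed.

Let erem_H_cvg : erem (H n) * n.+1%:R ^+ 2 @[n --> \oo] --> h1 ^+ 2 / 2.
Proof.
have u2 : u n ^+ 2 / 2 @[n --> \oo] --> h1 ^+ 2 / 2.
  by apply: cvgM; [exact: cvgM|exact: cvg_cst].
apply: (@squeeze_cvgr _ _ _ _ (fun n => u n ^+ 2 / 2 - theta n * (u n ^+ 3 / 6)) (fun n => u n ^+ 2 / 2)) => //.
  by apply: nearW => n; rewrite uH erem_scaled_le// erem_scaled_ge.
rewrite -[X in _ --> X]subr0; apply: cvgB => //.
rewrite -(mul0r (h1 ^+ 3 / 6)); apply: cvgM; first exact: cvg_invS.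
by apply: cvgM; [apply: cvgM => //; exact: cvgM|exact: cvg_cst].
Qed.

Let onem_H_cvg : (1 - expR (- H n)) * n.+1%:R @[n --> \oo] --> h1.
Proof.
have -> : (fun n => (1 - expR (- H n)) * n.+1%:R) = (fun n => u n - theta n * (erem (H n) * n.+1%:R ^+ 2)).
  apply/funext => n; rewrite /u /erem; have := N0 n.
  by set N : R := n.+1%:R => n0; field; rewrite gt_eqF.
rewrite -[X in _ --> X]subr0; apply: cvgB => //.
by rewrite -(mul0r (h1 ^+ 2 / 2)); apply: cvgM => //; exact: cvg_invS.
Qed.

Local Notation rint f := (q.-integrable cone (EFin \o f)).

Lemma rint_cst1 : rint (fun=> 1).
Proof.
apply: rint_ge0_fin => //.
by rewrite (@integral_cst _ _ _ q _ mC 1) q1 mul1e ltry.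
Qed.

Lemma Rint_cst1 : \int[q]_(y in cone) 1 = 1.
Proof. by rewrite (Rintegral_cst _ mC) q1 mul1r. Qed.

Let mdot (k : 'cV[R]_d) : measurable_fun cone (fun y : Rvec R d => dotr k y).
Proof. exact: measurable_dotr. Qed.

Let dl0 (y : Rvec R d) : cone y -> 0 <= dotr l y.
Proof. by move=> cy; exact: dotr_ge0. Qed.

Let mE n : measurable_fun cone (fun y : Rvec R d => expR (- dotr (theta n *: l) y)).
Proof. by apply: measurableT_comp => //; apply: measurableT_comp. Qed.

Let rint_exp n : rint (fun y => expR (- dotr (theta n *: l) y)).
Proof.
apply: (rint_le mC (mE n) _ rint_cst1) => y cy.
rewrite ger0_norm ?expR_ge0// -expR0 ler_expR oppr_le0 dotrZl mulr_ge0 ?invr_ge0//.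
exact: dl0.
Qed.

Let Rint_exp n : \int[q]_(y in cone) expR (- dotr (theta n *: l) y) = expR (- H n).
Proof. by rewrite /Rintegral laplace. Qed.

(** [H n] is the Laplace exponent of q at l / (n + 1). The hypotheses are arranged so that [h1]
    becomes the mean of <l, y> and 2 [V] its variance. The approximations (1 - e^{-u / (n + 1)}) (n
    + 1) stay below u, as the passage to the limit requires. *)
Lemma integral_dotr : (\int[q]_(y in cone) (dotr l y)%:E)%E = h1%:E.
Proof.
apply: (integral_cvg_from_below mC (f_ := fun n y => (1 - expR (- (theta n * dotr l y))) * n.+1%:R) _ _ _ _ _ onem_H_cvg).
- move=> n; apply: measurable_funM; last exact: measurable_cst.
  apply: measurable_funB; first exact: measurable_cst.
  by under eq_fun do rewrite -dotrZl; exact: mE.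
- exact: mdot.
- by move=> n y cy; apply: onem_expR_scaled_bound; exact: dl0.
- by move=> y cy; apply: onem_expR_scaled_cvg; exact: dl0.
move=> n; under eq_integral do rewrite -dotrZl.
rewrite -(EFin_Rint mC); last first.
  have -> : (fun y : Rvec R d => (1 - expR (- dotr (theta n *: l) y)) * n.+1%:R) =
     (fun y => n.+1%:R * (1 - expR (- dotr (theta n *: l) y))) by apply/funext => y; rewrite mulrC.
  by apply: (rintZ mC); apply: (rintB mC) => //; exact: rint_cst1.
rewrite (RintegralZr _ mC); last first.
  by apply: (rintB mC) => //; exact: rint_cst1.
rewrite (RintegralB mC) //; last exact: rint_cst1.
by rewrite Rint_exp Rint_cst1.
Qed.

Lemma rint_dotr : rint (dotr l).
Proof.
by apply: rint_ge0_fin => //; rewrite integral_dotr ltry.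
Qed.

(** As h1 / (n + 1) = H n + j n, the integral of the rescaled [erem] splits into [erem (H n)] and
    [j n], both times (n + 1)^2; these tend to h1^2 / 2 and V. The first moment has to be known
    beforehand, because the linear term of [erem] is integrated separately. *)
Let integral_half_sqr : (\int[q]_(y in cone) (2^-1 * dotr l y ^+ 2)%:E)%E = (h1 ^+ 2 / 2 + V)%:E.
Proof.
have cvgA : (expR (- H n) - 1 + theta n * h1) * n.+1%:R ^+ 2 @[n --> \oo] --> h1 ^+ 2 / 2 + V.
  have -> : (fun n => (expR (- H n) - 1 + theta n * h1) * n.+1%:R ^+ 2) =
     (fun n => erem (H n) * n.+1%:R ^+ 2 + j n * n.+1%:R ^+ 2).
    by apply/funext => n; rewrite -mulrDl /erem {3}HE; congr (_ * _); ring.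
  exact: cvgD.
apply: (integral_cvg_from_below mC (f_ := fun n y => erem (theta n * dotr l y) * n.+1%:R ^+ 2) _ _ _ _ _ cvgA).
- move=> n; apply: measurable_funM; last exact: measurable_cst.
  apply: measurableT_comp; first by apply: continuous_measurable_fun; exact: continuous_erem.
  by apply: measurable_funM => //; exact: measurable_cst.
- by apply: measurable_funM; [exact: measurable_cst|exact: measurable_funX].
- move=> n y cy; rewrite mulr_ge0 ?erem_ge0 ?sqr_ge0//= [leRHS]mulrC.
  by apply: erem_scaled_le; exact: dl0.
- by move=> y cy; apply: erem_scaled_cvg; exact: dl0.
move=> n.
have ie : rint (fun y => expR (- dotr (theta n *: l) y) - 1 + theta n * dotr l y).
  by apply: (rintD mC); [apply: (rintB mC) => //; exact: rint_cst1|apply: (rintZ mC); exact: rint_dotr].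
under eq_integral do rewrite /erem -{1}dotrZl.
rewrite -(EFin_Rint mC); last first.
  have -> : (fun y : Rvec R d => (expR (- dotr (theta n *: l) y) - 1 + theta n * dotr l y) * n.+1%:R ^+ 2) =
     (fun y => n.+1%:R ^+ 2 * (expR (- dotr (theta n *: l) y) - 1 + theta n * dotr l y)).
    by apply/funext => y; rewrite mulrC.
  exact: (rintZ mC).
rewrite (RintegralZr _ mC)//.
rewrite (RintegralD mC); last 2 first.
- by apply: (rintB mC) => //; exact: rint_cst1.
- by apply: (rintZ mC); exact: rint_dotr.
rewrite (RintegralB mC) //; last exact: rint_cst1.
rewrite (RintegralZl _ mC); last exact: rint_dotr.
rewrite Rint_exp Rint_cst1.
by have -> : \int[q]_(y in cone) dotr l y = h1 by rewrite /Rintegral integral_dotr.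
Qed.

Lemma rint_dotr2 : rint (fun y => dotr l y ^+ 2).
Proof.
have h : rint (fun y => 2^-1 * dotr l y ^+ 2).
  apply: rint_ge0_fin => //.
  - by apply: measurable_funM; [exact: measurable_cst|exact: measurable_funX].
  - by move=> y _; rewrite mulr_ge0 ?sqr_ge0.
  - by rewrite integral_half_sqr ltry.
have := rintZ mC 2 h.
by under eq_fun do rewrite mulrA mulfV// mul1r.
Qed.

Lemma Rint_dotr : \int[q]_(y in cone) dotr l y = h1.
Proof. by rewrite /Rintegral integral_dotr. Qed.

Lemma Rint_dotr2 : \int[q]_(y in cone) (dotr l y ^+ 2) = h1 ^+ 2 + 2 * V.
Proof.
have : \int[q]_(y in cone) (2^-1 * dotr l y ^+ 2) = h1 ^+ 2 / 2 + V.
  by rewrite /Rintegral integral_half_sqr.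
rewrite (RintegralZl _ mC); last exact: rint_dotr2.
lra.
Qed.

End laplace_moments.

Lemma immigration_ge0 (R : realType) (d : nat) (p : cbi_params R d) (l : 'cV[R]_d) :
  admissible p -> cone l -> 0 <= immigration p l.
Proof.
move=> [_ [_ b0 _ _ _]] cl; rewrite /immigration addr_ge0//.
  by apply: dotr_ge0 => // i; exact: b0.
apply: Rintegral_ge0 => z Uz.
by rewrite subr_ge0 -expR0 ler_expR oppr_le0 dotr_ge0//; exact: Uset_cone.
Qed.

(** * First and second moments under the semigroup *)

Section kernel_moments.
Variables (R : realType) (d : nat) (p : cbi_params R d).
Hypothesis adm : admissible p.
Hypothesis mu_tail : (\sum_(l < d) \int[pmu p l]_(z in Uset)
     (enorm z ^+ 2 * (1 <= enorm z)%R%:R)%:E < +oo)%E.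
Hypothesis nu_tail : (\int[pnu p]_(r in Uset)
     (enorm r ^+ 2 * (1 <= enorm r)%R%:R)%:E < +oo)%E.
Variable Q : R -> R.-pker (Rvec R d) ~> (Rvec R d).
Hypothesis sgQ : cbi_semigroup p Q.

Local Notation B := (Btilde p).
Local Notation b := (betatilde p).
Local Notation theta n := (n.+1%:R^-1 : R).

Definition mflow (x : 'cV[R]_d) (t : R) : 'cV[R]_d := ode_sol B b x t.

Lemma is_derive_mflow x (t : R) i :
  is_derive t 1 (fun s => mflow x s i 0) ((B *m mflow x t + b) i 0).
Proof. exact: is_derive_ode_sol. Qed.

Lemma continuous_mflow x i : continuous (fun s => mflow x s i 0).
Proof. by move=> s; exact: is_derive1_continuous (is_derive_mflow x s i). Qed.

(** Density in s of half the conditional variance of <k, X_t> given X_0 = x: the mean at time t - s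
    weights the quadratic terms along the linearized backward flow, and immigration adds its own. *)
Definition quad_density (x : 'cV[R]_d) (t : R) (k : 'cV[R]_d) (s : R) : R :=
  (\sum_i mflow x (t - s) i 0 * bquad p i (homflow p s k)) + 2^-1 * isq (pnu p) (homflow p s k).

Definition quad_term (x : 'cV[R]_d) (t : R) (k : 'cV[R]_d) : R :=
  \int[lebesgue_measure]_(s in `[0, t]) quad_density x t k s.

Lemma continuous_quad_density x t k : continuous (quad_density x t k).
Proof.
apply: continuous_funD; last first.
  by apply: continuous_funZ; exact: continuous_isq_homflow.
apply: continuous_fun_sum => i; apply: continuous_funM; last exact: continuous_bquad_homflow.
by apply: (continuous_fun_subl (f := fun s => mflow x s i 0)); exact: continuous_mflow.
Qed.

Section cone_argument.
Variables (t : R) (x l : 'cV[R]_d).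
Hypotheses (t0 : 0 <= t) (cx : cone x) (cl : cone l).

(** Duality is applied to the mean flow, with source [betatilde]. The pairing of the source with w
    is the linear part of the immigration mechanism, so the Laplace exponent is <m(t), l> / (n + 1)
    minus the integrated remainders. *)
Let kernel_laplace : exists H j : nat -> R, [/\
  forall n, (\int[Q t x]_(y in cone) (expR (- dotr (theta n *: l) y))%:E)%E = (expR (- H n))%:E,
  forall n, 0 <= H n,
  forall n, H n = theta n * dotr (mflow x t) l - j n &
  j n * n.+1%:R ^+ 2 @[n --> \oo] --> quad_term x t l].
Proof.
have [_ _ _ [v [vflow vlap]]] := sgQ.
have cth n : cone (theta n *: l) by apply: coneZ.
have /choice[w_ Hw] : forall n, exists w, flow_ext p w (theta n *: l) /\
    forall s, 0 <= s -> w s = v s (theta n *: l).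
  by move=> n; have [w h1 h2] := branching_flow_ext (vflow _ (cth n)); exists w.
pose f n s := (\sum_i mflow x (t - s) i 0 * brem p i (w_ n s)) + ierem (pnu p) (w_ n s).
exists (fun n => dotr x (v t (theta n *: l)) +
  \int[lebesgue_measure]_(s in `[0, t]) immigration p (v s (theta n *: l))).
exists (fun n => \int[lebesgue_measure]_(s in `[0, t]) f n s); split.
- by move=> n; rewrite vlap// opprD.
- move=> n; apply: addr_ge0.
    by apply: dotr_ge0 => //; rewrite -(Hw n).2//; case: (Hw n).1.
  apply: Rintegral_ge0 => s; rewrite /= in_itv/= => /andP[s0 _].
  by apply: immigration_ge0 => //; rewrite -(Hw n).2//; case: (Hw n).1.
- move=> n; have [wl wv] := Hw n.
  have cw s : cone (w_ n s) by case: wl.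
  have := flow_duality adm mu_tail wl t0 (fun s i => is_derive_mflow x s i).
  rewrite {1}/mflow ode_sol0 dotrZr => <-.
  rewrite -wv// -addrA; congr (_ + _).
  have cm i : continuous (fun s => mflow x (t - s) i 0).
    by apply: (continuous_fun_subl (f := fun s => mflow x s i 0)); exact: continuous_mflow.
  have c1 : continuous (fun s => dotr b (w_ n s) + \sum_i mflow x (t - s) i 0 * brem p i (w_ n s)).
    apply: continuous_funD; first exact: (continuous_dotr_flow wl).
    apply: continuous_fun_sum => i; apply: continuous_funM => //.
    exact: (continuous_brem_flow adm mu_tail wl).
  have c2 : continuous (f n).
    apply: continuous_funD; last exact: (continuous_ierem_flow adm nu_tail wl).
    apply: continuous_fun_sum => i; apply: continuous_funM => //.
    exact: (continuous_brem_flow adm mu_tail wl).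
  rewrite -RintegralB//; last 2 first.
  - exact: continuous_rint.
  - exact: continuous_rint.
  apply: eq_Rintegral => s; rewrite inE/= in_itv/= => /andP[s0 _].
  by rewrite -wv// (immigrationE adm nu_tail)// /f; ring.
- apply: (quadratic_term_cvg adm mu_tail nu_tail) => //.
    by move=> n; case: (Hw n).
  by move=> i; exact: continuous_mflow.
Qed.

Let Qc : Q t x cone = 1%E.
Proof. by have [h _ _ _] := sgQ; exact: h. Qed.

Lemma rint_kernel_dotr_cone : (Q t x).-integrable cone (EFin \o dotr l).
Proof. by have [H [j [h1 h2 h3 h4]]] := kernel_laplace; exact: (rint_dotr cl Qc h1 h2 h3 h4). Qed.

Lemma rint_kernel_dotr2_cone : (Q t x).-integrable cone (EFin \o (fun y => dotr l y ^+ 2)).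
Proof. by have [H [j [h1 h2 h3 h4]]] := kernel_laplace; exact: (rint_dotr2 cl Qc h1 h2 h3 h4). Qed.

Lemma Rint_kernel_dotr_cone : \int[Q t x]_(y in cone) dotr l y = dotr (mflow x t) l.
Proof. by have [H [j [h1 h2 h3 h4]]] := kernel_laplace; exact: (Rint_dotr cl Qc h1 h2 h3 h4). Qed.

Lemma Rint_kernel_dotr2_cone : \int[Q t x]_(y in cone) (dotr l y ^+ 2) =
  dotr (mflow x t) l ^+ 2 + 2 * quad_term x t l.
Proof. by have [H [j [h1 h2 h3 h4]]] := kernel_laplace; exact: (Rint_dotr2 cl Qc h1 h2 h3 h4). Qed.

End cone_argument.

Lemma homflowD s (k l : 'cV[R]_d) : homflow p s (k + l) = homflow p s k + homflow p s l.
Proof. by apply/matrixP => i j; rewrite !mxE dotrDr. Qed.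

Lemma homflowB s (k l : 'cV[R]_d) : homflow p s (k - l) = homflow p s k - homflow p s l.
Proof. by apply/matrixP => i j; rewrite !mxE -scaleN1r dotrDr dotrZr mulN1r. Qed.

Lemma bquad_parallelogram i (k l : 'cV[R]_d) :
  bquad p i (k + l) + bquad p i (k - l) = 2 * bquad p i k + 2 * bquad p i l.
Proof.
have := isq_parallelogram (mu_sqint adm mu_tail i) k l.
by rewrite /bquad !mxE => h; nra.
Qed.

Lemma quad_density_parallelogram x t (k l : 'cV[R]_d) s :
  quad_density x t (k + l) s + quad_density x t (k - l) s =
  2 * quad_density x t k s + 2 * quad_density x t l s.
Proof.
rewrite /quad_density homflowD homflowB.
have e1 := isq_parallelogram (nu_sqint adm nu_tail) (homflow p s k) (homflow p s l).
suff : \sum_i mflow x (t - s) i 0 * bquad p i (homflow p s k + homflow p s l) +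
   \sum_i mflow x (t - s) i 0 * bquad p i (homflow p s k - homflow p s l) =
   2 * (\sum_i mflow x (t - s) i 0 * bquad p i (homflow p s k)) +
   2 * (\sum_i mflow x (t - s) i 0 * bquad p i (homflow p s l)).
  by move=> h; rewrite addrACA h -(mulrDr 2^-1) e1; ring.
rewrite !mulr_sumr -!big_split/=; apply: eq_bigr => i _.
by rewrite -mulrDr bquad_parallelogram; ring.
Qed.

Lemma quad_term_parallelogram x t (k l : 'cV[R]_d) :
  quad_term x t (k + l) + quad_term x t (k - l) = 2 * quad_term x t k + 2 * quad_term x t l.
Proof.
by apply: itv_Rint_parallelogram => [||||s]; rewrite ?quad_density_parallelogram//;
  exact: continuous_quad_density.
Qed.

(* The second moment and its formula are quadratic in l, so the parallelogram law
   reduces l = lp - lm to lp, lm and lp + lm, which lie in the cone. *)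
Section real_argument.
Variables (t : R) (x l : 'cV[R]_d).
Hypotheses (t0 : 0 <= t) (cx : cone x).

Let lp : 'cV[R]_d := \col_i Num.max 0 (l i 0).
Let lm : 'cV[R]_d := \col_i Num.max 0 (- l i 0).
Let clp : cone lp. Proof. by move=> i; rewrite mxE le_max lexx. Qed.
Let clm : cone lm. Proof. by move=> i; rewrite mxE le_max lexx. Qed.
Let clpm : cone (lp + lm). Proof. by move=> i; rewrite mxE; apply: addr_ge0; [exact: clp|exact: clm]. Qed.
Let lE : l = lp - lm.
Proof.
apply/matrixP => i j; rewrite (ord1 j) !mxE.
by case: (leP 0 (l i 0)) => h; [rewrite max_l ?oppr_le0// subr0|rewrite max_r ?oppr_ge0 ?ltW// sub0r opprK].
Qed.

Let mC := @measurable_cone R d.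

Lemma rint_kernel_dotr : (Q t x).-integrable cone (EFin \o dotr l).
Proof.
rewrite lE (_ : dotr (lp - lm) = fun y => dotr lp y - dotr lm y); last first.
  by apply/funext => y; rewrite dotrBl.
by apply: (rintB mC); exact: rint_kernel_dotr_cone.
Qed.

Let sqE (y : 'cV[R]_d) : dotr l y ^+ 2 = 2 * dotr lp y ^+ 2 + 2 * dotr lm y ^+ 2 - dotr (lp + lm) y ^+ 2.
Proof. by rewrite lE dotrBl dotrDl; ring. Qed.

Lemma rint_kernel_dotr2 : (Q t x).-integrable cone (EFin \o (fun y => dotr l y ^+ 2)).
Proof.
rewrite (_ : (fun y => _) = fun y => 2 * dotr lp y ^+ 2 + 2 * dotr lm y ^+ 2 - dotr (lp + lm) y ^+ 2); last first.
  by apply/funext => y; rewrite sqE.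
apply: (rintB mC); last exact: rint_kernel_dotr2_cone.
by apply: (rintD mC); apply: (rintZ mC); exact: rint_kernel_dotr2_cone.
Qed.

Lemma Rint_kernel_dotr : \int[Q t x]_(y in cone) dotr l y = dotr (mflow x t) l.
Proof.
rewrite {1}lE; under eq_Rintegral do rewrite dotrBl.
rewrite (RintegralB mC); [|exact: rint_kernel_dotr_cone|exact: rint_kernel_dotr_cone].
by rewrite !Rint_kernel_dotr_cone// !(dotrC (mflow x t)) -dotrBl -lE.
Qed.

Lemma Rint_kernel_dotr2 : \int[Q t x]_(y in cone) (dotr l y ^+ 2) =
  dotr (mflow x t) l ^+ 2 + 2 * quad_term x t l.
Proof.
have i1 := rint_kernel_dotr2_cone t0 cx clp.
have i2 := rint_kernel_dotr2_cone t0 cx clm.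
have i3 := rint_kernel_dotr2_cone t0 cx clpm.
under eq_Rintegral do rewrite sqE.
rewrite (RintegralB mC)//; last by apply: (rintD mC); exact: (rintZ mC).
rewrite (RintegralD mC); [|exact: (rintZ mC)|exact: (rintZ mC)].
rewrite !(RintegralZl _ mC)// !Rint_kernel_dotr2_cone//.
have := quad_term_parallelogram x t lp lm; rewrite -lE.
have e : dotr (mflow x t) l = dotr (mflow x t) lp - dotr (mflow x t) lm.
  by rewrite {1}lE !(dotrC (mflow x t)) dotrBl.
rewrite e dotrDr; move: (quad_term x t (lp + lm)) (quad_term x t l) (quad_term x t lp)
  (quad_term x t lm) (dotr (mflow x t) lp) (dotr (mflow x t) lm) => q1 q2 q3 q4 a1 a2.
by move=> /(canRL (addKr _)) ->; ring.
Qed.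

End real_argument.
End kernel_moments.

(** * Complex left eigenvectors *)

Section complex_vectors.
Variables (R : realType) (d : nat).
Implicit Types (v : 'cV[R[i]]_d) (x : 'cV[R]_d) (z : R[i]).
Local Open Scope complex_scope.

Definition re_mx v : 'cV[R]_d := \col_i complex.Re (v i 0).
Definition im_mx v : 'cV[R]_d := \col_i complex.Im (v i 0).

Lemma sqmodE z : sqmod z = complex.Re z ^+ 2 + complex.Im z ^+ 2.
Proof.
case: z => a b; rewrite /sqmod /ComplexField.Normc.normc /= sqr_sqrtr//.
by rewrite addr_ge0 ?sqr_ge0.
Qed.

Lemma Re_sum I (r : seq I) (P : pred I) (F : I -> R[i]) :
  complex.Re (\sum_(j <- r | P j) F j) = \sum_(j <- r | P j) complex.Re (F j).
Proof. by apply: (big_morph (@complex.Re R)) => [[a b] [a' b']|]. Qed.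

Lemma Im_sum I (r : seq I) (P : pred I) (F : I -> R[i]) :
  complex.Im (\sum_(j <- r | P j) F j) = \sum_(j <- r | P j) complex.Im (F j).
Proof. by apply: (big_morph (@complex.Im R)) => [[a b] [a' b']|]. Qed.

Lemma Re_dotc v x : complex.Re (dotc v (toC x)) = dotr (re_mx v) x.
Proof.
rewrite /dotc Re_sum; apply: eq_bigr => j _; rewrite !mxE.
by case: (v j 0) => a b /=; rewrite oppr0 mulr0 subr0.
Qed.

Lemma Im_dotc v x : complex.Im (dotc v (toC x)) = dotr (im_mx v) x.
Proof.
rewrite /dotc Im_sum; apply: eq_bigr => j _; rewrite !mxE.
by case: (v j 0) => a b /=; rewrite oppr0 mulr0 add0r.
Qed.

Lemma sqmod_dotc v x :
  sqmod (dotc v (toC x)) = dotr (re_mx v) x ^+ 2 + dotr (im_mx v) x ^+ 2.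
Proof. by rewrite sqmodE Re_dotc Im_dotc. Qed.

(** Re v and Im v span a subspace invariant under A^T, on which A^T acts as multiplication by
    lambda. The conjugate of lambda does not occur, because the eigenvector equation involves the
    transpose only. *)
Lemma left_eigenvector_mxE (A : 'M[R]_d) lambda v : left_eigenvector A lambda v ->
  A^T *m re_mx v = complex.Re lambda *: re_mx v - complex.Im lambda *: im_mx v /\
  A^T *m im_mx v = complex.Im lambda *: re_mx v + complex.Re lambda *: im_mx v.
Proof.
move=> [_ /matrixP E].
have Ei i : \sum_j v j 0 * (A j i)%:C = lambda * v i 0.
  have := E 0 i; rewrite !mxE => <-; apply: eq_bigr => j _; by rewrite !mxE.
split; apply/matrixP => i j; rewrite (ord1 j) !mxE.
  transitivity (complex.Re (lambda * v i 0)).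
    rewrite -Ei Re_sum; apply: eq_bigr => k _; rewrite !mxE.
    by case: (v k 0) => a b /=; rewrite mulr0 subr0 mulrC.
  by case: lambda {E Ei} => a b; case: (v i 0).
transitivity (complex.Im (lambda * v i 0)).
  rewrite -Ei Im_sum; apply: eq_bigr => k _; rewrite !mxE.
  by case: (v k 0) => a b /=; rewrite mulr0 add0r mulrC.
by case: lambda {E Ei} => a b; case: (v i 0) => x y /=; rewrite addrC.
Qed.

End complex_vectors.

(** * Variation of constants for a complex scalar equation, in real coordinates *)

Section planar_linear_ode.
Variables (R : realType) (al ka : R).

(** [ecos] and [esin] are the real and imaginary parts of e^{(al + i ka) s}. *)
Definition ecos (s : R) := expR (al * s) * cos (ka * s).
Definition esin (s : R) := expR (al * s) * sin (ka * s).

Lemma is_derive_ecos (s : R) : is_derive s 1 ecos (al * ecos s - ka * esin s).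
Proof.
have dk : is_derive s 1 (fun u : R => ka * u) ka.
  by have := is_derive1Z ka (is_derive_id s 1); rewrite mulr1.
have dc : is_derive s 1 (fun u : R => cos (ka * u)) (- sin (ka * s) * ka).
  exact: (is_derive1_comp (f := cos) (is_derive_cos (ka * s)) dk).
have := is_derive1M (is_derive1_expRM al s) dc.
suff -> : al * expR (al * s) * cos (ka * s) + expR (al * s) * (- sin (ka * s) * ka) =
  al * ecos s - ka * esin s by [].
by rewrite /ecos /esin; ring.
Qed.

Lemma is_derive_esin (s : R) : is_derive s 1 esin (al * esin s + ka * ecos s).
Proof.
have dk : is_derive s 1 (fun u : R => ka * u) ka.
  by have := is_derive1Z ka (is_derive_id s 1); rewrite mulr1.
have dc : is_derive s 1 (fun u : R => sin (ka * u)) (cos (ka * s) * ka).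
  exact: (is_derive1_comp (f := sin) (is_derive_sin (ka * s)) dk).
have := is_derive1M (is_derive1_expRM al s) dc.
suff -> : al * expR (al * s) * sin (ka * s) + expR (al * s) * (cos (ka * s) * ka) =
  al * esin s + ka * ecos s by [].
by rewrite /ecos /esin; ring.
Qed.

Lemma continuous_ecos : continuous ecos.
Proof. by move=> s; exact: is_derive1_continuous (is_derive_ecos s). Qed.

Lemma continuous_esin : continuous esin.
Proof. by move=> s; exact: is_derive1_continuous (is_derive_esin s). Qed.

Variables (gr gi : R -> R) (a c : R).
Hypothesis dgr : forall s : R, is_derive s 1 gr (al * gr s - ka * gi s + a).
Hypothesis dgi : forall s : R, is_derive s 1 gi (ka * gr s + al * gi s + c).

Lemma planar_ode_re (t : R) : 0 <= t ->
  gr t = ecos t * gr 0 - esin t * gi 0 +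
    (a * \int[lebesgue_measure]_(u in `[0, t]) ecos (t - u) -
     c * \int[lebesgue_measure]_(u in `[0, t]) esin (t - u)).
Proof.
move=> t0.
have c1 := @continuous_fun_subl _ _ t continuous_ecos.
have c2 := @continuous_fun_subl _ _ t continuous_esin.
rewrite -(itv_RintZ a 0 t c1) -(itv_RintZ c 0 t c2).
rewrite -(itv_RintB 0 t (@continuous_funZ _ a _ c1) (@continuous_funZ _ c _ c2)).
(* The real part of e^{(al + i ka)(t - u)} (gr + i gi); its derivative retains only the source a + i
   c. *)
pose F u := ecos (t - u) * gr u - esin (t - u) * gi u.
pose f u := a * ecos (t - u) - c * esin (t - u).
have dF (s : R) : is_derive s 1 F (f s).
  have := is_derive1B (is_derive1M (is_derive1_comp_subl (is_derive_ecos (t - s))) (dgr s))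
    (is_derive1M (is_derive1_comp_subl (is_derive_esin (t - s))) (dgi s)).
  by move=> /is_derive_eq; apply; rewrite /f; ring.
have cf : continuous f by apply: continuous_funB; exact: continuous_funZ.
rewrite -/(f _) (itv_Rint_FTC t0 dF cf) /F subrr subr0 /ecos /esin !mulr0 expR0 cos0 sin0; ring.
Qed.

Lemma planar_ode_im (t : R) : 0 <= t ->
  gi t = ecos t * gi 0 + esin t * gr 0 +
    (a * \int[lebesgue_measure]_(u in `[0, t]) esin (t - u) +
     c * \int[lebesgue_measure]_(u in `[0, t]) ecos (t - u)).
Proof.
move=> t0.
have c1 := @continuous_fun_subl _ _ t continuous_ecos.
have c2 := @continuous_fun_subl _ _ t continuous_esin.
rewrite -(itv_RintZ a 0 t c2) -(itv_RintZ c 0 t c1).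
rewrite -(itv_RintD 0 t (@continuous_funZ _ a _ c2) (@continuous_funZ _ c _ c1)).
pose F u := ecos (t - u) * gi u + esin (t - u) * gr u.
pose f u := a * esin (t - u) + c * ecos (t - u).
have dF (s : R) : is_derive s 1 F (f s).
  have := is_derive1D (is_derive1M (is_derive1_comp_subl (is_derive_ecos (t - s))) (dgi s))
    (is_derive1M (is_derive1_comp_subl (is_derive_esin (t - s))) (dgr s)).
  by move=> /is_derive_eq; apply; rewrite /f; ring.
have cf : continuous f by apply: continuous_funD; exact: continuous_funZ.
rewrite -/(f _) (itv_Rint_FTC t0 dF cf) /F subrr subr0 /ecos /esin !mulr0 expR0 cos0 sin0; ring.
Qed.

End planar_linear_ode.

(** The variance integral has the mean at time t - s and the exponential at s, whereas [Il] has the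
    mean at u and the exponential at t - u; reflection matches the two. *)
Lemma itv_Rint_reflect (R : realType) (f : R -> R) (t : R) : 0 <= t -> continuous f ->
  \int[lebesgue_measure]_(s in `[0, t]) f (t - s) = \int[lebesgue_measure]_(s in `[0, t]) f s.
Proof.
move=> t0 cf.
have dF (s : R) : is_derive s 1 (fun s => t - s) (-1).
  by have := is_derive1B (is_derive_cst t s 1) (is_derive_id s 1); rewrite sub0r.
have dE : (fun s : R => t - s)^`()%classic = fun=> - 1.
  by apply/funext => s; have h := dF s; rewrite derive1E derive_val.
have := @integration_by_substitution_decreasing R (fun s => t - s) f 0 t t0.
rewrite subrr subr0 dE => H.
rewrite /Rintegral H//.
- by congr fine; apply: eq_integral => s _ /=; rewrite opprK mulr1.
- by move=> x y _ _ xy; rewrite ltrD2l ltrN2.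
- by move=> x _; exact: cvg_cst.
- by apply/cvg_ex; exists (- 1); exact: cvg_cst.
- by apply/cvg_ex; exists (- 1); exact: cvg_cst.
- have cF : continuous (fun s : R => t - s) by move=> s; exact: is_derive1_continuous (dF s).
  split=> [x _||]; first by have [] := dF x.
    by apply: (@cvg_at_right_filter _ _ (fun s => t - s)); exact: cF.
  by apply: (@cvg_at_left_filter _ _ (fun s => t - s)); exact: cF.
- exact: continuous_subspaceT.
Qed.

Section eigenvector_moments.
Variables (R : realType) (d : nat) (p : cbi_params R d).
Hypothesis adm : admissible p.
Hypothesis mu_tail : (\sum_(l < d) \int[pmu p l]_(z in Uset)
     (enorm z ^+ 2 * (1 <= enorm z)%R%:R)%:E < +oo)%E.
Hypothesis nu_tail : (\int[pnu p]_(r in Uset)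
     (enorm r ^+ 2 * (1 <= enorm r)%R%:R)%:E < +oo)%E.
Variables (v : 'cV[R[i]]_d) (lambda : R[i]).
Hypothesis vl : left_eigenvector (Btilde p) lambda v.

Local Notation al := (complex.Re lambda).
Local Notation ka := (complex.Im lambda).
Local Notation B := (Btilde p).
Local Notation b := (betatilde p).
Local Notation rv := (re_mx v).
Local Notation iv := (im_mx v).
Local Notation U := (@Uset R d).

Lemma isq_re_im (m : {measure set (Rvec R d) -> \bar R}) :
  m.-integrable U (EFin \o (fun z => enorm z ^+ 2)) ->
  \int[m]_(z in U) sqmod (dotc v (toC z)) = isq m rv + isq m iv.
Proof.
move=> h; rewrite /isq -(RintegralD (@measurable_Uset R d) (rint_dotr_sqr h rv) (rint_dotr_sqr h iv)).
by apply: eq_Rintegral => z _; rewrite sqmod_dotc.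
Qed.

Lemma CvE i : Cv p v i = 2 * (bquad p i rv + bquad p i iv).
Proof.
rewrite /Cv isq_re_im; last exact: (mu_sqint adm mu_tail).
by rewrite sqmod_dotc !(dotrC _ (e_ R i)) !dotr_e_ /bquad; field.
Qed.

Lemma nu_intE : nu_int p v = isq (pnu p) rv + isq (pnu p) iv.
Proof. by rewrite /nu_int isq_re_im//; exact: (nu_sqint adm nu_tail). Qed.

Let dual_re k : dotr (B *m k) rv = al * dotr k rv - ka * dotr k iv.
Proof.
have [e _] := left_eigenvector_mxE vl.
by rewrite dotr_mulmx e dotrC dotrBl !dotrZl !(dotrC _ k).
Qed.

Let dual_im k : dotr (B *m k) iv = ka * dotr k rv + al * dotr k iv.
Proof.
have [_ e] := left_eigenvector_mxE vl.
by rewrite dotr_mulmx e dotrC dotrDl !dotrZl !(dotrC _ k).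
Qed.

Lemma is_derive_dotr (m : R -> 'cV[R]_d) (dm : R -> 'cV[R]_d) (k : 'cV[R]_d) (s : R) :
  (forall i, is_derive s 1 (fun s => m s i 0) (dm s i 0)) ->
  is_derive s 1 (fun s => dotr (m s) k) (dotr (dm s) k).
Proof.
move=> h; apply: is_derive1_sum => i.
have := is_derive1M (h i) (is_derive_cst (k i 0) s 1).
by rewrite mulr0 addr0.
Qed.

(** The real half of e^{s B^T} v = e^{lambda s} v. *)
Lemma homflow_re s : 0 <= s -> homflow p s rv = ecos al ka s *: rv - esin al ka s *: iv.
Proof.
move=> s0; apply/matrixP => i j; rewrite (ord1 j) !mxE.
have dm k (u : R) := is_derive_dotr (m := homsol p i) (dm := fun u => B *m homsol p i u) k
  (fun j => is_derive_homsol p i j u).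
have dr (u : R) : is_derive u 1 (fun u => dotr (homsol p i u) rv)
    (al * dotr (homsol p i u) rv - ka * dotr (homsol p i u) iv + 0).
  by rewrite addr0 -dual_re; exact: dm.
have di (u : R) : is_derive u 1 (fun u => dotr (homsol p i u) iv)
    (ka * dotr (homsol p i u) rv + al * dotr (homsol p i u) iv + 0).
  by rewrite addr0 -dual_im; exact: dm.
by rewrite (planar_ode_re dr di s0) !mul0r subrr addr0 /homsol ode_sol0 !dotr_e_ !mxE.
Qed.

Lemma homflow_im s : 0 <= s -> homflow p s iv = ecos al ka s *: iv + esin al ka s *: rv.
Proof.
move=> s0; apply/matrixP => i j; rewrite (ord1 j) !mxE.
have dm k (u : R) := is_derive_dotr (m := homsol p i) (dm := fun u => B *m homsol p i u) k
  (fun j => is_derive_homsol p i j u).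
have dr (u : R) : is_derive u 1 (fun u => dotr (homsol p i u) rv)
    (al * dotr (homsol p i u) rv - ka * dotr (homsol p i u) iv + 0).
  by rewrite addr0 -dual_re; exact: dm.
have di (u : R) : is_derive u 1 (fun u => dotr (homsol p i u) iv)
    (ka * dotr (homsol p i u) rv + al * dotr (homsol p i u) iv + 0).
  by rewrite addr0 -dual_im; exact: dm.
by rewrite (planar_ode_im dr di s0) !mul0r add0r addr0 /homsol ode_sol0 !dotr_e_ !mxE.
Qed.

Lemma ecos_sqr_esin s : ecos al ka s ^+ 2 + esin al ka s ^+ 2 = expR (2 * al * s).
Proof.
rewrite /ecos /esin !exprMn -mulrDr cos2Dsin2 mulr1 expr2 -expRD; congr expR; ring.
Qed.

(** The factor e^{lambda s} rotates the pair (Re v, Im v) and scales it by e^{Re(lambda) s}. Adding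
    the two squares removes the rotation, which is why only Re(lambda) is left in the time
    integrals. *)
Lemma isq_homflow (m : {measure set (Rvec R d) -> \bar R}) s : 0 <= s ->
  m.-integrable U (EFin \o (fun z => enorm z ^+ 2)) ->
  isq m (homflow p s rv) + isq m (homflow p s iv) = expR (2 * al * s) * (isq m rv + isq m iv).
Proof.
move=> s0 h; have i2 := rint_dotr_sqr h; have mU := @measurable_Uset R d.
rewrite /isq -(RintegralD mU (i2 rv) (i2 iv)).
rewrite -(RintegralZl _ mU (rintD mU (i2 rv) (i2 iv))) -(RintegralD mU (i2 _) (i2 _)).
apply: eq_Rintegral => z _.
by rewrite homflow_re// homflow_im// dotrBl dotrDl !dotrZl -ecos_sqr_esin; ring.
Qed.

Lemma bquad_homflow i s : 0 <= s ->
  bquad p i (homflow p s rv) + bquad p i (homflow p s iv) =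
  expR (2 * al * s) * (bquad p i rv + bquad p i iv).
Proof.
move=> s0; have := isq_homflow s0 (mu_sqint adm mu_tail i).
rewrite /bquad => h.
have -> : forall a1 a2 a3 a4 : R, (a1 + 2^-1 * a2) + (a3 + 2^-1 * a4) = (a1 + a3) + 2^-1 * (a2 + a4).
  by move=> *; ring.
rewrite h homflow_re// homflow_im// !mxE -ecos_sqr_esin; ring.
Qed.

Lemma quad_density_re_im x t s : 0 <= s ->
  2 * (quad_density p x t rv s + quad_density p x t iv s) =
  expR (2 * al * s) * (\sum_i Cv p v i * mflow p x (t - s) i 0 + nu_int p v).
Proof.
move=> s0; rewrite /quad_density.
have -> : forall a1 a2 a3 a4 : R, 2 * ((a1 + 2^-1 * a2) + (a3 + 2^-1 * a4)) = 2 * (a1 + a3) + (a2 + a4).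
  by move=> *; field.
rewrite isq_homflow//; last exact: (nu_sqint adm nu_tail).
rewrite -nu_intE [RHS]mulrDr; congr (_ + _).
rewrite -big_split/= !mulr_sumr; apply: eq_bigr => i _.
by rewrite -mulrDr bquad_homflow// CvE; ring.
Qed.

Lemma quad_term_re_im x t : 0 <= t ->
  2 * (quad_term p x t rv + quad_term p x t iv) =
  \sum_i Cv p v i * \int[lebesgue_measure]_(u in `[0, t]) (expR (2 * al * (t - u)) * mflow p x u i 0)
  + I_ lambda t * nu_int p v.
Proof.
move=> t0.
have cd k := @continuous_quad_density _ _ p adm mu_tail nu_tail x t k.
rewrite /quad_term -(itv_RintD 0 t (cd rv) (cd iv)).
rewrite -(itv_RintZ 2 0 t (@continuous_funD _ _ _ (cd rv) (cd iv))).
have ce : continuous (fun s => expR (2 * al * s)).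
  by move=> s; exact: is_derive1_continuous (is_derive1_expRM (2 * al) s).
have cet : continuous (fun s => expR (2 * al * (t - s))).
  exact: (@continuous_fun_subl _ (fun s => expR (2 * al * s)) t ce).
have cm i : continuous (fun s => mflow p x s i 0) by exact: continuous_mflow.
have cmt i : continuous (fun s => mflow p x (t - s) i 0).
  by apply: (@continuous_fun_subl _ (fun s => mflow p x s i 0)).
pose f u := expR (2 * al * (t - u)) * (\sum_i Cv p v i * mflow p x u i 0 + nu_int p v).
have cf : continuous f.
  apply: continuous_funM => //; apply: continuous_funD; last by move=> s; exact: cvg_cst.
  by apply: continuous_fun_sum => i; exact: continuous_funZ.
transitivity (\int[lebesgue_measure]_(s in `[0, t]) f (t - s)).
  apply: eq_Rintegral => s; rewrite inE/= in_itv/= => /andP[s0 _].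
  by rewrite quad_density_re_im// /f (_ : t - (t - s) = s)// opprB addrC subrK.
rewrite itv_Rint_reflect//.
transitivity (\int[lebesgue_measure]_(u in `[0, t])
   ((\sum_i Cv p v i * (expR (2 * al * (t - u)) * mflow p x u i 0)) +
    nu_int p v * expR (2 * al * (t - u)))).
  apply: eq_Rintegral => s _; rewrite /f mulrDr mulr_sumr; congr (_ + _); last by rewrite mulrC.
  by apply: eq_bigr => i _; rewrite mulrCA.
have cs i : continuous (fun u => Cv p v i * (expR (2 * al * (t - u)) * mflow p x u i 0)).
  by apply: continuous_funZ; exact: continuous_funM.
rewrite itv_RintD; [|exact: continuous_fun_sum|exact: continuous_funZ].
rewrite itv_Rint_sum// itv_RintZ// (mulrC (I_ _ _)) /I_; congr (_ + _).
by apply: eq_bigr => i _; rewrite itv_RintZ//; exact: continuous_funM.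
Qed.

End eigenvector_moments.

(** * Moments of the process *)

Section mixture.
Context (dO dT : measure_display) (O : measurableType dO) (T : measurableType dT) (R : realType).
Variables (P : probability O R) (Y : O -> T) (K : R.-pker T ~> T).
Hypothesis mY : measurable_fun setT Y.

(** The unit factor gives the shape required by kernel composition: with P seen as a constant kernel
    from [unit], the mixture of the K (Y w) is a composition, and integrals against it can be
    iterated. *)
Definition pull_kernel (z : unit * O) : {measure set T -> \bar R} := K (Y z.2).

Let measurable_pull_kernel U : measurable U -> measurable_fun setT (pull_kernel ^~ U).
Proof.
move=> mU; apply: (measurableT_comp (measurable_kernel K U mU)).
exact: measurableT_comp.
Qed.

HB.instance Definition _ := isKernel.Build _ _ _ _ R pull_kernel measurable_pull_kernel.

Let pull_kernel_prob z : pull_kernel z setT = 1%E.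
Proof. exact: prob_kernel. Qed.

HB.instance Definition _ := Kernel_isProbability.Build _ _ _ _ R pull_kernel pull_kernel_prob.

Lemma integral_kernel_mixture (Z : O -> T) (f : T -> \bar R) :
  measurable_fun setT Z ->
  (forall A, measurable A -> P (Z @^-1` A) = (\int[P]_w K (Y w) A)%E) ->
  (forall y, (0 <= f y)%E) -> measurable_fun setT f ->
  (\int[P]_w f (Z w) = \int[P]_w \int[K (Y w)]_y f y)%E.
Proof.
move=> mZ PZ f0 mf.
pose l := kprobability (measurable_cst (P : pprobability O R) : measurable_fun [set: unit] _).
have := @integral_kcomp _ _ _ unit O T R l pull_kernel tt f f0 mf.
move=> <-.
have := @ge0_integral_pushforward _ _ _ _ _ Z mZ P setT f measurableT mf (fun y _ => f0 y).
rewrite preimage_setT => <-.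
apply: eq_measure_integral => A mA _.
exact: PZ.
Qed.

End mixture.

Section affine_mean_flow.
Variables (R : realType) (d : nat) (B : 'M[R]_d) (b x : 'cV[R]_d).

Lemma ode_coeff_affine k :
  ode_coeff B b x k = ode_coeff B b 0 k + \sum_j x j 0 *: ode_coeff B 0 (e_ R j) k.
Proof.
elim: k => [|k IH] /=.
  rewrite add0r; apply/matrixP => i j; rewrite (ord1 j) summxE (bigD1 i)//= big1 ?addr0.
    by rewrite !mxE !eqxx mulr1.
  by move=> k ki; rewrite !mxE eq_sym (negbTE ki) mulr0.
rewrite IH mulmxDr mulmx_sumr addrAC scalerDr; congr (_ + _).
rewrite scaler_sumr; apply: eq_bigr => j _.
by rewrite scaler0 addr0 -scalemxAr !scalerA mulrC.
Qed.

(** An affine dependence on the initial value lets expectations pass through the mean flow. *)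
Lemma ode_sol_affine t :
  ode_sol B b x t = ode_sol B b 0 t + \sum_j x j 0 *: ode_sol B 0 (e_ R j) t.
Proof.
apply/matrixP => i k; rewrite (ord1 k) {k} !mxE summxE.
have cv (a y : 'cV[R]_d) : cvgn (pseries (fun k => ode_coeff B a y k i 0) t).
  apply: cvg_pseries_fact_bound; last by move=> k; exact: ode_coeff_bound.
  by rewrite addr_ge0// sumr_ge0// => j _; rewrite sumr_ge0.
apply: cvg_lim => //.
under [X in _ --> _ + X]eq_bigr do rewrite !mxE.
have -> : pseries (fun k => ode_coeff B b x k i 0) t = (fun n =>
    pseries (fun k => ode_coeff B b 0 k i 0) t n +
    \sum_j x j 0 * pseries (fun k => ode_coeff B 0 (e_ R j) k i 0) t n).
  apply/funext => n; rewrite /pseries /series /=.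
  under eq_bigr => k _ do rewrite ode_coeff_affine !mxE summxE mulrDl mulr_suml.
  rewrite big_split/= exchange_big/=; congr (_ + _); apply: eq_bigr => j _.
  by rewrite mulr_sumr; apply: eq_bigr => k _; rewrite mxE mulrA.
apply: cvgD; first exact: cv.
by apply: cvg_sumr => j _; apply: cvgM; [exact: cvg_cst|exact: cv].
Qed.

End affine_mean_flow.

Section process_moments.
Variables (R : realType) (d : nat) (p : cbi_params R d).
Context (dO : measure_display) (O : measurableType dO) (P : probability O R).
Variable X : R -> O -> Rvec R d.
Hypothesis adm : admissible p.
Hypothesis cbiX : is_cbi p P X.
Hypothesis X02 : ('E_P[fun w => (enorm (X 0 w) ^+ 2)%R] < +oo)%E.
Hypothesis mu_tail : (\sum_(l < d) \int[pmu p l]_(z in Uset)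
     (enorm z ^+ 2 * (1 <= enorm z)%R%:R)%:E < +oo)%E.
Hypothesis nu_tail : (\int[pnu p]_(r in Uset)
     (enorm r ^+ 2 * (1 <= enorm r)%R%:R)%:E < +oo)%E.

Local Notation B := (Btilde p).
Local Notation b := (betatilde p).
Local Notation Pint f := (P.-integrable setT (EFin \o f)).

Let mX t : 0 <= t -> measurable_fun setT (X t). Proof. by case: cbiX => h _ _; exact: h. Qed.
Let cX t w : 0 <= t -> cone (X t w). Proof. by case: cbiX => _ h _; exact: h. Qed.
Let mX0 : measurable_fun setT (X 0). Proof. exact: mX. Qed.
Let cX0 w : cone (X 0 w). Proof. exact: cX. Qed.

Let mC := @measurable_cone R d.

(** The semigroup is existentially quantified in [is_cbi], so the moment computation is demanded for
    every kernel family with the defining properties. Taking f nonnegative allows integrals to be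
    interchanged before any integrability under P is known. *)
Lemma expectation_transfer (t : R) (f g : Rvec R d -> R) : 0 <= t ->
  measurable_fun setT f -> (forall y, cone y -> 0 <= f y) ->
  (forall Q : R -> R.-pker (Rvec R d) ~> (Rvec R d), cbi_semigroup p Q ->
     forall x, cone x -> (Q t x).-integrable cone (EFin \o f) /\
       \int[Q t x]_(y in cone) f y = g x) ->
  (\int[P]_w (f (X t w))%:E = \int[P]_w (g (X 0 w))%:E)%E.
Proof.
move=> t0 mf f0 fg; have [_ _ [Q [sgQ markov]]] := cbiX.
(* Both X and the kernels live on the cone, so truncating f outside it changes no integral. *)
pose f1 y := Num.max 0 (f y).
have mf1 : measurable_fun setT f1 by apply: measurable_maxr => //; exact: measurable_cst.
have f1E y : cone y -> f1 y = f y by move=> cy; rewrite /f1 max_r// f0.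
(* The Markov property at time 0, with the sure event as past. *)
have PX A : measurable A -> P (X t @^-1` A) = (\int[P]_w Q t (X 0 w) A)%E.
  move=> mA; have := markov 0 t setT A (lexx _) t0 _ mA.
  rewrite setTI add0r; apply => // S [[S0 SC _] _].
  by rewrite -(setD0 setT); exact: SC.
have H := integral_kernel_mixture (K := Q t) mX0 (f := EFin \o f1) (mX t0) PX.
transitivity (\int[P]_w ((EFin \o f1) (X t w)))%E.
  by apply: eq_integral => w _ /=; rewrite f1E//; exact: cX.
rewrite H; last 2 first.
- by move=> y; rewrite /= lee_fin le_max lexx.
- exact/measurable_EFinP.
apply: eq_integral => w _.
have [ig e] := fg Q sgQ _ (cX0 w).
have q1 : Q t (X 0 w) cone = 1%E by case: sgQ => h _ _ _; exact: h.
have qC : Q t (X 0 w) (~` cone) = 0%E.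
  have qT : Q t (X 0 w) setT = 1%E by exact: prob_kernel.
  have qU : Q t (X 0 w) setT = (Q t (X 0 w) cone + Q t (X 0 w) (~` cone))%E.
    by rewrite -(setUv (@cone R d)) measureU//; [exact: measurableC|exact: setICr].
  move: qU; rewrite qT q1.
  have : (0 <= Q t (X 0 w) (~` cone))%E by exact: measure_ge0.
  case: (Q t (X 0 w) (~` cone)) => [r| |]//= r0 [] /eqP.
  by rewrite -subr_eq0 opprD addrA subrr sub0r oppr_eq0 => /eqP ->.
rewrite (ge0_negligible_integral (N := ~` cone))//; last 3 first.
- exact: measurableC.
- exact/measurable_EFinP.
- by move=> y _; rewrite /= lee_fin le_max lexx.
rewrite setTD setCK -e (EFin_Rint mC ig).
by apply: eq_integral => y /set_mem cy /=; rewrite f1E.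
Qed.

Lemma Pint_sqr : Pint (fun w => enorm (X 0 w) ^+ 2).
Proof.
apply: rint_ge0_fin.
- apply: measurable_funX; exact: (measurableT_comp (@measurable_enorm R d setT)).
- by move=> w _; exact: sqr_ge0.
- by move: X02; rewrite unlock.
Qed.

Let mT : measurable [set: O]. Proof. exact: measurableT. Qed.

Lemma Pint_cst (k : R) : Pint (fun=> k).
Proof. exact: finite_measure_integrable_cst. Qed.

Let meas_coord i : measurable_fun setT (fun w => X 0 w i 0).
Proof. exact: (measurableT_comp (@measurable_coord R d setT i)). Qed.

Lemma Pint_coord i : Pint (fun w => X 0 w i 0).
Proof.
apply: (rint_le mT _ _ (rintD mT (Pint_cst 1) Pint_sqr)) => // w _.
apply: le_trans (coord_le_enorm _ i) _.
by have := sqr_ge0 (enorm (X 0 w) - 1); have := sqr_ge0 (enorm (X 0 w)); nra.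
Qed.

Lemma Rint_cstP (k : R) : \int[P]_w k = k.
Proof. by have := expectation_cst P k; rewrite unlock /Rintegral => ->. Qed.

Lemma meanE t i : mean P X t i 0 = \int[P]_w X t w i 0.
Proof. by rewrite mxE unlock. Qed.

Lemma Pint_affine (c0 : R) (c : 'I_d -> R) :
  Pint (fun w => c0 + \sum_j X 0 w j 0 * c j) /\
  \int[P]_w (c0 + \sum_j X 0 w j 0 * c j) = c0 + \sum_j mean P X 0 j 0 * c j.
Proof.
have h j : Pint (fun w => X 0 w j 0 * c j).
  by under eq_fun do rewrite mulrC; apply: (rintZ mT); exact: Pint_coord.
have hs : Pint (fun w => \sum_j X 0 w j 0 * c j) by apply: (rint_sum mT) => j _.
split; first by apply: (rintD mT) => //; exact: Pint_cst.
rewrite (RintegralD mT)//; last exact: Pint_cst.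
rewrite Rint_cstP (Rintegral_sum mT)//; congr (_ + _); apply: eq_bigr => j _.
by rewrite (RintegralZr _ mT) ?meanE//; exact: Pint_coord.
Qed.

Lemma mflow_affine (x : 'cV[R]_d) t i :
  mflow p x t i 0 = mflow p 0 t i 0 + \sum_j x j 0 * homsol p j t i 0.
Proof. by rewrite /mflow ode_sol_affine mxE summxE; under eq_bigr do rewrite mxE. Qed.

Lemma mean_mflow t : 0 <= t -> mean P X t = mflow p (mean P X 0) t.
Proof.
move=> t0; apply/matrixP => i j; rewrite (ord1 j) {j}.
have H := expectation_transfer (f := fun y : Rvec R d => y i 0) (g := fun x => mflow p x t i 0) t0.
rewrite meanE /Rintegral H; last 3 first.
- exact: measurable_coord.
- by move=> y cy; exact: cy.
- move=> Q sgQ x cx; have := Rint_kernel_dotr adm mu_tail nu_tail sgQ (e_ R i) t0 cx.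
  have := rint_kernel_dotr adm mu_tail nu_tail sgQ (e_ R i) t0 cx.
  have -> : dotr (e_ R i) = (fun y : 'cV[R]_d => y i 0).
    by apply/funext => y; rewrite dotr_e_.
  by rewrite dotrC dotr_e_.
rewrite -/(Rintegral _ _ _); under eq_Rintegral do rewrite mflow_affine.
by rewrite [RHS]mflow_affine; exact: (Pint_affine (mflow p 0 t i 0) (fun j => homsol p j t i 0)).2.
Qed.

Variables (v : 'cV[R[i]]_d) (lambda : R[i]).
Hypothesis vl : left_eigenvector (Btilde p) lambda v.

Local Notation al := (complex.Re lambda).
Local Notation ka := (complex.Im lambda).
Local Notation rv := (re_mx v).
Local Notation iv := (im_mx v).
Local Open Scope complex_scope.

Lemma Re_cexp (s : R) : complex.Re (cexp (lambda * s%:C)) = ecos al ka s.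
Proof. by case: lambda => a c; rewrite /cexp /ecos /= !mulr0 subr0 add0r. Qed.

Lemma Im_cexp (s : R) : complex.Im (cexp (lambda * s%:C)) = esin al ka s.
Proof. by case: lambda => a c; rewrite /cexp /esin /= !mulr0 subr0 add0r. Qed.

(** Paired with v, the mean equation becomes the scalar equation z' = lambda z + <v, betatilde>.
    Hence the integrand of [Ev] is the squared modulus of the conditional mean of <v, X_t>. *)
Lemma Ev_integrandE (x : 'cV[R]_d) t : 0 <= t ->
  sqmod (cexp (lambda * t%:C) * dotc v (toC x)
     + dotc v (toC b) * cintegral 0 t (fun u => cexp (lambda * (t - u)%:C))) =
  dotr rv (mflow p x t) ^+ 2 + dotr iv (mflow p x t) ^+ 2.
Proof.
move=> t0.
have [er ei] := left_eigenvector_mxE vl.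
have dm k (u : R) := is_derive_dotr (m := mflow p x) (dm := fun u => B *m mflow p x u + b) k
  (fun j => is_derive_mflow p x u j).
have dr (u : R) : is_derive u 1 (fun u => dotr (mflow p x u) rv)
    (al * dotr (mflow p x u) rv - ka * dotr (mflow p x u) iv + dotr b rv).
  apply: is_derive_eq (dm rv u) _.
  by rewrite dotrDl dotr_mulmx er (dotrC _ (_ - _)) dotrBl !dotrZl !(dotrC _ (mflow p x u)).
have di (u : R) : is_derive u 1 (fun u => dotr (mflow p x u) iv)
    (ka * dotr (mflow p x u) rv + al * dotr (mflow p x u) iv + dotr b iv).
  apply: is_derive_eq (dm iv u) _.
  by rewrite dotrDl dotr_mulmx ei (dotrC _ (_ + _)) dotrDl !dotrZl !(dotrC _ (mflow p x u)).
have ce (k : R -> R) : (fun u : R => k (t - u)) = (fun u => k (t - u)) by [].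
rewrite !(dotrC _ (mflow p x t)) (planar_ode_re dr di t0) (planar_ode_im dr di t0).
rewrite /mflow !ode_sol0 !(dotrC x) !(dotrC b).
rewrite /cintegral; under eq_Rintegral do rewrite Re_cexp.
under [X in _ +i* X]eq_Rintegral do rewrite Im_cexp.
have := Re_cexp t; have := Im_cexp t; have := Re_dotc v x; have := Im_dotc v x.
have := Re_dotc v b; have := Im_dotc v b.
move: (dotc v (toC x)) (dotc v (toC b)) (cexp (lambda * t%:C)) => [x1 x2] [y1 y2] [z1 z2] /=.
move=> <- <- <- <- <- <-; rewrite sqmodE /=; congr (_ ^+ 2 + _ ^+ 2); ring.
Qed.

Lemma Pint_Ev t : 0 <= t ->
  Pint (fun w => dotr rv (mflow p (X 0 w) t) ^+ 2 + dotr iv (mflow p (X 0 w) t) ^+ 2).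
Proof.
move=> t0.
have h (k : 'cV[R]_d) : Pint (fun w => dotr k (mflow p (X 0 w) t) ^+ 2).
  pose a0 := dotr k (mflow p 0 t); pose a : 'cV[R]_d := \col_j dotr k (homsol p j t).
  have E x : dotr k (mflow p x t) = a0 + dotr a x.
    rewrite /dotr; under eq_bigr do rewrite mflow_affine mulrDr mulr_sumr.
    rewrite big_split/= exchange_big/=; congr (_ + _); apply: eq_bigr => j _.
    by rewrite mxE mulr_suml; apply: eq_bigr => i _; rewrite mulrCA mulrC.
  under eq_fun do rewrite E.
  apply: (rint_le mT _ _ (rintD mT (Pint_cst (2 * a0 ^+ 2)) (rintZ mT (2 * n1 a ^+ 2) Pint_sqr))).
    apply: measurable_funX; apply: measurable_funD; first exact: measurable_cst.
    exact: (measurableT_comp (@measurable_dotr R d setT a)).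
  move=> w _; rewrite ger0_norm ?sqr_ge0//.
  have : dotr a (X 0 w) ^+ 2 <= n1 a ^+ 2 * enorm (X 0 w) ^+ 2.
    rewrite -exprMn -real_normK ?num_real//; apply: lerXn2r; rewrite ?nnegrE//.
      by rewrite mulr_ge0 ?n1_ge0 ?enorm_ge0.
    exact: dotr_le.
  by have := sqr_ge0 (a0 - dotr a (X 0 w)); nra.
exact: (rintD mT).
Qed.

Lemma EvE t : 0 <= t -> Ev p P X v lambda t =
  \int[P]_w (dotr rv (mflow p (X 0 w) t) ^+ 2 + dotr iv (mflow p (X 0 w) t) ^+ 2).
Proof.
move=> t0; rewrite /Ev unlock /Rintegral; congr fine.
by apply: eq_integral => w _; rewrite Ev_integrandE.
Qed.

(** [S1] is the squared conditional mean and [S2] the conditional variance given X_0 = x. [S1] is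
    quadratic in x and integrates to [Ev]; [S2] is affine, so its expectation is its value at the
    mean of X_0. *)
Lemma second_moment t : 0 <= t ->
  'E_P[fun w => sqmod (dotc v (toC (X t w)))%R]%E =
     (Ev p P X v lambda t
      + \sum_(l < d) Cv p v l * Il P X lambda l t
      + I_ lambda t * nu_int p v)%:E.
Proof.
move=> t0; rewrite unlock.
pose S1 x := dotr rv (mflow p x t) ^+ 2 + dotr iv (mflow p x t) ^+ 2.
pose J x i := \int[lebesgue_measure]_(u in `[0, t]) (expR (2 * al * (t - u)) * mflow p x u i 0).
pose S2 x := \sum_i Cv p v i * J x i + I_ lambda t * nu_int p v.
have H := expectation_transfer (f := fun y : Rvec R d => sqmod (dotc v (toC y)))
  (g := fun x => S1 x + S2 x) t0.
have sE (y : Rvec R d) : sqmod (dotc v (toC y)) = dotr rv y ^+ 2 + dotr iv y ^+ 2.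
  exact: sqmod_dotc.
rewrite H; last 3 first.
- under eq_fun do rewrite sE.
  by apply: measurable_funD; apply: measurable_funX; exact: measurable_dotr.
- by move=> y _; rewrite sE addr_ge0 ?sqr_ge0.
- move=> Q sgQ x cx; have := @rint_kernel_dotr2 _ _ p adm mu_tail nu_tail Q sgQ t x _ t0 cx.
  move=> ir; split; first by under eq_fun do rewrite sE; exact: (rintD mC).
  under eq_Rintegral do rewrite sE.
  rewrite (RintegralD mC)// !(Rint_kernel_dotr2 adm mu_tail nu_tail sgQ _ t0 cx).
  rewrite /S1 /S2 -(quad_term_re_im adm mu_tail nu_tail vl x t0) !(dotrC (mflow p x t)).
  by rewrite mulrDr addrACA.
have ce : continuous (fun u => expR (2 * al * (t - u))).
  apply: (@continuous_fun_subl _ (fun s => expR (2 * al * s)) t) => s.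
  exact: is_derive1_continuous (is_derive1_expRM (2 * al) s).
pose c0 i := \int[lebesgue_measure]_(u in `[0, t]) (expR (2 * al * (t - u)) * mflow p 0 u i 0).
pose c1 i j := \int[lebesgue_measure]_(u in `[0, t]) (expR (2 * al * (t - u)) * homsol p j u i 0).
have JE x i : J x i = c0 i + \sum_j x j 0 * c1 i j.
  have ch j : continuous (fun u => expR (2 * al * (t - u)) * homsol p j u i 0).
    apply: continuous_funM => // u; exact: is_derive1_continuous (is_derive_homsol p j i u).
  have cm : continuous (fun u => expR (2 * al * (t - u)) * mflow p 0 u i 0).
    by apply: continuous_funM => //; exact: continuous_mflow.
  have chz j := @continuous_funZ _ (x j 0) _ (ch j).
  have e j : x j 0 * c1 i j = \int[lebesgue_measure]_(u in `[0, t])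
      (x j 0 * (expR (2 * al * (t - u)) * homsol p j u i 0)) by rewrite (itv_RintZ (x j 0) 0 t (ch j)).
  under eq_bigr do rewrite e.
  rewrite -(itv_Rint_sum 0 t chz) -(itv_RintD 0 t cm (continuous_fun_sum chz)).
  apply: eq_Rintegral => u _; rewrite mflow_affine mulrDr mulr_sumr; congr (_ + _).
  by apply: eq_bigr => j _; rewrite mulrCA.
have IlE i : J (mean P X 0) i = Il P X lambda i t.
  apply: eq_Rintegral => u; rewrite inE/= in_itv/= => /andP[u0 _].
  by rewrite (mean_mflow u0).
have iS2 : Pint (fun w => S2 (X 0 w)) /\ \int[P]_w S2 (X 0 w) = S2 (mean P X 0).
  pose a0 := \sum_i Cv p v i * c0 i + I_ lambda t * nu_int p v.
  pose a1 j := \sum_i Cv p v i * c1 i j.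
  have S2E x : S2 x = a0 + \sum_j x j 0 * a1 j.
    rewrite /S2; under eq_bigr do rewrite JE mulrDr mulr_sumr.
    rewrite big_split/= addrAC; congr (_ + _); rewrite exchange_big/=; apply: eq_bigr => j _.
    by rewrite mulr_sumr; apply: eq_bigr => i _; rewrite mulrCA.
  under eq_fun do rewrite S2E.
  by rewrite S2E; exact: Pint_affine.
rewrite -(EFin_Rint mT); last by apply: (rintD mT); [exact: Pint_Ev|exact: iS2.1].
rewrite (RintegralD mT); [|exact: Pint_Ev|exact: iS2.1].
rewrite iS2.2 EvE// -addrA /S2; congr (_ + (_ + _))%:E.
by apply: eq_bigr => i _; rewrite IlE.
Qed.

End process_moments.

(** * Irreducibility and the Perron rate *)

Section irreducibility.
Variables (R : realType) (d : nat).

(** Listing J first and its complement afterwards gives the block form in which reducibility is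
    expressed. *)
Lemma set_perm (J : {set 'I_d}) :
  exists s : 'S_d, forall k : 'I_d, (s k \in J) = (k < #|J|)%N.
Proof.
pose e := enum J ++ enum (~: J).
have se : size e = d by rewrite size_cat -!cardE cardsC card_ord.
have ue : uniq e.
  rewrite cat_uniq !enum_uniq andbT/=; apply/hasPn => k.
  by rewrite !mem_enum inE.
have finj : injective (fun k : 'I_d => nth k e k).
  move=> k k' /= ; rewrite (set_nth_default k) ?se// => /eqP.
  by rewrite nth_uniq ?se// => /eqP; exact: val_inj.
exists (perm finj) => k; rewrite permE /e nth_cat -cardE.
case: ltnP => kJ; first by rewrite -mem_enum mem_nth// -cardE.
have /(mem_nth k) : (k - #|J| < size (enum (~: J)))%N.
  by rewrite -cardE ltn_subLR// cardsC card_ord.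
by rewrite mem_enum inE => /negbTE.
Qed.

(** If all entries with row outside J and column in J vanished, they would form the zero block of a
    reducible matrix. *)
Lemma irreducible_edge (A : 'M[R]_d) (J : {set 'I_d}) :
  irreducible A -> J != finset.set0 -> J != finset.setT ->
  exists i j, [/\ i \notin J, j \in J & A i j != 0].
Proof.
move=> irr J0 JT; apply: contrapT => noedge; apply: irr.
have [s sJ] := set_perm J.
exists s, #|J|; split.
  rewrite lt0n cards_eq0 J0/= -[X in (_ < X)%N]card_ord -cardsT; apply: proper_card.
  by rewrite properE finset.subsetT finset.subTset JT.
move=> i j /andP[jJ Ji]; rewrite !mxE; apply: contrapT => /eqP Aij.
apply: noedge; exists (s i), (s j); split => //; last by rewrite sJ.
by rewrite sJ -leqNgt.
Qed.

End irreducibility.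

(** * Exponential convergence to the Perron direction *)

Section spectral_gap.
Variables (R : realType) (d : nat) (B : 'M[R]_d) (s : R) (ut u : 'cV[R]_d).
Hypothesis d0 : (0 < d)%N.
Hypothesis B0 : forall i j, i != j -> 0 <= B i j.
Hypothesis irrB : irreducible B.
Hypothesis ut0 : forall i, 0 < ut i 0.
Hypothesis u0 : forall i, 0 < u i 0.
Hypothesis But : B *m ut = s *: ut.
Hypothesis uB : u^T *m B = s *: u^T.
Hypothesis utu : dotr u ut = 1.

Definition dirichlet (f : 'I_d -> R) : R :=
  \sum_i \sum_j u i 0 * B i j * ut j 0 * (f i - f j) ^+ 2.

(** Diagonal entries of B may be negative, but they are multiplied by f i - f i. *)
Lemma dirichlet_term_ge0 (f : 'I_d -> R) i j : 0 <= u i 0 * B i j * ut j 0 * (f i - f j) ^+ 2.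
Proof.
have [->|ij] := eqVneq i j; first by rewrite subrr expr0n mulr0.
by rewrite mulr_ge0 ?sqr_ge0// mulr_ge0 ?(ltW (ut0 _))// mulr_ge0 ?B0// ltW.
Qed.

Lemma dirichlet_ge0 f : 0 <= dirichlet f.
Proof. by apply: sumr_ge0 => i _; apply: sumr_ge0 => j _; exact: dirichlet_term_ge0. Qed.

Lemma dirichlet_term_le f i j : u i 0 * B i j * ut j 0 * (f i - f j) ^+ 2 <= dirichlet f.
Proof.
rewrite /dirichlet (bigD1 i)//= (bigD1 j)//= -addrA lerDl addr_ge0//.
  by apply: sumr_ge0 => k _; exact: dirichlet_term_ge0.
by apply: sumr_ge0 => k _; apply: sumr_ge0 => k' _; exact: dirichlet_term_ge0.
Qed.

(* The indices controlled by i0 are closed under the edges of B, hence are all the indices by irreducibility. *)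
Let controlled i j := exists2 K : R, 0 <= K & forall f, (f i - f j) ^+ 2 <= K * dirichlet f.

Let all_controlled i0 j : controlled i0 j.
Proof.
pose J := [set j : 'I_d | `[< controlled i0 j >]]%SET.
have inJ k : (k \in J) = `[< controlled i0 k >] by rewrite inE.
have J0 : J != finset.set0.
  apply/finset.set0Pn; exists i0; rewrite inJ; apply/asboolP; exists 0 => // f.
  by rewrite subrr expr0n mul0r.
have [JT|JT] := eqVneq J finset.setT.
  by apply/asboolP; rewrite -inJ JT inE.
have [i [k [iJ kJ Bik]]] := irreducible_edge irrB J0 JT.
have ik : i != k by apply: contraNneq iJ => ->.
have a0 : 0 < u i 0 * B i k * ut k 0 by rewrite !mulr_gt0// lt_neqAle eq_sym Bik B0.
exfalso; move/negP: iJ; apply; rewrite inJ; apply/asboolP.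
have [K K0 hK] : controlled i0 k by apply/asboolP; rewrite -inJ.
(* From (x - y)^2 <= 2 x^2 + 2 y^2 with the intermediate index k; a single Dirichlet term controls
   the edge between i and k. *)
exists (2 * K + 2 * (u i 0 * B i k * ut k 0)^-1).
  by rewrite addr_ge0// mulr_ge0// invr_ge0 ltW.
move=> f; have h1 := hK f.
have h2 : (f i - f k) ^+ 2 <= (u i 0 * B i k * ut k 0)^-1 * dirichlet f.
  by rewrite ler_pdivlMl//; exact: dirichlet_term_le.
have h3 := sqr_ge0 ((f i0 - f k) + (f i - f k)).
rewrite mulrDl; move: h1 h2 h3; move: (dirichlet f) (_^-1) => D a h1 h2 h3.
nra.
Qed.

(** The weights u_i ut_i have total mass 1, so for f of weighted mean 0 the second moment about 0 is
    at most that about f i0, and every difference f i0 - f i is controlled by the Dirichlet form. *)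
Lemma poincare : exists2 K : R, 0 < K & forall f : 'I_d -> R,
  \sum_i u i 0 * ut i 0 * f i = 0 ->
  \sum_i u i 0 * ut i 0 * f i ^+ 2 <= K * dirichlet f.
Proof.
pose i0 : 'I_d := Ordinal d0.
have /choice[k hk] : forall j, exists K : R, 0 <= K /\ forall f, (f i0 - f j) ^+ 2 <= K * dirichlet f.
  by move=> j; have [K K0 hK] := all_controlled i0 j; exists K.
exists (1 + \sum_j k j).
  by rewrite ltr_pwDl// sumr_ge0// => j _; case: (hk j).
move=> f f0.
have p1 : \sum_i u i 0 * ut i 0 = 1 by [].
have -> : \sum_i u i 0 * ut i 0 * f i ^+ 2 = \sum_i u i 0 * ut i 0 * (f i0 - f i) ^+ 2 - f i0 ^+ 2.
  transitivity (\sum_i (u i 0 * ut i 0 * (f i0 - f i) ^+ 2 - f i0 ^+ 2 * (u i 0 * ut i 0)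
      + 2 * f i0 * (u i 0 * ut i 0 * f i))).
    by apply: eq_bigr => i _; ring.
  by rewrite big_split/= sumrB -!mulr_sumr f0 p1 mulr0 mulr1 addr0.
apply: (@le_trans _ _ (\sum_i u i 0 * ut i 0 * (f i0 - f i) ^+ 2)).
  by rewrite lerBlDr lerDl sqr_ge0.
rewrite -[leRHS]mul1r -{1}p1 mulr_suml; apply: ler_sum => i _.
rewrite ler_wpM2l ?mulr_ge0 ?(ltW (u0 _)) ?(ltW (ut0 _))//.
apply: le_trans ((hk i).2 f) _; rewrite ler_wpM2r ?dirichlet_ge0//.
rewrite (bigD1 i)//= addrCA lerDl addr_ge0// sumr_ge0// => j _.
by case: (hk j).
Qed.

(** Expand the squares of the Dirichlet form. By the right and left eigenvector relations, the parts
    in f_i^2 and in f_j^2 both sum to s times the weighted second moment, and the cross terms are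
    the pairing with B y. *)
Lemma dirichletE (y : 'cV[R]_d) :
  2 * \sum_i u i 0 * (y i 0 / ut i 0) * (B *m y - s *: y) i 0 =
  - dirichlet (fun i => y i 0 / ut i 0).
Proof.
pose f i := y i 0 / ut i 0.
have yE i : y i 0 = f i * ut i 0 by rewrite /f divfK// gt_eqF.
have row i : \sum_j B i j * ut j 0 = s * ut i 0.
  by have /matrixP/(_ i 0) := But; rewrite !mxE.
have col j : \sum_i u i 0 * B i j = s * u j 0.
  have /matrixP/(_ 0 j) := uB; rewrite !mxE => <-.
  by apply: eq_bigr => i _; rewrite mxE.
have e1 : \sum_i \sum_j u i 0 * B i j * ut j 0 * f i ^+ 2 = s * \sum_i u i 0 * ut i 0 * f i ^+ 2.
  rewrite mulr_sumr; apply: eq_bigr => i _.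
  transitivity (u i 0 * f i ^+ 2 * \sum_j B i j * ut j 0).
    by rewrite mulr_sumr; apply: eq_bigr => j _; ring.
  by rewrite row; ring.
have e2 : \sum_i \sum_j u i 0 * B i j * ut j 0 * f j ^+ 2 = s * \sum_i u i 0 * ut i 0 * f i ^+ 2.
  rewrite exchange_big/= mulr_sumr; apply: eq_bigr => j _.
  transitivity (ut j 0 * f j ^+ 2 * \sum_i u i 0 * B i j).
    by rewrite mulr_sumr; apply: eq_bigr => i _; ring.
  by rewrite col; ring.
have e3 : \sum_i u i 0 * f i * (B *m y - s *: y) i 0 =
   \sum_i \sum_j u i 0 * B i j * ut j 0 * (f i * f j) - s * \sum_i u i 0 * ut i 0 * f i ^+ 2.
  rewrite mulr_sumr -sumrB; apply: eq_bigr => i _.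
  rewrite !mxE mulrBr yE; congr (_ - _); last by ring.
  by rewrite mulr_sumr; apply: eq_bigr => j _; rewrite yE; ring.
rewrite e3 /dirichlet.
have -> : \sum_i \sum_j u i 0 * B i j * ut j 0 * (f i - f j) ^+ 2 =
   \sum_i \sum_j u i 0 * B i j * ut j 0 * f i ^+ 2 +
   \sum_i \sum_j u i 0 * B i j * ut j 0 * f j ^+ 2 -
   2 * \sum_i \sum_j u i 0 * B i j * ut j 0 * (f i * f j).
  rewrite mulr_sumr -big_split -sumrB/=; apply: eq_bigr => i _.
  rewrite mulr_sumr -big_split -sumrB/=; apply: eq_bigr => j _; ring.
rewrite e1 e2.
by move: (\sum_i \sum_j _) (s * _) => a c; ring.
Qed.

Variables (m : R -> 'cV[R]_d) (b : 'cV[R]_d).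
Hypothesis s0 : 0 < s.
Hypothesis dm : forall (t : R) i, is_derive t 1 (fun t => m t i 0) ((B *m m t + b) i 0).

(** [c] is the coefficient of e^{-st} m(t) along [ut], and [w] is its limit. *)
Let w := dotr u (m 0) + dotr u b / s.
Let c t := expR (- s * t) * dotr u (m t).
Let y t : 'cV[R]_d := expR (- s * t) *: m t - c t *: ut.

Let dE (k t : R) : is_derive t 1 (fun t => expR (k * t)) (k * expR (k * t)).
Proof. exact: is_derive1_expRM. Qed.

Let dc (t : R) : is_derive t 1 c (expR (- s * t) * dotr u b).
Proof.
have dum : is_derive t 1 (fun t => dotr u (m t)) (dotr u (B *m m t + b)).
  by apply: is_derive1_sum => i; exact: is_derive1Z.
have Bu : B^T *m u = s *: u by rewrite -[RHS]trmxK linearZ/= -uB trmx_mul trmxK.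
apply: is_derive_eq (is_derive1M (dE (- s) t) dum) _.
by rewrite dotrDr (dotrC u (B *m _)) dotr_mulmx Bu dotrZr (dotrC (m t)); ring.
Qed.

Let cE t : c t = w - dotr u b / s * expR (- s * t).
Proof.
have h (x : R) : is_derive x 1 (fun t => c t + dotr u b / s * expR (- s * t)) 0.
  apply: is_derive_eq (is_derive1D (dc x) (is_derive1Z _ (dE (- s) x))) _.
  by field; rewrite gt_eqF.
have := is_derive_0_is_cst t 0 h.
by rewrite /c mulr0 expR0 mul1r mulr1 /w => <-; rewrite addrK.
Qed.

(** The component of b orthogonal to u, which is the source in the equation of y. *)
Let g := b - dotr u b *: ut.

Let dy (t : R) i : is_derive t 1 (fun t => y t i 0) ((B *m y t - s *: y t) i 0 + expR (- s * t) * g i 0).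
Proof.
have -> : (fun t => y t i 0) = (fun t => expR (- s * t) * m t i 0 - ut i 0 * c t).
  by apply/funext => r; rewrite !mxE (mulrC (c r)).
apply: is_derive_eq (is_derive1B (is_derive1M (dE (- s) t) (dm t i)) (is_derive1Z (ut i 0) (dc t))) _.
have -> : B *m y t - s *: y t = expR (- s * t) *: (B *m m t) - s *: (expR (- s * t) *: m t).
  rewrite mulmxBr -!scalemxAr But scalerBr opprB addrA.
  by rewrite (scalerA (c t)) (mulrC (c t)) -(scalerA s) subrK.
rewrite /g !mxE; ring.
Qed.

Let uy t : \sum_i u i 0 * ut i 0 * (y t i 0 / ut i 0) = 0.
Proof.
transitivity (dotr u (y t)).
  by apply: eq_bigr => i _; field; rewrite gt_eqF.
by rewrite /y dotrDr -scaleNr !dotrZr utu mulr1 /c addrN.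
Qed.

(* The Lyapunov function is V = sum_i (u_i / ut_i) y_i^2, where y = e^{-st} m - c ut is orthogonal to u. *)
Lemma perron_rate : exists2 de : R, 0 < de & exists2 C : R, 0 <= C &
  forall (t : R) i, 0 <= t -> `|expR (- s * t) * m t i 0 - w * ut i 0| <= C * expR (- de * t).
Proof.
have [K K0 hK] := poincare.
pose f t i := y t i 0 / ut i 0.
pose V t := \sum_i u i 0 / ut i 0 * (y t i 0 * y t i 0).
have VE t : V t = \sum_i u i 0 * ut i 0 * f t i ^+ 2.
  by apply: eq_bigr => i _; rewrite /f; field; rewrite gt_eqF.
have V0 t : 0 <= V t.
  by rewrite VE sumr_ge0// => i _; rewrite mulr_ge0 ?sqr_ge0// mulr_ge0// ltW.
pose dV t := - dirichlet (f t) + 2 * expR (- s * t) * \sum_i u i 0 * f t i * g i 0.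
have dVt (t : R) : is_derive t 1 V (dV t).
  have h i := is_derive1Z (u i 0 / ut i 0) (is_derive1M (dy t i) (dy t i)).
  apply: is_derive_eq (is_derive1_sum h) _.
  rewrite /dV -dirichletE -/f !mulr_sumr -big_split/=; apply: eq_bigr => i _.
  by rewrite /f; ring.
(* From Young's inequality with weight 2 K: half of the dissipation V / K absorbs the source term,
   at the price of C e^{-2st}. *)
pose C := 2 * K * \sum_i u i 0 / ut i 0 * g i 0 ^+ 2.
have C0 : 0 <= C.
  rewrite mulr_ge0 ?mulr_ge0 ?(ltW K0)// sumr_ge0// => i _.
  by rewrite mulr_ge0 ?sqr_ge0// divr_ge0 ?(ltW (u0 i)) ?(ltW (ut0 i)).
have K2 : 0 < (2 * K)^-1 by rewrite invr_gt0 mulr_gt0.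
have dVle t : dV t <= - (2 * K)^-1 * V t + C * expR (- s * t) ^+ 2.
  have hD : V t <= K * dirichlet (f t) by rewrite VE; exact: hK (uy t).
  have hE : 2 * expR (- s * t) * \sum_i u i 0 * f t i * g i 0 <=
      (2 * K)^-1 * V t + C * expR (- s * t) ^+ 2.
    rewrite (mulrC C) VE /C !mulr_sumr -big_split/=.
    apply: ler_sum => i _.
    have h := sqr_ge0 (ut i 0 * f t i - (2 * K) * (expR (- s * t) * g i 0)).
    have a0 : 0 < (2 * K)^-1 * (u i 0 / ut i 0) by rewrite mulr_gt0// divr_gt0.
    rewrite -subr_ge0.
    have -> : (2 * K)^-1 * (u i 0 * ut i 0 * f t i ^+ 2) +
        expR (- s * t) ^+ 2 * (2 * K * (u i 0 / ut i 0 * g i 0 ^+ 2)) -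
        2 * expR (- s * t) * (u i 0 * f t i * g i 0) =
      (2 * K)^-1 * (u i 0 / ut i 0) * (ut i 0 * f t i - (2 * K) * (expR (- s * t) * g i 0)) ^+ 2.
      by field; rewrite !gt_eqF.
    by rewrite mulr_ge0// ltW.
  have hD2 : V t / K <= dirichlet (f t) by rewrite ler_pdivrMr// mulrC.
  rewrite /dV; apply: (@le_trans _ _ (- (V t / K) + ((2 * K)^-1 * V t + C * expR (- s * t) ^+ 2))).
    by apply: lerD => //; rewrite lerN2.
  rewrite le_eqVlt; apply/orP; left; apply/eqP; field; rewrite gt_eqF//.
(* The remaining dissipation rate, capped by s so that the forcing e^{-2st} decays faster than
   e^{-kt}. *)
pose k := Num.min (2 * K)^-1 s.
have k0 : 0 < k by rewrite lt_min K2.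
have kK : k <= (2 * K)^-1 by rewrite ge_min lexx.
have ks : k <= s by rewrite ge_min lexx orbT.
have s2k : 0 < 2 * s - k by rewrite subr_gt0 (le_lt_trans ks)// ltr_pMl// ltr1n.
(* The second term has derivative -C e^{(k - 2s)t}, which compensates the forcing and makes W
   nonincreasing. *)
pose W t := expR (k * t) * V t + C / (2 * s - k) * expR ((k - 2 * s) * t).
have W0 t : 0 <= W t.
  by rewrite addr_ge0// mulr_ge0 ?expR_ge0// divr_ge0// ltW.
have Wle t : 0 <= t -> W t <= W 0.
  move=> t0.
  have dW (r : R) : is_derive r 1 W (k * expR (k * r) * V r + expR (k * r) * dV r +
      C / (2 * s - k) * ((k - 2 * s) * expR ((k - 2 * s) * r))).
    by apply: is_derive1D (is_derive1M (dE k r) (dVt r)) (is_derive1Z _ (dE (k - 2 * s) r)).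
  apply: (is_derive_le_itv t0 _ (fun r _ => dW r)).
    by apply: continuous_subspaceT => r; exact: is_derive1_continuous (dW r).
  move=> r _.
  have -> : expR ((k - 2 * s) * r) = expR (k * r) * expR (- s * r) ^+ 2.
    by rewrite expr2 -!expRD; congr expR; ring.
  have -> : k * expR (k * r) * V r + expR (k * r) * dV r +
      C / (2 * s - k) * ((k - 2 * s) * (expR (k * r) * expR (- s * r) ^+ 2)) =
      expR (k * r) * (k * V r + dV r - C * expR (- s * r) ^+ 2).
    by field; rewrite gt_eqF.
  rewrite mulr_ge0_le0 ?expR_ge0//.
  have h1 := dVle r.
  have h2 : k * V r <= (2 * K)^-1 * V r by rewrite ler_wpM2r.
  rewrite subr_le0 -lerBrDl (le_trans h1)// addrC lerD2l mulNr lerN2//.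
have VW t : 0 <= t -> V t <= W 0 * expR (- k * t).
  move=> t0; have h := Wle t t0.
  have h1 : expR (k * t) * V t <= W 0.
    by apply: le_trans h; rewrite lerDl mulr_ge0 ?expR_ge0// divr_ge0// ltW.
  by rewrite mulNr expRN ler_pdivlMr ?expR_gt0// mulrC.
(* V is quadratic in y, so the rate is halved on taking square roots. *)
exists (k / 2); first exact: divr_gt0.
pose Ci i := Num.sqrt (ut i 0 / u i 0 * W 0) + `|dotr u b / s| * ut i 0.
have Ci0 i : 0 <= Ci i by rewrite addr_ge0 ?sqrtr_ge0// mulr_ge0// ltW.
exists (\sum_i Ci i); first exact: sumr_ge0.
move=> t i t0.
apply: (@le_trans _ _ (Ci i * expR (- (k / 2) * t))); last first.
  by rewrite ler_wpM2r ?expR_ge0// (bigD1 i)//= lerDl sumr_ge0.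
have -> : expR (- s * t) * m t i 0 - w * ut i 0 = y t i 0 - dotr u b / s * ut i 0 * expR (- s * t).
  rewrite /y !mxE cE; ring.
apply: le_trans (ler_normB _ _) _; rewrite mulrDl; apply: lerD.
  rewrite -sqrtr_sqr.
  have -> : expR (- (k / 2) * t) = Num.sqrt (expR (- k * t)).
    rewrite (_ : - k * t = - (k / 2) * t + - (k / 2) * t); last by field.
    by rewrite expRD -expr2 sqrtr_sqr ger0_norm// expR_ge0.
  rewrite -sqrtrM; last by rewrite mulr_ge0 ?W0// divr_ge0// ltW.
  apply: ler_wsqrtr; rewrite -(mulrA (ut i 0 / u i 0)).
  apply: le_trans (_ : _ <= ut i 0 / u i 0 * V t) _; last first.
    by rewrite ler_wpM2l ?VW// divr_ge0// ltW.
  rewrite /V (bigD1 i)//= mulrDr expr2.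
  have -> : ut i 0 / u i 0 * (u i 0 / ut i 0 * (y t i 0 * y t i 0)) = y t i 0 * y t i 0.
    by field; rewrite !gt_eqF.
  rewrite lerDl mulr_ge0//; first by rewrite divr_ge0// ltW.
  apply: sumr_ge0 => j _; rewrite mulr_ge0 -?expr2 ?sqr_ge0//.
  by rewrite divr_ge0// ltW.
rewrite !normrM -normrM [X in _ * X]ger0_norm ?expR_ge0//.
rewrite (ger0_norm (ltW (ut0 i))) ler_wpM2l ?mulr_ge0 ?(ltW (ut0 i))//.
rewrite ler_expR !mulNr lerN2 ler_wpM2r//.
by rewrite ler_pdivrMr// (le_trans ks)// ler_peMr ?(ltW s0)// ler1n.
Qed.

End spectral_gap.

(** * Limits *)

Section limits_at_infinity.
Variable R : realType.
Implicit Types f : R -> R.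

Lemma cvg_invr_pinfty : t^-1 @[t --> +oo] --> (0 : R).
Proof. by apply/gtr0_cvgV0; [exact: nbhs_pinfty_gt|exact: cvg_id]. Qed.

Lemma cvg_exprM_expRN n (k : R) : 0 < k -> t ^+ n * expR (- k * t) @[t --> +oo] --> 0.
Proof.
(* The exponential series gives (k t)^(n + 1) <= (n + 1)! e^{kt}, so the expression is at most C /
   t. *)
move=> k0; pose C := (n.+1)`!%:R / k ^+ n.+1.
apply: (@squeeze_cvgr _ _ _ _ (fun=> 0) (fun t => C * t^-1)).
- near=> t.
  have t0 : 0 < t by near: t; exact: nbhs_pinfty_gt.
  rewrite mulr_ge0 ?exprn_ge0 ?expR_ge0 ?(ltW t0)//=.
  have kt : 0 < k * t by rewrite mulr_gt0.
  have f0 : 0 < (n.+1)`!%:R :> R by rewrite ltr0n fact_gt0.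
  have h : (k * t) ^+ n.+1 <= expR (k * t) * (n.+1)`!%:R.
    rewrite -ler_pdivrMr//; apply: le_trans (expR_ge1Dxn n (ltW kt)).
    by rewrite lerDr.
  rewrite mulNr expRN ler_pdivrMr ?expR_gt0// /C -(ler_pM2l (exprn_gt0 n.+1 kt)).
  apply: le_trans (_ : expR (k * t) * (n.+1)`!%:R * t ^+ n <= _).
    by rewrite ler_pM2r ?exprn_gt0.
  rewrite le_eqVlt; apply/orP; left; apply/eqP.
  rewrite exprMn (exprS t); move: (expR _) ((n.+1)`!%:R) => E F.
  by field; rewrite gt_eqF//= expf_neq0// gt_eqF.
- exact: cvg_cst.
- by rewrite -[X in _ --> X](mulr0 C); apply: cvgM; [exact: cvg_cst|exact: cvg_invr_pinfty].
Unshelve. all: by end_near.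
Qed.

Lemma cvg_expRNM (k : R) : 0 < k -> expR (- k * t) @[t --> +oo] --> 0.
Proof. by move=> /(@cvg_exprM_expRN 0); under eq_fun do rewrite expr0 mul1r. Qed.

Lemma continuous_expRM (k : R) : continuous (fun t : R => expR (k * t)).
Proof. by move=> t; exact: is_derive1_continuous (is_derive1_expRM k t). Qed.

Lemma le_itv_Rint (f F g : R -> R) (t : R) : 0 <= t -> continuous f ->
  (forall s : R, is_derive s 1 F (g s)) -> continuous g ->
  (forall s, 0 <= s <= t -> f s <= g s) ->
  \int[lebesgue_measure]_(s in `[0, t]) f s <= F t - F 0.
Proof.
move=> t0 cf dF cg fg; rewrite -(itv_Rint_FTC t0 dF cg).
by apply: le_Rintegral => //; exact: continuous_rint.
Qed.

Lemma ge_itv_Rint (f F g : R -> R) (t : R) : 0 <= t -> continuous f ->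
  (forall s : R, is_derive s 1 F (g s)) -> continuous g ->
  (forall s, 0 <= s <= t -> g s <= f s) ->
  F t - F 0 <= \int[lebesgue_measure]_(s in `[0, t]) f s.
Proof.
move=> t0 cf dF cg fg; rewrite -(itv_Rint_FTC t0 dF cg).
by apply: le_Rintegral => //; exact: continuous_rint.
Qed.

Definition exp_close f (L : R) := exists2 de : R, 0 < de & exists2 C : R, 0 <= C &
  forall t, 0 <= t -> `|f t - L| <= C * expR (- de * t).

(** The primitive used for the convolution divides by g - de, so the rate is made smaller than g. *)
Lemma exp_close_shrink f (L g : R) : 0 < g -> exp_close f L ->
  exists2 de : R, 0 < de < g & exists2 C : R, 0 <= C &
  forall t, 0 <= t -> `|f t - L| <= C * expR (- de * t).
Proof.
move=> g0 [de de0 [C C0 h]]; exists (Num.min de (g / 2)).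
  rewrite lt_min de0 divr_gt0//= gt_min.
  by apply/orP; right; rewrite ltr_pdivrMr// ltr_pMr// ltr1n.
exists C => // t t0; apply: le_trans (h t t0) _.
by rewrite ler_wpM2l// ler_expR !mulNr lerN2 ler_wpM2r// ge_min lexx.
Qed.

Lemma cvg_exp_conv (g L : R) f : 0 < g -> continuous f -> exp_close f L ->
  \int[lebesgue_measure]_(s in `[0, t]) (expR (- g * (t - s)) * f s) @[t --> +oo] --> L / g.
Proof.
move=> g0 cf /(exp_close_shrink g0)[de /andP[de0 deg] [C C0 h]].
have gd : 0 < g - de by rewrite subr_gt0.
(* A primitive in s of e^{-g (t - s)} (L + k e^{-de s}); k = C and k = -C give the two envelopes of
   the integrand. *)
pose G (k : R) t s := expR (- g * (t - s)) * (L / g + k * expR (- de * s) / (g - de)).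
have dG k t (s : R) : is_derive s 1 (G k t) (expR (- g * (t - s)) * (L + k * expR (- de * s))).
  have d1 : is_derive s 1 (fun s => expR (- g * (t - s))) (g * expR (- g * (t - s))).
    have := is_derive1_comp_subl (is_derive1_expRM (- g) (t - s)).
    by rewrite mulNr opprK.
  have d2 : is_derive s 1 (fun s => L / g + k * expR (- de * s) / (g - de))
      (0 + k / (g - de) * (- de * expR (- de * s))).
    have -> : (fun s => L / g + k * expR (- de * s) / (g - de)) =
        (fun s => L / g + k / (g - de) * expR (- de * s)).
      by apply/funext => r; rewrite mulrAC.
    exact: is_derive1D (is_derive_cst _ _ _) (is_derive1Z _ (is_derive1_expRM _ _)).
  apply: is_derive_eq (is_derive1M d1 d2) _.
  move: (expR _) (expR (- de * s)) => E F; field.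
  by rewrite !gt_eqF.
have cexp t : continuous (fun s : R => expR (- g * (t - s))).
  exact: (@continuous_fun_subl _ (fun s => expR (- g * s)) t (@continuous_expRM (- g))).
have cg k t : continuous (fun s : R => expR (- g * (t - s)) * (L + k * expR (- de * s))).
  apply: continuous_funM; first exact: cexp.
  apply: continuous_funD; first exact: cst_continuous.
  by apply: continuous_funZ; exact: continuous_expRM.
have lim k : G k t t - G k t 0 @[t --> +oo] --> L / g.
  have -> : (fun t => G k t t - G k t 0) = (fun t => L / g + k / (g - de) * expR (- de * t) -
      (L / g + k / (g - de)) * expR (- g * t)).
    apply/funext => t; rewrite /G subrr mulr0 expR0 mul1r subr0 mulr0 expR0 mulr1.
    by rewrite (mulrC (L / g + _)) (mulrAC k).
  rewrite [X in _ --> X](_ : _ = L / g + k / (g - de) * 0 - (L / g + k / (g - de)) * 0); last by rewrite !mulr0 addr0 subr0.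
  apply: cvgB; first apply: cvgD; first exact: cvg_cst.
    by apply: cvgM; [exact: cvg_cst|exact: cvg_expRNM].
  by apply: cvgM; [exact: cvg_cst|exact: cvg_expRNM].
apply: (squeeze_cvgr _ (lim (- C)) (lim C)).
near=> t.
have t0 : 0 <= t by near: t; exact: nbhs_pinfty_ge.
have cfe : continuous (fun s => expR (- g * (t - s)) * f s) by exact: continuous_funM.
apply/andP; split.
  apply: (ge_itv_Rint t0 cfe (dG _ t) (cg _ t)) => s /andP[s0 _].
  have := h s s0; rewrite ler_norml => /andP[h1 _].
  by rewrite ler_wpM2l ?expR_ge0// mulNr -lerBrDl.
apply: (le_itv_Rint t0 cfe (dG _ t) (cg _ t)) => s /andP[s0 _].
have := h s s0; rewrite ler_norml => /andP[_ h1].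
by rewrite ler_wpM2l ?expR_ge0// -lerBlDl.
Unshelve. all: by end_near.
Qed.

Lemma cvg_exp_average (L : R) f : continuous f -> exp_close f L ->
  t^-1 * \int[lebesgue_measure]_(s in `[0, t]) f s @[t --> +oo] --> L.
Proof.
move=> cf [de de0 [C C0 h]].
(* A primitive of the envelopes L + k e^{-de s}, with k = C and k = -C. *)
pose G (k : R) s := L * s - k / de * expR (- de * s).
have dG k (s : R) : is_derive s 1 (G k) (L + k * expR (- de * s)).
  apply: is_derive_eq (is_derive1B (is_derive1Z L (is_derive_id s 1))
    (is_derive1Z (k / de) (is_derive1_expRM (- de) s))) _.
  by move: (expR _) => E; field; rewrite gt_eqF.
have cg k : continuous (fun s : R => L + k * expR (- de * s)).
  apply: continuous_funD; first exact: cst_continuous.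
  by apply: continuous_funZ; exact: continuous_expRM.
have lim k : L + t^-1 * (k / de - k / de * expR (- de * t)) @[t --> +oo] --> L.
  rewrite -[X in _ --> X]addr0; apply: cvgD; first exact: cvg_cst.
  rewrite -(mul0r (k / de - k / de * 0)); apply: cvgM; first exact: cvg_invr_pinfty.
  apply: cvgB; first exact: cvg_cst.
  by apply: cvgM; [exact: cvg_cst|exact: cvg_expRNM].
have GE k t : 0 < t -> t^-1 * (G k t - G k 0) = L + t^-1 * (k / de - k / de * expR (- de * t)).
  move=> t0; rewrite /G !mulr0 expR0; move: (expR _) => E; field.
  by rewrite !gt_eqF.
apply: (squeeze_cvgr _ (lim (- C)) (lim C)).
near=> t.
have t0 : 0 < t by near: t; exact: nbhs_pinfty_gt.
rewrite -!GE// !ler_pM2l ?invr_gt0//; apply/andP; split.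
  apply: (ge_itv_Rint (ltW t0) cf (dG _) (cg _)) => s /andP[s0 _].
  by have := h s s0; rewrite ler_norml => /andP[h1 _]; rewrite mulNr -lerBrDl.
apply: (le_itv_Rint (ltW t0) cf (dG _) (cg _)) => s /andP[s0 _].
by have := h s s0; rewrite ler_norml => /andP[_ h1]; rewrite -lerBlDl.
Unshelve. all: by end_near.
Qed.

End limits_at_infinity.
Lemma exp_close_cvg (R : realType) (f : R -> R) (L : R) : exp_close f L -> f t @[t --> +oo] --> L.
Proof.
move=> [de de0 [C C0 h]].
have lim (k : R) : L + k * expR (- de * t) @[t --> +oo] --> L.
  rewrite -[X in _ --> X]addr0; apply: cvgD; first exact: cvg_cst.
  rewrite -[X in _ --> X](mulr0 k).
  by apply: cvgM; [exact: cvg_cst|exact: cvg_expRNM].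
apply: (squeeze_cvgr _ (lim (- C)) (lim C)); near=> t.
have t0 : 0 <= t by near: t; exact: nbhs_pinfty_ge.
have := h t t0; rewrite ler_norml => /andP[h1 h2].
by rewrite mulNr -lerBrDl h1 -lerBlDl h2.
Unshelve. all: by end_near.
Qed.

(** * The resolvent as a limit of truncated Laplace transforms *)

Section resolvent.
Variables (R : realType) (d : nat) (B : 'M[R]_d) (s : R) (ut : 'cV[R]_d).
Hypothesis B0 : forall i j, i != j -> 0 <= B i j.
Hypothesis ut0 : forall i, 0 < ut i 0.
Hypothesis But : B *m ut = s *: ut.
Variable zeta : R.
Hypothesis szeta : s < zeta.

(** If v B = zeta v, then |v| satisfies zeta |v| <= |v| B coordinatewise. Pairing with the positive
    eigenvector ut gives (zeta - s) <|v|, ut> <= 0, which forces v = 0. *)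
Lemma resolvent_unitmx : zeta%:M - B \in unitmx.
Proof.
rewrite -row_free_unit; apply: inj_row_free => v.
rewrite mulmxBr mul_mx_scalar => /eqP; rewrite subr_eq0 => /eqP vB.
have vj j : zeta * `|v 0 j| <= \sum_i `|v 0 i| * B i j.
  have /matrixP/(_ 0 j) := vB; rewrite !mxE (bigD1 j)//= => e.
  (* The diagonal entry may be negative, so it is moved to the side of zeta before absolute values
     are taken. *)
  have {}e : (zeta - B j j) * v 0 j = \sum_(i | i != j) v 0 i * B i j.
    by rewrite mulrBl e mulrC; ring.
  rewrite [leRHS](bigD1 j)//= -lerBlDl mulrC -mulrBr mulrC.
  apply: le_trans (_ : `|(zeta - B j j) * v 0 j| <= _).
    by rewrite normrM ler_wpM2r// ler_norm.
  rewrite e; apply: le_trans (ler_norm_sum _ _ _) _.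
  by apply: ler_sum => i ij; rewrite normrM (ger0_norm (B0 ij)).
have S0 : (zeta - s) * \sum_j `|v 0 j| * ut j 0 <= 0.
  rewrite mulrBl subr_le0.
  apply: le_trans (_ : \sum_j (\sum_i `|v 0 i| * B i j) * ut j 0 <= _).
    rewrite mulr_sumr; apply: ler_sum => j _.
    by rewrite mulrA ler_wpM2r// ltW.
  under eq_bigr do rewrite mulr_suml.
  rewrite exchange_big/= mulr_sumr; apply: ler_sum => i _.
  have /matrixP/(_ i 0) := But; rewrite !mxE => e.
  by rewrite mulrCA -e mulr_sumr; apply: ler_sum => j _; rewrite mulrA.
have T0 j : 0 <= `|v 0 j| * ut j 0 by rewrite mulr_ge0// ltW.
have /eqP : \sum_j `|v 0 j| * ut j 0 = 0.
  by apply/eqP; rewrite eq_le sumr_ge0// andbT -(pmulr_rle0 _ (_ : 0 < zeta - s))// subr_gt0.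
rewrite psumr_eq0// => /allP h; apply/matrixP => i j.
rewrite ord1 mxE; have := h j; rewrite mem_index_enum => /(_ isT).
by rewrite mulf_eq0 normr_eq0 (gt_eqF (ut0 j)) orbF => /eqP.
Qed.

Variables (m : R -> 'cV[R]_d) (b : 'cV[R]_d) (w : R).
Hypothesis s0 : 0 < s.
Hypothesis dm : forall (t : R) i, is_derive t 1 (fun t => m t i 0) ((B *m m t + b) i 0).
Hypothesis m_rate : forall i, exp_close (fun t => expR (- s * t) * m t i 0) (w * ut i 0).

Let z0 : 0 < zeta. Proof. exact: lt_trans s0 szeta. Qed.

Let cm i : continuous (fun t => m t i 0).
Proof. by move=> t; exact: is_derive1_continuous (dm t i). Qed.

Let cf i : continuous (fun t => expR (- zeta * t) * m t i 0).
Proof. by apply: continuous_funM => //; exact: continuous_expRM. Qed.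

Let J t : 'cV[R]_d := \col_i \int[lebesgue_measure]_(r in `[0, t]) (expR (- zeta * r) * m r i 0).
Let rhs t : 'cV[R]_d :=
  m 0 + zeta^-1 *: b - (expR (- zeta * t) / zeta) *: b - expR (- zeta * t) *: m t.

(** Integration of the derivative of e^{-zeta r} m(r) over [0, t]: the Laplace transform of the mean
    equation, with its boundary terms at t. *)
Let JE t : 0 <= t -> J t = invmx (zeta%:M - B) *m rhs t.
Proof.
move=> t0; suff h : (zeta%:M - B) *m J t = rhs t by rewrite -h mulKmx// resolvent_unitmx.
apply/matrixP => i j; rewrite ord1 mulmxBl mul_scalar_mx.
pose F r := -1 * (expR (- zeta * r) * m r i 0 + zeta^-1 * b i 0 * expR (- zeta * r)).
pose f r := zeta * (expR (- zeta * r) * m r i 0) - \sum_j B i j * (expR (- zeta * r) * m r j 0).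
have dF (r : R) : is_derive r 1 F (f r).
  have d1 := is_derive1_expRM (- zeta) r.
  have d2 := is_derive1D (is_derive1M d1 (dm r i)) (is_derive1Z (zeta^-1 * b i 0) d1).
  apply: is_derive_eq (is_derive1Z (-1) d2) _.
  rewrite /f !mxE; move: (expR _) => E.
  have -> : \sum_k B i k * (E * m r k 0) = E * \sum_k B i k * m r k 0.
    by rewrite mulr_sumr; apply: eq_bigr => k _; rewrite mulrCA.
  by move: (\sum_k _) => S; field; rewrite gt_eqF.
have cS : continuous (fun r => \sum_j B i j * (expR (- zeta * r) * m r j 0)).
  by apply: continuous_fun_sum => k; exact: continuous_funZ.
have cf' : continuous f by apply: continuous_funB => //; exact: continuous_funZ.
have := itv_Rint_FTC t0 dF cf'.
rewrite /f itv_RintB//; last exact: continuous_funZ.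
rewrite itv_RintZ// itv_Rint_sum; last by move=> k; exact: continuous_funZ.
under eq_bigr do rewrite itv_RintZ//.
rewrite !mxE => h.
under eq_bigr do rewrite mxE.
rewrite h /F mulr0 expR0.
by move: (expR _) => E; field; rewrite gt_eqF.
Qed.

Lemma resolvent_cvg i :
  \int[lebesgue_measure]_(r in `[0, t]) (expR (- zeta * r) * m r i 0) @[t --> +oo] -->
    (invmx (zeta%:M - B) *m (m 0 + zeta^-1 *: b)) i 0.
Proof.
have rhsk k : rhs t k 0 @[t --> +oo] --> (m 0 + zeta^-1 *: b) k 0.
  (* The boundary term vanishes because e^{-zeta t} m(t) is e^{-(zeta - s) t} times a convergent
     function. *)
  have -> : (fun t => rhs t k 0) = (fun t => (m 0 + zeta^-1 *: b) k 0 - zeta^-1 * b k 0 * expR (- zeta * t) -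
     expR (- (zeta - s) * t) * (expR (- s * t) * m t k 0)).
    apply/funext => t; rewrite !mxE mulrA -expRD.
    have -> : - (zeta - s) * t + - s * t = - zeta * t by ring.
    by ring.
  rewrite [X in _ --> X](_ : _ = (m 0 + zeta^-1 *: b) k 0 - zeta^-1 * b k 0 * 0 - 0 * (w * ut k 0));
    last by rewrite mul0r mulr0 !subr0.
  apply: cvgB; first apply: cvgB; first exact: cvg_cst.
    by apply: cvgM; [exact: cvg_cst|exact: cvg_expRNM].
  by apply: cvgM; [apply: cvg_expRNM; rewrite subr_gt0|exact: exp_close_cvg].
have lim : \sum_k invmx (zeta%:M - B) i k * rhs t k 0 @[t --> +oo] -->
    (invmx (zeta%:M - B) *m (m 0 + zeta^-1 *: b)) i 0.
  rewrite mxE; apply: cvg_sumr => k _.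
  by apply: cvgM; [exact: cvg_cst|exact: rhsk].
apply: cvg_trans lim; apply: near_eq_cvg; near=> t.
have t0 : 0 <= t by near: t; exact: nbhs_pinfty_ge.
by have /matrixP/(_ i 0) := JE t0; rewrite !mxE => ->.
Unshelve. all: by end_near.
Qed.

End resolvent.

Lemma Btilde_offdiag_ge0 (R : realType) (d : nat) (p : cbi_params R d) i j :
  admissible p -> i != j -> 0 <= Btilde p i j.
Proof.
move=> [_ [_ _ B0 _ _]] ij; rewrite mxE addr_ge0 ?B0//.
by apply: Rintegral_ge0 => z _; rewrite le_max lexx.
Qed.

(** * The conditional-mean term as a function of time *)

Section initial_term.
Variables (R : realType) (d : nat) (p : cbi_params R d).
Context (dO : measure_display) (O : measurableType dO) (P : probability O R).
Variable X : R -> O -> Rvec R d.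
Hypothesis cbiX : is_cbi p P X.
Hypothesis X02 : ('E_P[fun w => (enorm (X 0 w) ^+ 2)%R] < +oo)%E.
Variables (v : 'cV[R[i]]_d) (lambda : R[i]).
Hypothesis vl : left_eigenvector (Btilde p) lambda v.

Local Notation al := (complex.Re lambda).
Local Notation ka := (complex.Im lambda).
Local Notation B := (Btilde p).
Local Notation b := (betatilde p).
Local Notation rv := (re_mx v).
Local Notation iv := (im_mx v).
Local Notation Pint f := (P.-integrable setT (EFin \o f)).

Let mT : measurable [set: O] := measurableT.

Let gr x t := dotr (mflow p x t) rv.
Let gi x t := dotr (mflow p x t) iv.

Let dm x k (u : R) := is_derive_dotr (m := mflow p x) (dm := fun u => B *m mflow p x u + b) k
  (fun j => is_derive_mflow p x u j).

Let dgr x (u : R) : is_derive u 1 (gr x) (al * gr x u - ka * gi x u + dotr b rv).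
Proof.
have [er ei] := left_eigenvector_mxE vl.
apply: is_derive_eq (dm x rv u) _.
by rewrite dotrDl dotr_mulmx er (dotrC _ (_ - _)) dotrBl !dotrZl !(dotrC _ (mflow p x u)).
Qed.

Let dgi x (u : R) : is_derive u 1 (gi x) (ka * gr x u + al * gi x u + dotr b iv).
Proof.
have [er ei] := left_eigenvector_mxE vl.
apply: is_derive_eq (dm x iv u) _.
by rewrite dotrDl dotr_mulmx ei (dotrC _ (_ + _)) dotrDl !dotrZl !(dotrC _ (mflow p x u)).
Qed.

Let EvE' t : 0 <= t -> Ev p P X v lambda t = \int[P]_w (gr (X 0 w) t ^+ 2 + gi (X 0 w) t ^+ 2).
Proof. by move=> t0; rewrite EvE//; apply: eq_Rintegral => w _; rewrite !(dotrC _ (mflow _ _ _)). Qed.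

Let sq0 : Pint (fun w => dotr (X 0 w) rv ^+ 2 + dotr (X 0 w) iv ^+ 2).
Proof.
have := Pint_Ev cbiX X02 v (lexx 0).
by congr (integrable _ _ _); apply/funext => w /=; rewrite /mflow ode_sol0 !(dotrC _ (X 0 w)).
Qed.

(** In both cases below, the integrand of [Ev] is a multiple of |<v, X_0>|^2 plus an affine function
    of X_0, so its expectation involves only one quadratic moment and the mean. *)
Let int_sq_affine (k c0 c1 c2 : R) :
  \int[P]_w (k * (dotr (X 0 w) rv ^+ 2 + dotr (X 0 w) iv ^+ 2) +
    (c0 + c1 * dotr (X 0 w) rv + c2 * dotr (X 0 w) iv)) =
  k * (\int[P]_w (dotr (X 0 w) rv ^+ 2 + dotr (X 0 w) iv ^+ 2)) +
    (c0 + c1 * dotr (mean P X 0) rv + c2 * dotr (mean P X 0) iv).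
Proof.
pose c j := c1 * rv j 0 + c2 * iv j 0.
have E x : c0 + c1 * dotr x rv + c2 * dotr x iv = c0 + \sum_j x j 0 * c j.
  rewrite /dotr !mulr_sumr -addrA -big_split/=; congr (_ + _).
  by apply: eq_bigr => j _; rewrite /c; ring.
have [i1 e1] := Pint_affine cbiX X02 c0 c.
under eq_Rintegral do rewrite E.
rewrite (RintegralD mT)//; last exact: (rintZ mT).
by rewrite e1 (RintegralZl _ mT)// -E.
Qed.

(** For lambda = 0 the pairing of v with the mean flow grows linearly in t. *)
Lemma Ev_lambda0 : lambda = 0 -> exists a0 a1 a2 : R, forall t, 0 <= t ->
  Ev p P X v lambda t = a0 + a1 * t + a2 * t ^+ 2.
Proof.
move=> l0.
have lin x t : gr x t = dotr x rv + dotr b rv * t /\ gi x t = dotr x iv + dotr b iv * t.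
  have dr (u : R) : is_derive u 1 (fun u => gr x u - dotr b rv * u) 0.
    apply: is_derive_eq (is_derive1B (dgr x u) (is_derive1Z (dotr b rv) (is_derive_id u 1))) _.
    by rewrite l0 /=; ring.
  have di (u : R) : is_derive u 1 (fun u => gi x u - dotr b iv * u) 0.
    apply: is_derive_eq (is_derive1B (dgi x u) (is_derive1Z (dotr b iv) (is_derive_id u 1))) _.
    by rewrite l0 /=; ring.
  have := is_derive_0_is_cst t 0 dr; have := is_derive_0_is_cst t 0 di.
  rewrite !mulr0 !subr0 {2}/gr {2}/gi /mflow !ode_sol0 => <- <-.
  by rewrite !subrK.
pose m := mean P X 0.
exists (\int[P]_w (dotr (X 0 w) rv ^+ 2 + dotr (X 0 w) iv ^+ 2)).
exists (2 * dotr b rv * dotr m rv + 2 * dotr b iv * dotr m iv).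
exists (dotr b rv ^+ 2 + dotr b iv ^+ 2) => t t0.
rewrite EvE'//.
have := int_sq_affine 1 ((dotr b rv ^+ 2 + dotr b iv ^+ 2) * t ^+ 2)
  (2 * dotr b rv * t) (2 * dotr b iv * t).
rewrite -/m mul1r => e.
transitivity (\int[P]_w (dotr (X 0 w) rv ^+ 2 + dotr (X 0 w) iv ^+ 2) +
   ((dotr b rv ^+ 2 + dotr b iv ^+ 2) * t ^+ 2 + (2 * dotr b rv * t) * dotr m rv +
    (2 * dotr b iv * t) * dotr m iv)); last by rewrite -!addrA; congr (_ + _); ring.
rewrite -e; apply: eq_Rintegral => w _.
have [-> ->] := lin (X 0 w) t; ring.
Qed.

(** With q the quotient of <v, betatilde> by lambda, the mean flow satisfies <v, m(t)> + q =
    e^{lambda t} (<v, x> + q). Subtracting q inside the squared modulus leaves the leading term and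
    lower-order terms in e^{lambda t} and 1. *)
Lemma Ev_lambda_neq0 : lambda != 0 -> exists a0 a1 a2 : R, forall t, 0 <= t ->
  Ev p P X v lambda t =
  expR (2 * al * t) * fine 'E_P[fun w => sqmod (dotc v (toC (X 0 w)) + dotc v (toC b) / lambda)]
  + (a0 + a1 * ecos al ka t + a2 * esin al ka t).
Proof.
move=> l0; pose q := dotc v (toC b) / lambda.
pose q1 := complex.Re q; pose q2 := complex.Im q.
have ql : lambda * q = dotc v (toC b) by rewrite /q mulrCA divff ?mulr1.
have e1 : dotr b rv = al * q1 - ka * q2.
  by rewrite dotrC -Re_dotc -ql /q1 /q2; move: (q) (lambda) => [? ?] [? ?].
have e2 : dotr b iv = ka * q1 + al * q2.
  by rewrite dotrC -Im_dotc -ql /q1 /q2; move: (q) (lambda) => [? ?] [? ?] /=; rewrite addrC.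
have sol x t : 0 <= t ->
    gr x t + q1 = ecos al ka t * (dotr x rv + q1) - esin al ka t * (dotr x iv + q2) /\
    gi x t + q2 = ecos al ka t * (dotr x iv + q2) + esin al ka t * (dotr x rv + q1).
  move=> t0.
  have dr (u : R) : is_derive u 1 (fun u => gr x u + q1) (al * (gr x u + q1) - ka * (gi x u + q2) + 0).
    apply: is_derive_eq (is_derive1D (dgr x u) (is_derive_cst q1 u 1)) _.
    by rewrite e1; ring.
  have di (u : R) : is_derive u 1 (fun u => gi x u + q2) (ka * (gr x u + q1) + al * (gi x u + q2) + 0).
    apply: is_derive_eq (is_derive1D (dgi x u) (is_derive_cst q2 u 1)) _.
    by rewrite e2; ring.
  rewrite (planar_ode_re dr di t0) (planar_ode_im dr di t0) /gr /gi /mflow !ode_sol0.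
  by rewrite !mul0r subr0 !addr0.
pose m := mean P X 0.
pose A1 := dotr m rv + q1; pose A2 := dotr m iv + q2.
(* Read off from |z - q|^2 = |z|^2 - 2 (q1 Re z + q2 Im z) + |q|^2, where the mean of z is e^{lambda
   t} (A1 + i A2). *)
exists (q1 ^+ 2 + q2 ^+ 2), (- 2 * (q1 * A1 + q2 * A2)), (2 * (q1 * A2 - q2 * A1)) => t t0.
rewrite EvE'//.
have -> : fine 'E_P[fun w => sqmod (dotc v (toC (X 0 w)) + dotc v (toC b) / lambda)] =
    \int[P]_w (dotr (X 0 w) rv ^+ 2 + dotr (X 0 w) iv ^+ 2) +
    (q1 ^+ 2 + q2 ^+ 2 + 2 * q1 * dotr m rv + 2 * q2 * dotr m iv).
  have := int_sq_affine 1 (q1 ^+ 2 + q2 ^+ 2) (2 * q1) (2 * q2).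
  rewrite mul1r => <-; rewrite unlock /Rintegral; congr fine.
  apply: eq_integral => w _; congr (_%:E).
  rewrite -/q sqmodE !(dotrC (X 0 w)) -Re_dotc -Im_dotc /q1 /q2.
  by move: (dotc v _) (q) => [x1 x2] [y1 y2] /=; ring.
set E := expR _; set ec := ecos _ _ _; set es := esin _ _ _.
have Ee : E = ec ^+ 2 + es ^+ 2 by rewrite ecos_sqr_esin.
have := int_sq_affine E (E * (q1 ^+ 2 + q2 ^+ 2) + (q1 ^+ 2 + q2 ^+ 2) - 2 * (q1 * (ec * q1 - es * q2) + q2 * (ec * q2 + es * q1)))
  (2 * E * q1 - 2 * (q1 * ec + q2 * es)) (2 * E * q2 + 2 * (q1 * es - q2 * ec)).
rewrite -/m => e.
transitivity (\int[P]_w (E * (dotr (X 0 w) rv ^+ 2 + dotr (X 0 w) iv ^+ 2) +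
  (E * (q1 ^+ 2 + q2 ^+ 2) + (q1 ^+ 2 + q2 ^+ 2) - 2 * (q1 * (ec * q1 - es * q2) + q2 * (ec * q2 + es * q1)) +
  (2 * E * q1 - 2 * (q1 * ec + q2 * es)) * dotr (X 0 w) rv +
  (2 * E * q2 + 2 * (q1 * es - q2 * ec)) * dotr (X 0 w) iv))).
  apply: eq_Rintegral => w _.
  have [h1 h2] := sol (X 0 w) t t0.
  have -> : gr (X 0 w) t = ec * (dotr (X 0 w) rv + q1) - es * (dotr (X 0 w) iv + q2) - q1.
    by rewrite -h1 addrK.
  have -> : gi (X 0 w) t = ec * (dotr (X 0 w) iv + q2) + es * (dotr (X 0 w) rv + q1) - q2.
    by rewrite -h2 addrK.
  by rewrite Ee; move: (dotr _ rv) (dotr _ iv) => y1 y2; ring.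
rewrite e /A1 /A2; move: (Rintegral _ _ _) (dotr m rv) (dotr m iv) => I y1 y2; ring.
Qed.

End initial_term.
Lemma cvgM_bounded0 (R : realType) (f g : R -> R) : f t @[t --> +oo] --> 0 ->
  (forall t, `|g t| <= 1) -> f t * g t @[t --> +oo] --> 0.
Proof.
move=> f0 g1; have n0 : `|f t| @[t --> +oo] --> 0 by rewrite -(normr0 R); exact: cvg_norm.
have n0' : - `|f t| @[t --> +oo] --> 0 by rewrite -oppr0; exact: cvgN.
apply: (squeeze_cvgr _ n0' n0); apply: nearW => t.
by rewrite -ler_norml normrM ler_piMr.
Qed.

(** * The three growth regimes *)

Section second_moment_limit.
Variables (R : realType) (d : nat) (p : cbi_params R d).
Context (dO : measure_display) (O : measurableType dO) (P : probability O R).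
Variable X : R -> O -> Rvec R d.
Hypothesis adm : admissible p.
Hypothesis cbiX : is_cbi p P X.
Hypothesis X02 : ('E_P[fun w => (enorm (X 0 w) ^+ 2)%R] < +oo)%E.
Hypothesis mu_tail : (\sum_(l < d) \int[pmu p l]_(z in Uset)
     (enorm z ^+ 2 * (1 <= enorm z)%R%:R)%:E < +oo)%E.
Hypothesis nu_tail : (\int[pnu p]_(r in Uset)
     (enorm r ^+ 2 * (1 <= enorm r)%R%:R)%:E < +oo)%E.
Variables (v : 'cV[R[i]]_d) (lambda : R[i]).
Hypothesis vl : left_eigenvector (Btilde p) lambda v.
Hypothesis irrB : irreducible (Btilde p).
Hypothesis s0 : 0 < spectral_abscissa (Btilde p).
Variables ut u : 'cV[R]_d.
Hypothesis rpv : right_perron_vector (Btilde p) ut.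
Hypothesis lpv : left_perron_vector (Btilde p) ut u.

Local Notation al := (complex.Re lambda).
Local Notation ka := (complex.Im lambda).
Local Notation B := (Btilde p).
Local Notation b := (betatilde p).
Local Notation s := (spectral_abscissa B).
Local Notation E0 := (Ev p P X v lambda).
Local Notation m := (mflow p (mean P X 0)).
Local Notation w := (dotr u (mean P X 0) + dotr u b / s).

(** The three assumptions on h match the three time scales e^{2 Re(lambda) t}, e^{Re(lambda) t} and
    1 of [Ev]; the oscillating factors are bounded. *)
Lemma cvg_Ev_lambda_neq0 (h : R -> R) (k : R) : lambda != 0 ->
  h t * expR (2 * al * t) @[t --> +oo] --> k -> h t * expR (al * t) @[t --> +oo] --> 0 ->
  h t @[t --> +oo] --> 0 ->
  h t * E0 t @[t --> +oo] --> k * fine 'E_P[fun w => sqmod (dotc v (toC (X 0 w)) + dotc v (toC b) / lambda)].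
Proof.
move=> l0 hk ha h0; have [a0 [a1 [a2 H]]] := Ev_lambda_neq0 cbiX X02 vl l0.
set M := fine _ in H *.
have hc : h t * ecos al ka t @[t --> +oo] --> 0.
  under eq_fun do rewrite /ecos mulrA.
  by apply: cvgM_bounded0 => // t; rewrite ler_norml cos_geN1 cos_le1.
have hs : h t * esin al ka t @[t --> +oo] --> 0.
  under eq_fun do rewrite /esin mulrA.
  by apply: cvgM_bounded0 => // t; rewrite ler_norml sin_geN1 sin_le1.
have lim : h t * expR (2 * al * t) * M + (a0 * h t + a1 * (h t * ecos al ka t) + a2 * (h t * esin al ka t))
    @[t --> +oo] --> k * M.
  rewrite [X in _ --> X](_ : _ = k * M + (a0 * 0 + a1 * 0 + a2 * 0)); last by rewrite !mulr0 !addr0.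
  apply: cvgD; first by apply: cvgM => //; exact: cvg_cst.
  by apply: cvgD; [apply: cvgD|]; apply: cvgM => //; exact: cvg_cst.
apply: cvg_trans lim; apply: near_eq_cvg; near=> t.
have t0 : 0 <= t by near: t; exact: nbhs_pinfty_ge.
by rewrite H//; ring.
Unshelve. all: by end_near.
Qed.

Let m_rate i : exp_close (fun t => expR (- s * t) * m t i 0) (w * ut i 0).
Proof.
have [ut0 But _] := rpv; have [u0 uB utu] := lpv.
have utu1 : dotr u ut = 1.
  have /matrixP/(_ 0 0) := utu; rewrite !mxE mulr1n => <-.
  by apply: eq_bigr => j _; rewrite mxE mulrC.
have B0 (j k : 'I_d) : j != k -> 0 <= B j k by exact: Btilde_offdiag_ge0.
have [de de0 [C C0 h]] := perron_rate adm.1 B0 irrB ut0 u0 But uB utu1 s0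
  (fun t i => is_derive_mflow p (mean P X 0) t i).
exists de => //; exists C => // t t0.
by have := h t i t0; rewrite {2}/mflow ode_sol0.
Qed.

Let s_rate : exp_close (fun t : R => expR (- s * t)) 0.
Proof. by exists s => //; exists 1 => // t _; rewrite subr0 mul1r ger0_norm// expR_ge0. Qed.

Let cm i : continuous (fun t => m t i 0). Proof. exact: continuous_mflow. Qed.

Let ce (k t : R) : continuous (fun r : R => expR (k * (t - r))).
Proof. exact: (@continuous_fun_subl _ (fun r => expR (k * r)) t (@continuous_expRM _ k)). Qed.

Let hIl (k : R) (g : R -> R) l t : 0 <= t ->
  (forall r, k * expR (2 * al * (t - r)) = g r) ->
  k * Il P X lambda l t = \int[lebesgue_measure]_(r in `[0, t]) (g r * m r l 0).
Proof.
move=> t0 hg; rewrite /Il.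
have c : continuous (fun r => expR (2 * al * (t - r)) * m r l 0) by exact: continuous_funM.
rewrite [X in k * X](_ : _ = \int[lebesgue_measure]_(r in `[0, t]) (expR (2 * al * (t - r)) * m r l 0)).
  by rewrite -itv_RintZ//; apply: eq_Rintegral => r _; rewrite mulrA hg.
apply: eq_Rintegral => r; rewrite inE/= in_itv/= => /andP[r0 _].
by rewrite (mean_mflow adm cbiX X02 mu_tail nu_tail r0).
Qed.

Let hI (k : R) (g : R -> R) t :
  (forall r, k * expR (2 * al * (t - r)) = g r) ->
  k * I_ lambda t = \int[lebesgue_measure]_(r in `[0, t]) g r.
Proof.
move=> hg; rewrite /I_ -itv_RintZ; last exact: ce.
by apply: eq_Rintegral => r _; rewrite hg.
Qed.

Let assemble (h : R -> R) (Me k : R) (K : 'I_d -> R) :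
  h t * E0 t @[t --> +oo] --> Me -> (forall l, h t * Il P X lambda l t @[t --> +oo] --> K l) ->
  h t * I_ lambda t @[t --> +oo] --> k ->
  h t * (E0 t + \sum_l Cv p v l * Il P X lambda l t + I_ lambda t * nu_int p v) @[t --> +oo] -->
    Me + \sum_l Cv p v l * K l + k * nu_int p v.
Proof.
move=> hE hK hk.
under eq_fun do rewrite !mulrDr mulrA mulr_sumr.
apply: cvgD; last by apply: cvgM => //; exact: cvg_cst.
apply: cvgD => //; apply: cvg_sumr => l _.
by under eq_fun do rewrite mulrCA; apply: cvgM => //; exact: cvg_cst.
Qed.

Let near_cvg (f g : R -> R) (L : R) : (forall t, 0 < t -> g t = f t) ->
  f t @[t --> +oo] --> L -> g t @[t --> +oo] --> L.
Proof.
move=> fg; apply: cvg_trans; apply: near_eq_cvg; near=> t.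
by rewrite fg//; near: t; exact: nbhs_pinfty_gt.
Unshelve. all: by end_near.
Qed.

Let eqexp (x y : R) : x = y -> expR x = expR y. Proof. by move->. Qed.

Let case_lt : al < s / 2 ->
  expR (- s * t) * (E0 t + \sum_l Cv p v l * Il P X lambda l t + I_ lambda t * nu_int p v) @[t --> +oo] -->
  (s - 2 * al)^-1 * w * \sum_l Cv p v l * dotr (e_ R l) ut.
Proof.
move=> als.
have g0 : 0 < s - 2 * al by move: als; move: (s) => s'; lra.
(* The normalized kernel is a decaying exponential in t - r acting on e^{-sr} m(r), so the limit is
   a convolution limit. *)
have hg t r : expR (- s * t) * expR (2 * al * (t - r)) = expR (- (s - 2 * al) * (t - r)) * expR (- s * r).
  by rewrite -!expRD; apply: eqexp; ring.
rewrite [X in _ --> X](_ : _ = 0 + \sum_l Cv p v l * (w * ut l 0 / (s - 2 * al)) + 0 / (s - 2 * al) * nu_int p v); last first.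
  rewrite !mul0r add0r addr0 mulr_sumr; apply: eq_bigr => l _; rewrite dotr_e_.
  by move: (Cv _ _ _) w => c w'; field; rewrite gt_eqF.
apply: assemble.
(* The eigenvalue 0 can occur in this regime only, because s > 0; [Ev] then grows polynomially and
   is killed by e^{-st}. *)
- have [l0|l0] := eqVneq lambda 0; last first.
    rewrite -(mul0r (fine 'E_P[fun w => sqmod (dotc v (toC (X 0 w)) + dotc v (toC b) / lambda)])).
    apply: (cvg_Ev_lambda_neq0 (h := fun t => expR (- s * t))) => //.
    + apply: (near_cvg (f := fun t => expR (- (s - 2 * al) * t))); last exact: cvg_expRNM.
      by move=> t _; rewrite -expRD; apply: eqexp; ring.
    + have g1 : 0 < s - al by move: als s0; move: (s) => s'; lra.
      apply: (near_cvg (f := fun t => expR (- (s - al) * t))); last exact: cvg_expRNM.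
      by move=> t _; rewrite -expRD; apply: eqexp; ring.
    + exact: cvg_expRNM.
  have [a0 [a1 [a2 H]]] := Ev_lambda0 cbiX X02 vl l0.
  apply: (near_cvg (f := fun t => a0 * (t ^+ 0 * expR (- s * t)) + a1 * (t ^+ 1 * expR (- s * t)) +
     a2 * (t ^+ 2 * expR (- s * t)))).
    by move=> t t0; rewrite H ?(ltW t0)//; ring.
  rewrite [X in _ --> X](_ : _ = a0 * 0 + a1 * 0 + a2 * 0); last by rewrite !mulr0 !addr0.
  by apply: cvgD; [apply: cvgD|]; apply: cvgM; try exact: cvg_cst; exact: cvg_exprM_expRN.
- move=> l.
  apply: (near_cvg (f := fun t => \int[lebesgue_measure]_(r in `[0, t])
    (expR (- (s - 2 * al) * (t - r)) * (expR (- s * r) * m r l 0)))).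
    move=> t t0; rewrite (hIl _ (ltW t0) (hg t)).
    by apply: eq_Rintegral => r _; rewrite mulrA.
  apply: cvg_exp_conv => //; apply: continuous_funM => //; exact: continuous_expRM.
- under eq_fun do rewrite (hI (hg _)).
  by apply: cvg_exp_conv => //; exact: continuous_expRM.
Qed.

Let case_eq : al = s / 2 ->
  t^-1 * expR (- s * t) * (E0 t + \sum_l Cv p v l * Il P X lambda l t + I_ lambda t * nu_int p v) @[t --> +oo] -->
  w * \sum_l Cv p v l * dotr (e_ R l) ut.
Proof.
move=> als.
have l0 : lambda != 0.
  by apply/eqP => l0; move: als s0; rewrite l0 /=; move: (s) => s'; lra.
have s2 : 2 * al = s by rewrite als; field.
(* At the critical value the dependence on t - r cancels, and a time average of e^{-sr} m(r)
   remains. *)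
have hg t r : t^-1 * expR (- s * t) * expR (2 * al * (t - r)) = t^-1 * expR (- s * r).
  by rewrite s2 -mulrA -expRD; congr (_ * _); apply: eqexp; ring.
rewrite [X in _ --> X](_ : _ = 0 + \sum_l Cv p v l * (w * ut l 0) + 0 * nu_int p v); last first.
  rewrite !mul0r add0r addr0 mulr_sumr; apply: eq_bigr => l _; rewrite dotr_e_.
  by rewrite mulrCA.
apply: assemble.
- rewrite -(mul0r (fine 'E_P[fun w => sqmod (dotc v (toC (X 0 w)) + dotc v (toC b) / lambda)])).
  apply: (cvg_Ev_lambda_neq0 (h := fun t => t^-1 * expR (- s * t))) => //.
  + apply: (near_cvg (f := fun t => t^-1)); last exact: cvg_invr_pinfty.
    by move=> t _; rewrite s2 -mulrA -expRD mulNr addNr expR0 mulr1.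
  + have g1 : 0 < s / 2 by rewrite divr_gt0.
    apply: (near_cvg (f := fun t => t^-1 * expR (- (s / 2) * t))).
      by move=> t _; rewrite -mulrA -expRD als; congr (_ * _); apply: eqexp; field.
    rewrite -(mul0r 0); apply: cvgM; [exact: cvg_invr_pinfty|exact: cvg_expRNM].
  + rewrite -(mul0r 0); apply: cvgM; [exact: cvg_invr_pinfty|exact: cvg_expRNM].
- move=> l; have c : continuous (fun r : R => expR (- s * r) * m r l 0).
    by apply: continuous_funM => //; exact: continuous_expRM.
  apply: (near_cvg (f := fun t => t^-1 * \int[lebesgue_measure]_(r in `[0, t])
    (expR (- s * r) * m r l 0))).
    move=> t t0; rewrite (hIl _ (ltW t0) (hg t)).
    by rewrite -itv_RintZ//; apply: eq_Rintegral => r _; rewrite mulrA.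
  exact: cvg_exp_average.
- apply: (near_cvg (f := fun t => t^-1 * \int[lebesgue_measure]_(r in `[0, t]) expR (- s * r))).
    move=> t t0; rewrite (hI (hg _)) itv_RintZ//.
    exact: continuous_expRM.
  by apply: cvg_exp_average => //; exact: continuous_expRM.
Qed.

Let case_gt : s / 2 < al ->
  expR (- 2 * al * t) * (E0 t + \sum_l Cv p v l * Il P X lambda l t + I_ lambda t * nu_int p v) @[t --> +oo] -->
  fine 'E_P[fun w => sqmod (dotc v (toC (X 0 w)) + dotc v (toC b) / lambda)]
    + (2 * al)^-1 * nu_int p v
    + \sum_l Cv p v l *
        ((e_ R l)^T *m invmx ((2 * al)%:M - B) *m (mean P X 0 + (2 * al)^-1 *: b)) 0 0.
Proof.
move=> als; have [ut0 But _] := rpv.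
have sz : s < 2 * al by move: als; move: (s) => s'; lra.
have z0 : 0 < 2 * al by exact: lt_trans sz.
have al0 : 0 < al by move: z0; lra.
have l0 : lambda != 0 by apply/eqP => l0; move: al0; rewrite l0 ltxx.
(* Here the normalized integral is a Laplace transform of m at 2 Re(lambda) > s truncated at t,
   whence the resolvent in the limit. *)
have hg t r : expR (- 2 * al * t) * expR (2 * al * (t - r)) = expR (- (2 * al) * r).
  by rewrite -expRD; apply: eqexp; ring.
set M := fine _.
rewrite addrAC -(mul1r M); apply: (assemble (h := fun t => expR (- 2 * al * t))).
- apply: (cvg_Ev_lambda_neq0 (h := fun t => expR (- 2 * al * t))) => //.
  + apply: (near_cvg (f := fun=> 1)); last exact: cvg_cst.
    by move=> t _; rewrite -expRD -[RHS]expR0; apply: eqexp; ring.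
  + apply: (near_cvg (f := fun t => expR (- al * t))); last exact: cvg_expRNM.
    by move=> t _; rewrite -expRD; apply: eqexp; ring.
  + by under eq_fun do rewrite [- 2 * al]mulNr; exact: cvg_expRNM.
- move=> l; have B0 (j k : 'I_d) : j != k -> 0 <= B j k by exact: Btilde_offdiag_ge0.
  have := @resolvent_cvg R d B s ut B0 ut0 But (2 * al) sz m b w s0
    (fun t i => is_derive_mflow p (mean P X 0) t i) m_rate l.
  have -> : m 0 = mean P X 0 by rewrite /mflow ode_sol0.
  rewrite /e_ trmx_delta -mulmxA -rowE [in X in _ -> X](mxE _ _ 0 0).
  apply: near_cvg => t t0.
  exact: (hIl _ (ltW t0) (hg t)).
- pose F r := - (2 * al)^-1 * expR (- (2 * al) * r).
  have dF (r : R) : is_derive r 1 F (expR (- (2 * al) * r)).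
    apply: is_derive_eq (is_derive1Z (- (2 * al)^-1) (is_derive1_expRM (- (2 * al)) r)) _.
    by rewrite mulrA mulNr mulrN opprK mulVf ?mul1r// gt_eqF.
  apply: (near_cvg (f := fun t => (2 * al)^-1 - (2 * al)^-1 * expR (- (2 * al) * t))).
    move=> t t0; rewrite (hI (hg _)).
    rewrite (itv_Rint_FTC (ltW t0) dF); last exact: continuous_expRM.
    by rewrite /F mulr0 expR0 mulr1 opprK mulNr addrC.
  rewrite -[X in _ --> X]subr0 -[X in _ - X](mulr0 (2 * al)^-1).
  apply: cvgB; first exact: cvg_cst.
  by apply: cvgM; [exact: cvg_cst|exact: cvg_expRNM].
Qed.

Lemma cvg_second_moment :
  h p lambda t * (E0 t + \sum_l Cv p v l * Il P X lambda l t + I_ lambda t * nu_int p v) @[t --> +oo] -->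
  M2 p P X v lambda ut u.
Proof.
rewrite /M2; under eq_fun do rewrite /h.
case: ltgtP => als; [exact: case_lt|exact: case_gt|exact: case_eq].
Qed.

End second_moment_limit.

Theorem propositionB1 (R : realType) (d : nat) (p : cbi_params R d)
    (dO : measure_display) (O : measurableType dO) (P : probability O R)
    (X : R -> O -> Rvec R d) :
  admissible p ->
  is_cbi p P X ->
  ('E_P[fun w => (enorm (X 0 w) ^+ 2)%R] < +oo)%E ->
  (\sum_(l < d) \int[pmu p l]_(z in Uset)
     (enorm z ^+ 2 * (1 <= enorm z)%R%:R)%:E < +oo)%E ->
  (\int[pnu p]_(r in Uset)
     (enorm r ^+ 2 * (1 <= enorm r)%R%:R)%:E < +oo)%E ->
  forall (v : 'cV[R[i]]_d) (lambda : R[i]),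
  left_eigenvector (Btilde p) lambda v ->
  (forall t : R, 0 <= t ->
     'E_P[fun w => sqmod (dotc v (toC (X t w)))%R]%E =
     (Ev p P X v lambda t
      + \sum_(l < d) Cv p v l * Il P X lambda l t
      + I_ lambda t * nu_int p v)%:E) /\
  (irreducible (Btilde p) -> 0 < spectral_abscissa (Btilde p) ->
   forall ut u : 'cV[R]_d,
   right_perron_vector (Btilde p) ut ->
   left_perron_vector (Btilde p) ut u ->
   (fun t : R => ((h p lambda t)%:E
      * 'E_P[fun w => sqmod (dotc v (toC (X t w)))%R])%E) @ +oo
     --> (M2 p P X v lambda ut u)%:E).
Proof.
move=> adm cbiX X02 mu_tail nu_tail v lambda vl.
have E := second_moment adm cbiX X02 mu_tail nu_tail vl.
split; first exact: E.
move=> irrB s0 ut u rpv lpv.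
have lim := cvg_second_moment adm cbiX X02 mu_tail nu_tail vl irrB s0 rpv lpv.
apply: cvg_EFin; first by near=> t; rewrite E//; near: t; exact: nbhs_pinfty_ge.
apply: cvg_trans lim; apply: near_eq_cvg; near=> t.
by rewrite /= E//; near: t; exact: nbhs_pinfty_ge.
Unshelve. all: by end_near.
Qed.
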